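(* Let $\beta\ge2$, let $f:\Gamma\to\mathbb R$ be continuous, let $H(x,p)=|p|^\beta+f(x)$, let the numerical Hamiltonian be $g(x,q_1,q_2)=\big((q_1^-)^2+(q_2^+)^2\big)^{\beta/2}+f(x)$, and let the operators $V$ and $V_h$ satisfy (V1)--(V4) (listed in the context). Let $(u,m,\lambda)$ be the unique solution, with $u\in C^{2,\alpha}(\Gamma)$, $m\in C^2(\Gamma)$, $m>0$, $\lambda\in\mathbb R$, of the stationary Mean Field Game system on the network $$ \begin{cases} -\nu\,\partial^2u+H(x,\partial u)+\lambda=V[m], & x\in\Gamma,\\ \nu\,\partial^2m+\partial\big(m\,H_p(x,\partial u)\big)=0, & x\in\Gamma,\\ \int_\Gamma m\,dx=1,\quad \int_\Gamma u\,dx=0, \end{cases} $$ with the transition conditions at every vertex $v_i$, $i\in I$: $$\sum_{j\in\mathrm{Inc}_i}\nu_j\partial_ju(v_i)=0,\qquad \sum_{j\in\mathrm{Inc}_i}\big[\nu_j\partial_jm(v_i)+H_{j,p}(v_i,\partial_ju)\,m_j(v_i)\big]=0,\qquad u_j(v_i)=u_k(v_i),\ m_j(v_i)=m_k(v_i)\ \ \forall j,k\in\mathrm{Inc}_i .$$ Let $(U^h,M^h,\Lambda^h)$ be the solutions of the scheme $$ \begin{cases} -\nu_j (D^2_h U)_{j,k}+g(x_{j,k},[D_hU]_{j,k})+\Lambda=(V_h[M])_{j,k}, & k=1,\dots,N^h_j-1,\ j\in J,\\ \nu_j(D^2_hM)_{j,k}+\mathcal B^h(U,M)_{j,k}=0,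 & k=1,\dots,N^h_j-1,\ j\in J,\\ \mathcal S^h(U,V_h[M]-\Lambda)_i=0,\quad \mathcal T^h(M,U)_i=0,\quad U \text{ continuous at } v_i, & i\in I,\\ M\in\mathcal K_h,\qquad (U,1)_2=0. \end{cases} $$ Then $$\lim_{|h|\to0}\ \|U^h-u\|_\infty+\|M^h-m\|_\infty+|\Lambda^h-\lambda|=0,$$ where $\|U^h-u\|_\infty=\max_{j,k}|U^h_{j,k}-u_j(y_{j,k})|$ and similarly for $\|M^h-m\|_\infty$.
   Context: Network. $\Gamma=(\mathcal V,\mathcal E)$ is a connected network: a finite set of vertices $\mathcal V=\{v_i\}_{i\in I}\subset\mathbb R^n$ and a finite collection $\mathcal E=\{e_j\}_{j\in J}$ of continuous non self-intersecting arcs with endpoints in $\mathcal V$; $e_j$ is parametrized by a smooth $\pi_j:[0,l_j]\to\mathbb R^n$, $l_j>0$. The network has no boundary, i.e. transition conditions are imposed at every vertex. $\nu=(\nu_j)_{j\in J}$, $\nu_j>0$, are given. $\mathrm{Inc}_i^+=\{j: v_i=\pi_j(0)\}$, $\mathrm{Inc}_i^-=\{j: v_i=\pi_j(l_j)\}$, $\mathrm{Inc}_i=\mathrm{Inc}_i^+\cup \mathrm{Inc}_i^-$ (edges incident to $v_i$). Functions on $\Gamma$. For $u:\Gamma\to\mathbb R$, $u_j:[0,l_j]\to\mathbb R$ is its restriction to $e_j$ in the coordinate $y=\pi_j^{-1}(x)$. Differential equations on $\Gamma$ are understood on each edge in this coordinate (with $\nu=\nu_j$, $H=H_j$ on $e_j$),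 $\int_\Gamma u\,dx=\sum_j\int_0^{l_j}u_j\,dy$, and $H_p$ ($H_{j,p}$ on $e_j$) is the derivative of $H$ in $p$. $C^{2,\alpha}(\Gamma)$, $C^2(\Gamma)$ are the continuous functions on $\Gamma$ whose restrictions $u_j$ are of class $C^{2,\alpha}$, $C^2$ on $[0,l_j]$. The oriented derivative at $v_i$ along $e_j$ is $\partial_ju(v_i)=\lim_{t\to0^+}(u_j(t)-u_j(0))/t$ if $v_i=\pi_j(0)$ and $\partial_ju(v_i)=\lim_{t\to0^+}(u_j(l_j-t)-u_j(l_j))/t$ if $v_i=\pi_j(l_j)$. Grid. A discretization step is $h=(h_j)_{j\in J}$, $h_j>0$, with $N^h_j=l_j/h_j$ an integer ($\ge 2$); $|h|=\max_jh_j$; $y_{j,k}=kh_j$, $x_{j,k}=\pi_j(y_{j,k})$, $0\le k\le N^h_j$. A grid function is a family $U=(U_{j,k})_{j\in J,\,0\le k\le N_j^h}$. It is continuous at $v_i$ if its values at all the grid indices corresponding to $v_i$ (index $(j,0)$ for $j\in\mathrm{Inc}_i^+$, index $(j,N^h_j)$ for $j\in\mathrm{Inc}_i^-$) coincide; it is continuous if it is continuous at every $v_i$. Constants are identified with constant grid functions. $\|U\|_\infty=\max_{j,k}|U_{j,k}|$. $q^+=\max(q,0)$, $q^-=\max(-q,0)$; $g(x_{j,k},q)$ for $q=(q_1,q_2)^T$ means $g(x_{j,k},q_1,q_2)$. Operators. $(D^+U)_{j,k}=(U_{j,k+1}-U_{j,k})/h_j$; $[D_hU]_{j,k}=((D^+U)_{j,k},(D^+U)_{j,k-1})^T$;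 $(D^2_hU)_{j,k}=(U_{j,k-1}-2U_{j,k}+U_{j,k+1})/h_j^2$. $$(U,W)_2=\sum_{j\in J}\sum_{k=1}^{N^h_j-1}h_jU_{j,k}W_{j,k}+\sum_{i\in I}\Big(\sum_{j\in\mathrm{Inc}_i^+}\tfrac{h_j}{2}U_{j,0}W_{j,0}+\sum_{j\in\mathrm{Inc}_i^-}\tfrac{h_j}{2}U_{j,N^h_j}W_{j,N^h_j}\Big).$$ $\mathcal K_h=\{M \text{ continuous grid function}: M_{j,k}\ge0,\ (M,1)_2=1\}$. $$\mathcal S^h(U,V)_i=\sum_{j\in\mathrm{Inc}_i^+}\big[\nu_j(D^+U)_{j,0}+\tfrac{h_j}{2}V_{j,0}\big]-\sum_{j\in\mathrm{Inc}_i^-}\big[\nu_j(D^+U)_{j,N^h_j-1}-\tfrac{h_j}{2}V_{j,N^h_j}\big],$$ $$\mathcal T^h(M,U)_i=\sum_{j\in\mathrm{Inc}_i^+}\big[\nu_j(D^+M)_{j,0}+M_{j,1}\tfrac{\partial g}{\partial q_2}(x_{j,1},[D_hU]_{j,1})\big]-\sum_{j\in\mathrm{Inc}_i^-}\big[\nu_j(D^+M)_{j,N^h_j-1}+M_{j,N^h_j-1}\tfrac{\partial g}{\partial q_1}(x_{j,N^h_j-1},[D_hU]_{j,N^h_j-1})\big].$$ For $k=1,\dots,N_j^h-1$, with $g^s_{j,k}:=\frac{\partial g}{\partial q_s}(x_{j,k},[D_hU]_{j,k})$, $s=1,2$, $$\mathcal B^h(U,M)_{j,k}=\tfrac1{h_j}\big[M_{j,k}g^1_{j,k}-M_{j,k-1}g^1_{j,k-1}+M_{j,k+1}g^2_{j,k+1}-M_{j,k}g^2_{j,k}\big],$$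 where the term $M_{j,k-1}g^1_{j,k-1}$ is omitted when $k=1$ and the term $M_{j,k+1}g^2_{j,k+1}$ is omitted when $k=N^h_j-1$. Coupling. $V$ maps densities on $\Gamma$ to functions on $\Gamma$; for each $h$, its approximation $V_h$ maps $\mathcal K_h$ to grid functions. Assumptions: (V1) $V_h$ is continuous and maps $\mathcal K_h$ into a bounded set of grid functions. (V2) $V_h$ is monotone in the sense that $(V_h[M]-V_h[\bar M],M-\bar M)_2\le0\Rightarrow M=\bar M$. (V3) There is $C$ independent of $h$ such that for all $M\in\mathcal K_h$: $\|V_h[M]\|_\infty\le C$ and $|(V_h[M])_{j,k}-(V_h[M])_{j,\ell}|\le C|y_{j,k}-y_{j,\ell}|$ for $k,\ell=0,\dots,N^h_j$, $j\in J$. (V4) There is a continuous increasing function $\omega$ with $\lim_{t\to0^+}\omega(t)=0$ such that for any $m\in\mathcal K:=\{\mu\in C^{0,\alpha}(\Gamma):\int_\Gamma\mu\,dx=1\}$ and $M\in\mathcal K_h$, $\|V[m]-V_h[M]\|_\infty\le\omega(\|m-\mathcal I^h(M)\|_\infty)$, where $\mathcal I^h(M)$ is the continuous piecewise linear reconstruction of $M$ on $\Gamma$ and the norm on the left is the maximum over the grid nodes. *)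

(* Defs.v *)
From HB Require Import structures.
From mathcomp Require Import all_boot all_order all_algebra.
From mathcomp Require Import all_classical all_reals all_analysis.

Set Implicit Arguments.
Unset Strict Implicit.
Unset Printing Implicit Defensive.

Import Order.TTheory GRing.Theory Num.Theory.
Import numFieldNormedType.Exports.

Local Open Scope classical_set_scope.
Local Open Scope ring_scope.

(* Calculus on a closed segment [0, l].  Difference quotients are taken inside
   [0, l], so the derivatives at 0 and l are one-sided and the values of the
   function outside [0, l] are irrelevant. *)
Section Segment.
Context {R : realType}.
Implicit Types (l a y : R) (w : R -> R).

Definition quot_filter l w y : set_system R :=
  (w z - w y) / (z - y) @[z --> within `[0, l] y^'].

Definition derivable_seg l w : Prop :=
  forall y, y \in `[0, l] -> cvg (quot_filter l w y).

Definition dseg l w : R -> R := fun y => lim (quot_filter l w y).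

Definition C2_seg l w : Prop :=
  [/\ derivable_seg l w, derivable_seg l (dseg l w) &
      {within `[0, l], continuous (dseg l (dseg l w))}].

Definition smooth_seg l w : Prop :=
  forall k, derivable_seg l (iter k (dseg l) w).

Definition holder_seg l a w : Prop :=
  exists C : R, forall y z, y \in `[0, l] -> z \in `[0, l] ->
    `|w y - w z| <= C * `|y - z| `^ a.

Definition C2holder_seg l a w : Prop :=
  C2_seg l w /\ holder_seg l a (dseg l (dseg l w)).

End Segment.

Record network (R : realType) (n : nat) (I J : finType) := Network {
  vtx : I -> 'rV[R]_n;
  len : J -> R;
  arc : J -> R -> 'rV[R]_n;
  vtx_inj : injective vtx;
  len_gt0 : forall j, 0 < len j;
  arc_smooth : forall j c, smooth_seg (len j) (fun y => arc j y 0 c);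
  arc_inj : forall j, {in `[0, len j] &, injective (arc j)};
  arc_source : forall j, exists i, arc j 0 = vtx i;
  arc_target : forall j, exists i, arc j (len j) = vtx i;
  vtx_connect : forall i i', connect (fun a b => [exists j,
    ((arc j 0 == vtx a) && (arc j (len j) == vtx b)) ||
    ((arc j 0 == vtx b) && (arc j (len j) == vtx a))]) i i' }.

(* A function on the network is represented by a function on the ambient space,
   of which only the values on [carrier G] matter; [edge G u j] is u_j. *)
Section NetworkFunctions.
Context {R : realType} {n : nat} {I J : finType} (G : network R n I J).
Implicit Types (u : 'rV[R]_n -> R) (i : I) (j : J).

Definition carrier : set 'rV[R]_n :=
  [set x | (exists i, x = vtx G i) \/
           (exists j, exists2 y, y \in `[0, len G j] & x = arc G j y)].

Definition incp i j : bool := vtx G i == arc G j 0.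
Definition incm i j : bool := vtx G i == arc G j (len G j).
Definition inc i j : bool := incp i j || incm i j.

Definition edge u j : R -> R := fun y => u (arc G j y).

(* edge coordinate of the vertex i on an incident edge j; an arc is injective,
   so [incp i j] and [incm i j] exclude each other *)
Definition vcoord i j : R := if incp i j then 0 else len G j.

Definition oriented_deriv u i j : R :=
  if incp i j
  then lim ((edge u j t - edge u j 0) / t @[t --> 0^'+])
  else lim ((edge u j (len G j - t) - edge u j (len G j)) / t @[t --> 0^'+]).

Definition net_integral u : R :=
  \sum_j \int[lebesgue_measure]_(y in `[0, len G j]) edge u j y.

Definition net_continuous u : Prop := {within carrier, continuous u}.

Definition net_holder (a : R) u : Prop :=
  net_continuous u /\ forall j, holder_seg (len G j) a (edge u j).

Definition net_C2 u : Prop :=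
  net_continuous u /\ forall j, C2_seg (len G j) (edge u j).

Definition net_C2holder (a : R) u : Prop :=
  net_continuous u /\ forall j, C2holder_seg (len G j) a (edge u j).

(* sup norm on the network of a function given in edge coordinates *)
Definition net_norm (w : J -> R -> R) : R :=
  sup [set r | exists j, exists2 y, y \in `[0, len G j] & r = `|w j y|].

End NetworkFunctions.

Section Hamiltonians.
Context {R : realType} {n : nat}.
Variables (beta : R) (f : 'rV[R]_n -> R).

Definition ham (x : 'rV[R]_n) (p : R) : R := `|p| `^ beta + f x.

Definition ham_p (x : 'rV[R]_n) (p : R) : R := derive1 (ham x) p.

Definition num_ham (x : 'rV[R]_n) (q1 q2 : R) : R :=
  (Num.max (- q1) 0 ^+ 2 + Num.max q2 0 ^+ 2) `^ (beta / 2) + f x.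

Definition num_ham_q1 (x : 'rV[R]_n) (q1 q2 : R) : R :=
  derive1 (fun q => num_ham x q q2) q1.

Definition num_ham_q2 (x : 'rV[R]_n) (q1 q2 : R) : R :=
  derive1 (fun q => num_ham x q1 q) q2.

End Hamiltonians.

Section StationarySystem.
Context {R : realType} {n : nat} {I J : finType} (G : network R n I J).
Variables (nu : J -> R) (alpha beta : R) (f : 'rV[R]_n -> R).
Variable V : ('rV[R]_n -> R) -> 'rV[R]_n -> R.

Definition hjb_equation (u m : 'rV[R]_n -> R) (lambda : R) : Prop :=
  forall j y, y \in `]0, len G j[ ->
    let du := dseg (len G j) (edge G u j) in
    - nu j * dseg (len G j) du y + ham beta f (arc G j y) (du y) + lambda
    = edge G (V m) j y.

Definition fp_equation (u m : 'rV[R]_n -> R) : Prop :=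
  forall j y, y \in `]0, len G j[ ->
    let d := dseg (len G j) in
    let du := d (edge G u j) in
    nu j * d (d (edge G m j)) y
    + d (fun z => edge G m j z * ham_p beta f (arc G j z) (du z)) y = 0.

Definition transition_conditions (u m : 'rV[R]_n -> R) : Prop :=
  forall i,
    [/\ \sum_(j | inc G i j) nu j * oriented_deriv G u i j = 0,
        \sum_(j | inc G i j)
          (nu j * oriented_deriv G m i j
           + ham_p beta f (vtx G i) (oriented_deriv G u i j)
             * edge G m j (vcoord G i j)) = 0 &
        forall j k, inc G i j -> inc G i k ->
          edge G u j (vcoord G i j) = edge G u k (vcoord G i k) /\
          edge G m j (vcoord G i j) = edge G m k (vcoord G i k)].

Definition mfg_solution (u m : 'rV[R]_n -> R) (lambda : R) : Prop :=
  [/\ net_C2holder G alpha u,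
      net_C2 G m /\ (forall x, carrier G x -> 0 < m x),
      hjb_equation u m lambda /\ fp_equation u m,
      net_integral G m = 1 /\ net_integral G u = 0 &
      transition_conditions u m].

End StationarySystem.

Record step (R : realType) (n : nat) (I J : finType) (G : network R n I J) :=
  Step {
  stp :> J -> R;
  nst : J -> nat;
  stp_gt0 : forall j, 0 < stp j;
  nst_ge2 : forall j, (2 <= nst j)%N;
  nst_stp : forall j, (nst j)%:R * stp j = len G j }.

Section StepFilter.
Context {R : realType} {n : nat} {I J : finType} (G : network R n I J).

Definition mesh (h : step G) : R := \big[Num.max/0]_j h j.

(* the filter of "|h| tends to 0" *)
Definition mesh_to0 : set_system (step G) :=
  filter_from [set d : R | 0 < d] (fun d => [set h | mesh h < d]).

#[global] Instance mesh_to0_filter : Filter mesh_to0.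
Proof.
apply: filter_from_filter; first by exists 1 => /=.
move=> d e /= d0 e0; exists (Num.min d e) => /=; first by rewrite lt_min d0.
by move=> h /=; rewrite lt_min => /andP[].
Qed.

End StepFilter.

Arguments mesh_to0 {R n I J} G _.

Section Grid.
Context {R : realType} {n : nat} {I J : finType} {G : network R n I J}.
Variable h : step G.

Definition gridfun := forall j : J, 'I_(nst h j).+1 -> R.

Implicit Types (U W M : gridfun) (j : J) (i : I).

(* U_{j,k}; meaningful for k <= N_j *)
Definition gat U j (k : nat) : R := U j (inord k).

Definition ycoord j (k : nat) : R := k%:R * h j.
Definition node j (k : nat) : 'rV[R]_n := arc G j (ycoord j k).

Definition grid_const (c : R) : gridfun := fun _ _ => c.
Definition grid_sub U W : gridfun := fun j k => U j k - W j k.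
Definition grid_proj (u : 'rV[R]_n -> R) : gridfun := fun j k => u (node j k).

Definition grid_norm U : R :=
  \big[Num.max/0]_j \big[Num.max/0]_(k < (nst h j).+1) `|U j k|.

Definition gcontinuous_at U i : Prop :=
  exists c : R, (forall j, incp G i j -> gat U j 0 = c) /\
                (forall j, incm G i j -> gat U j (nst h j) = c).

Definition gcontinuous U : Prop := forall i, gcontinuous_at U i.

Definition Dp U j (k : nat) : R := (gat U j k.+1 - gat U j k) / h j.

Definition D2 U j (k : nat) : R :=
  (gat U j k.-1 - 2 * gat U j k + gat U j k.+1) / h j ^+ 2.

Definition ginner U W : R :=
  \sum_j \sum_(1 <= k < nst h j) h j * gat U j k * gat W j k
  + \sum_i (\sum_(j | incp G i j) h j / 2 * gat U j 0 * gat W j 0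
            + \sum_(j | incm G i j)
                h j / 2 * gat U j (nst h j) * gat W j (nst h j)).

Definition grid_density M : Prop :=
  [/\ gcontinuous M, forall j k, 0 <= M j k & ginner M (grid_const 1) = 1].

Definition S_op (nu : J -> R) U W i : R :=
  \sum_(j | incp G i j) (nu j * Dp U j 0 + h j / 2 * gat W j 0)
  - \sum_(j | incm G i j)
      (nu j * Dp U j (nst h j).-1 - h j / 2 * gat W j (nst h j)).

Section Hamiltonian.
Variables (beta : R) (f : 'rV[R]_n -> R).

(* [D_h U]_{j,k} = (D^+ U_{j,k}, D^+ U_{j,k-1}) *)
Definition g_at U j (k : nat) : R :=
  num_ham beta f (node j k) (Dp U j k) (Dp U j k.-1).
Definition g1_at U j (k : nat) : R :=
  num_ham_q1 beta f (node j k) (Dp U j k) (Dp U j k.-1).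
Definition g2_at U j (k : nat) : R :=
  num_ham_q2 beta f (node j k) (Dp U j k) (Dp U j k.-1).

Definition B_op U M j (k : nat) : R :=
  (gat M j k * g1_at U j k
   - (if k == 1%N then 0 else gat M j k.-1 * g1_at U j k.-1)
   + (if k.+1 == nst h j then 0 else gat M j k.+1 * g2_at U j k.+1)
   - gat M j k * g2_at U j k) / h j.

Definition T_op (nu : J -> R) M U i : R :=
  \sum_(j | incp G i j) (nu j * Dp M j 0 + gat M j 1 * g2_at U j 1)
  - \sum_(j | incm G i j)
      (nu j * Dp M j (nst h j).-1
       + gat M j (nst h j).-1 * g1_at U j (nst h j).-1).

Definition scheme_solution (nu : J -> R) (Vh : gridfun -> gridfun)
    U M (Lambda : R) : Prop :=
  [/\ forall j k, (1 <= k < nst h j)%N ->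
        - nu j * D2 U j k + g_at U j k + Lambda = gat (Vh M) j k,
      forall j k, (1 <= k < nst h j)%N -> nu j * D2 M j k + B_op U M j k = 0,
      forall i, [/\ S_op nu U (grid_sub (Vh M) (grid_const Lambda)) i = 0,
                    T_op nu M U i = 0 & gcontinuous_at U i],
      grid_density M &
      ginner U (grid_const 1) = 0].

End Hamiltonian.

(* continuous piecewise linear reconstruction, in edge coordinates, as a
   combination of hat functions *)
Definition interp M : J -> R -> R := fun j y =>
  \sum_(k < (nst h j).+1) M j k * Num.max 0 (1 - `|y / h j - k%:R|).

End Grid.

Arguments grid_proj {R n I J G} h u _ _.

Section Coupling.
Context {R : realType} {n : nat} {I J : finType} (G : network R n I J).
Variable V : ('rV[R]_n -> R) -> 'rV[R]_n -> R.
Variable Vh : forall h : step G, gridfun h -> gridfun h.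

Definition coupling_V1 : Prop := forall h : step G,
  (forall M, grid_density M -> forall e : R, 0 < e ->
     exists2 d : R, 0 < d & forall M', grid_density M' ->
       grid_norm (grid_sub M' M) < d -> grid_norm (grid_sub (Vh M') (@Vh h M)) < e) /\
  (exists C : R, forall M, grid_density M -> grid_norm (@Vh h M) <= C).

Definition coupling_V2 : Prop := forall (h : step G) (M M' : gridfun h),
  grid_density M -> grid_density M' ->
  ginner (grid_sub (Vh M) (Vh M')) (grid_sub M M') <= 0 -> M = M'.

Definition coupling_V3 : Prop := exists C : R,
  forall (h : step G) (M : gridfun h), grid_density M ->
    grid_norm (Vh M) <= C /\
    forall j (k l : 'I_(nst h j).+1),
      `|Vh M k - Vh M l| <= C * `|ycoord h j k - ycoord h j l|.

Definition coupling_V4 (alpha : R) : Prop := exists omega : R -> R,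
  [/\ {within `[0, +oo[, continuous omega},
      {in `[0, +oo[ &, {homo omega : s t / s <= t}},
      omega t @[t --> 0^'+] --> 0 &
      forall (m : 'rV[R]_n -> R) (h : step G) (M : gridfun h),
        net_holder G alpha m -> net_integral G m = 1 -> grid_density M ->
        grid_norm (grid_sub (grid_proj h (V m)) (Vh M))
        <= omega (net_norm G (fun j y => edge G m j y - interp M j y))].

End Coupling.

(* Main.v *)
Require Import Defs.
From HB Require Import structures.
From mathcomp Require Import all_boot all_order all_algebra.
From mathcomp Require Import all_classical all_reals all_analysis.
From mathcomp Require Import ring lra.
(* After the cyclic arcs of sequences, [arc] is again that of a network. *)
Require Import Defs.

Set Implicit Arguments.
Unset Strict Implicit.
Unset Printing Implicit Defensive.

Import Order.TTheory GRing.Theory Num.Theory.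
Import numFieldNormedType.Exports.

Local Open Scope classical_set_scope.
Local Open Scope ring_scope.

(** Let [w] be the sampling of [u] on the grid and [mu] that of [m], normalized
    to mass one. They solve the scheme up to residuals. Pair the difference of
    the two Hamilton-Jacobi equations with [M - mu] and that of the two
    Fokker-Planck equations with [U - w]: the diffusion cancels and there
    remains ([gap_identity])

      sum of h M gap(U, w) + sum of h mu gap(w, U) + (Vh M - Vh mu, M - mu)
        = residuals,

    where [gap] is the distance of the numerical Hamiltonian to its tangent
    plane. The three terms on the left are nonnegative, the third by the
    monotonicity of the coupling. Clarkson's inequality makes the gap coercive
    ([gap_ge]) and [mu] is bounded below, so the upwind slopes of [U] converge
    to those of [u] in L^2 once the residuals, weighted by [M - mu] and by the
    slopes of [U - w], tend to zero.

    This requires bounds uniform in the grid. Testing the scheme with its own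
    solution bounds [Lambda] from below ([ergodic_ge]), and testing it with
    constants then bounds the Hamiltonian in L^1. Hence the second differences
    of [U] are bounded in L^1 and its slopes uniformly ([slope_le]). For the
    density, write the Fokker-Planck equation for the ratio [M / mu]: the
    zeroth-order term is reduced to the residual flux of [mu], and an energy
    estimate bounds the ratio ([energy_estimate], [ratio_le]).

    The conclusions follow one after the other. The difference [U - w] is
    continuous at the vertices, its total variation tends to zero and so does
    its mean; as the network is connected it is uniformly small ([osc_le],
    [value_near]). The residual flux of [mu] for the drift of [U] now tends to
    zero in L^2, and the energy estimate gives M / mu -> 1 uniformly
    ([ratio_to1_near]). The coupling then converges, and the sum of the
    Hamilton-Jacobi equation over the network determines [Lambda]
    ([ergodic_near]). *)

(** * Powers of sums of two squares *)

Section PowerInequalities.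
Context {R : realType}.
Implicit Types a b s t x z : R.

Lemma powR_continuous_gt0 s x : 0 < x -> {for x, continuous (@powR R ^~ s)}.
Proof.
move=> x0; apply: differentiable_continuous; apply/derivable1_diffP.
by apply: derivable_powR; rewrite in_itv/= andbT.
Qed.

Lemma powR_tangent s a b : 1 <= s -> 0 <= a -> 0 <= b ->
  a `^ s + s * a `^ (s - 1) * (b - a) <= b `^ s.
Proof.
move=> s1; have s0 : 0 < s by lra.
rewrite le0r => /orP[/eqP->|a0].
  rewrite subr0 (@powR0 _ s) ?gt_eqF// add0r => b0.
  have [->|sn1] := eqVneq s 1; first by rewrite subrr powRr0 powRr1// !mul1r.
  by rewrite powR0 ?mulr0 ?mul0r ?powR_ge0// subr_eq0.
rewrite le0r => /orP[/eqP->|b0].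
  rewrite sub0r (@powR0 _ s) ?gt_eqF// mulrN -mulrA [_ * a]mulrC mulr_powRB1 ?(ltW a0)//.
  by have := powR_ge0 a s; nra.
have dP x : 0 < x -> is_derive x 1 (@powR R ^~ s) (s * x `^ (s - 1)).
  by move=> x0; exact: is_derive1_powR.
have cP c d : 0 < c -> {within `[c, d], continuous (@powR R ^~ s)}.
  move=> c0; apply: continuous_in_subspaceT => x.
  rewrite inE/= in_itv/= => /andP[cx _]; apply: powR_continuous_gt0; lra.
have [ab|ba|->] := ltgtP a b; last by rewrite subrr mulr0 addr0.
- have dab x : x \in `]a, b[ -> is_derive x 1 (@powR R ^~ s) (s * x `^ (s - 1)).
    by rewrite in_itv/= => /andP[ax _]; apply: dP; lra.
  have [c] := MVT ab dab (cP a b a0); rewrite in_itv/= => /andP[ac cb].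
  have : a `^ (s - 1) <= c `^ (s - 1).
    by apply: ge0_ler_powR; rewrite ?nnegrE; lra.
  move=> le /eqP; rewrite subr_eq => /eqP->; rewrite addrC lerD2r.
  by rewrite ler_wpM2r; [| lra | rewrite ler_pM2l].
- have dab x : x \in `]b, a[ -> is_derive x 1 (@powR R ^~ s) (s * x `^ (s - 1)).
    by rewrite in_itv/= => /andP[ax _]; apply: dP; lra.
  have [c] := MVT ba dab (cP b a b0); rewrite in_itv/= => /andP[bc ca].
  have : c `^ (s - 1) <= a `^ (s - 1).
    by apply: ge0_ler_powR; rewrite ?nnegrE; lra.
  move=> le e; suff : a `^ s - b `^ s <= s * a `^ (s - 1) * (a - b) by lra.
  by rewrite e ler_wpM2r; [| lra | rewrite ler_pM2l].
Qed.

Lemma powR_midpoint s a b : 1 <= s -> 0 <= a -> 0 <= b ->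
  2 * ((a + b) / 2) `^ s <= a `^ s + b `^ s.
Proof.
move=> s1 a0 b0; have c0 : 0 <= (a + b) / 2 by lra.
have := powR_tangent s1 c0 a0; have := powR_tangent s1 c0 b0.
set c := (a + b) / 2 => hb ha.
have -> : 2 * c `^ s = (c `^ s + s * c `^ (s - 1) * (a - c)) +
    (c `^ s + s * c `^ (s - 1) * (b - c)) by rewrite /c; field.
exact: lerD.
Qed.

Lemma powR_superadd s a b : 1 <= s -> 0 <= a -> 0 <= b ->
  a `^ s + b `^ s <= (a + b) `^ s.
Proof.
move=> s1 a0 b0; have s0 : 0 < s by lra.
rewrite -!(mulr_powRB1 _ s0)// ?addr_ge0// mulrDl lerD// ler_wpM2l//.
  by apply: ge0_ler_powR; rewrite ?nnegrE; lra.
by apply: ge0_ler_powR; rewrite ?nnegrE; lra.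
Qed.

(** Written this way, with the factor [b], the estimate holds for every
    exponent [s >= 0], although the power itself is not Lipschitz at 0
    when [s < 1]. *)
Lemma powR_sub_weighted s a b : 0 <= s -> 0 <= b <= a ->
  b * (a `^ s - b `^ s) <= s * a `^ s * (a - b).
Proof.
move=> s0 /andP[b0 ba]; have a0 : 0 <= a by lra.
have s1 : 1 <= s + 1 by lra.
have s1' : 0 < s + 1 by lra.
have := powR_tangent s1 a0 b0.
have -> : s + 1 - 1 = s by lra.
have eM x : 0 <= x -> x `^ (s + 1) = x * x `^ s.
  by move=> x0; rewrite -(mulr_powRB1 x0 s1'); congr (_ * _ `^ _); lra.
rewrite !eM//; nra.
Qed.

End PowerInequalities.

(** The function (x, z) |-> (x^2 + z^2)^(beta/2) and its gradient, up to the
    factor [beta]; the numerical Hamiltonian is its composition with the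
    negative and positive parts of the one-sided slopes. *)
Section PowerOfNorm.
Context {R : realType}.
Variable beta : R.
Implicit Types x z : R.

Definition sqn x z : R := x ^+ 2 + z ^+ 2.
Definition npow x z : R := sqn x z `^ (beta / 2).
Definition nslope x z : R := sqn x z `^ (beta / 2 - 1).

Lemma sqn_ge0 x z : 0 <= sqn x z.
Proof. by rewrite addr_ge0 ?sqr_ge0. Qed.

Lemma npow_ge0 x z : 0 <= npow x z. Proof. exact: powR_ge0. Qed.
Lemma nslope_ge0 x z : 0 <= nslope x z. Proof. exact: powR_ge0. Qed.

Lemma npowE x z (beta2 : 2 <= beta) : npow x z = sqn x z * nslope x z.
Proof.
have b0 : 0 < beta / 2 by lra.
by rewrite /npow /nslope mulr_powRB1 ?sqn_ge0.
Qed.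

Lemma npow_convex x z x' z' (beta2 : 2 <= beta) :
  npow x z + beta * nslope x z * (x * (x' - x) + z * (z' - z)) <= npow x' z'.
Proof.
have b1 : 1 <= beta / 2 by lra.
apply: le_trans (powR_tangent b1 (sqn_ge0 x z) (sqn_ge0 x' z')).
rewrite lerD2l -/(nslope x z).
have -> : beta / 2 * nslope x z * (sqn x' z' - sqn x z) =
   beta * nslope x z * ((sqn x' z' - sqn x z) / 2) by field.
rewrite ler_wpM2l ?mulr_ge0 ?nslope_ge0//; first lra.
by have := sqr_ge0 (x' - x); have := sqr_ge0 (z' - z); rewrite /sqn; nra.
Qed.

(** Clarkson's inequality: the parallelogram identity followed by the
    convexity and the superadditivity of t |-> t^(beta/2). *)
Lemma npow_clarkson x z x' z' (beta2 : 2 <= beta) :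
  2 * (npow x z + npow x' z') <= npow (x + x') (z + z') + npow (x - x') (z - z').
Proof.
have b1 : 1 <= beta / 2 by lra.
apply: le_trans (powR_midpoint b1 (sqn_ge0 _ _) (sqn_ge0 _ _)).
rewrite ler_pM2l//.
have -> : (sqn (x + x') (z + z') + sqn (x - x') (z - z')) / 2 =
  sqn x z + sqn x' z' by rewrite /sqn; field.
exact: powR_superadd (sqn_ge0 _ _) (sqn_ge0 _ _).
Qed.

(** Uniform convexity of power type beta, from Clarkson's inequality at the
    midpoint and the tangent plane there. *)
Lemma npow_gap x z x' z' (beta2 : 2 <= beta) :
  npow x z + beta * nslope x z * (x * (x' - x) + z * (z' - z))
  + 2 * (sqn (x' - x) (z' - z) / 4) `^ (beta / 2) <= npow x' z'.
Proof.
have := npow_clarkson ((x + x') / 2) ((z + z') / 2) ((x' - x) / 2)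
  ((z' - z) / 2) beta2.
have -> : (x + x') / 2 + (x' - x) / 2 = x' by field.
have -> : (z + z') / 2 + (z' - z) / 2 = z' by field.
have -> : (x + x') / 2 - (x' - x) / 2 = x by field.
have -> : (z + z') / 2 - (z' - z) / 2 = z by field.
have := npow_convex x z ((x + x') / 2) ((z + z') / 2) beta2.
have -> : npow ((x' - x) / 2) ((z' - z) / 2) =
    (sqn (x' - x) (z' - z) / 4) `^ (beta / 2).
  by rewrite /npow; congr (_ `^ _); rewrite /sqn; field.
have -> : x * ((x + x') / 2 - x) + z * ((z + z') / 2 - z) =
   (x * (x' - x) + z * (z' - z)) / 2 by field.
by move: (npow _ _) (npow _ _) (_ `^ _) => A B C; lra.
Qed.

Lemma nslope_le B x z (beta2 : 2 <= beta) : sqn x z <= B -> nslope x z <= B `^ (beta / 2 - 1).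
Proof.
move=> SB; have := sqn_ge0 x z => S0.
by apply: ge0_ler_powR => //; rewrite ?nnegrE; lra.
Qed.

Lemma npow_le B x z (beta2 : 2 <= beta) : sqn x z <= B -> npow x z <= B `^ (beta / 2).
Proof.
move=> SB; have := sqn_ge0 x z => S0.
by apply: ge0_ler_powR => //; rewrite ?nnegrE; lra.
Qed.

Lemma nslopeE x z : nslope x z = Num.sqrt (sqn x z) `^ (beta - 2).
Proof.
rewrite -powR12_sqrt ?sqn_ge0// -powRrM /nslope; congr (_ `^ _); lra.
Qed.

Lemma sqrt_sqn_lip x z x' z' :
  Num.sqrt (sqn x z) <= Num.sqrt (sqn x' z') + (`|x - x'| + `|z - z'|).
Proof.
set r := Num.sqrt (sqn x' z'); have r0 : 0 <= r by exact: sqrtr_ge0.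
set dx := `|x - x'|; set dz := `|z - z'|.
have dx0 : 0 <= dx by exact: normr_ge0.
have dz0 : 0 <= dz by exact: normr_ge0.
have e0 : 0 <= r + (dx + dz) by lra.
rewrite -(ger0_norm e0) -sqrtr_sqr ler_sqrt ?sqr_ge0//.
have r2 : r ^+ 2 = x' ^+ 2 + z' ^+ 2 by rewrite sqr_sqrtr ?sqn_ge0.
have xr : `|x'| <= r by rewrite -sqrtr_sqr ler_sqrt ?sqn_ge0// lerDl sqr_ge0.
have zr : `|z'| <= r by rewrite -sqrtr_sqr ler_sqrt ?sqn_ge0// lerDr sqr_ge0.
have hx : x ^+ 2 <= x' ^+ 2 + 2 * r * dx + dx ^+ 2.
  have -> : x = x' + (x - x') by ring.
  have : x' * (x - x') <= r * dx.
    by rewrite (le_trans (ler_norm _))// normrM ler_wpM2r.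
  by rewrite /dx real_normK ?num_real//; nra.
have hz : z ^+ 2 <= z' ^+ 2 + 2 * r * dz + dz ^+ 2.
  have -> : z = z' + (z - z') by ring.
  have : z' * (z - z') <= r * dz.
    by rewrite (le_trans (ler_norm _))// normrM ler_wpM2r.
  by rewrite /dz real_normK ?num_real//; nra.
rewrite /sqn; nra.
Qed.

(** The component [y] stands for [x] or for [z]. At the smaller of the two
    points it weights the increment of the power, as [powR_sub_weighted]
    requires. *)
Lemma mul_nslope_lip B x z x' z' y y' (beta2 : 2 <= beta) :
  sqn x z <= B -> sqn x' z' <= B -> `|y| <= Num.sqrt (sqn x z) ->
  `|y'| <= Num.sqrt (sqn x' z') ->
  `|y * nslope x z - y' * nslope x' z'| <=
    B `^ (beta / 2 - 1) *
    (`|y - y'| + (beta - 2) * (`|x - x'| + `|z - z'|)).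
Proof.
wlog le : x z x' z' y y' / sqn x' z' <= sqn x z.
  move=> wl SB S'B yS yS'; have [le|/ltW le] := leP (sqn x' z') (sqn x z).
    exact: wl.
  rewrite [leLHS]distrC (distrC y) (distrC x) (distrC z); exact: wl.
move=> SB S'B yS yS'.
have -> : y * nslope x z - y' * nslope x' z' =
  (y - y') * nslope x z + y' * (nslope x z - nslope x' z') by ring.
apply: (le_trans (ler_normD _ _)); rewrite [leRHS]mulrDr lerD//.
  by rewrite normrM mulrC (ger0_norm (nslope_ge0 _ _)) ler_wpM2r// nslope_le.
have r0 : 0 <= Num.sqrt (sqn x' z') by exact: sqrtr_ge0.
have rr : Num.sqrt (sqn x' z') <= Num.sqrt (sqn x z).
  by rewrite ler_sqrt// sqn_ge0.
have nn : nslope x' z' <= nslope x z.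
  by rewrite !nslopeE; apply: ge0_ler_powR => //; rewrite ?nnegrE ?sqrtr_ge0; lra.
rewrite normrM [X in _ * X]ger0_norm ?subr_ge0//.
apply: (@le_trans _ _ (Num.sqrt (sqn x' z') * (nslope x z - nslope x' z'))).
  by rewrite ler_wpM2r// subr_ge0.
have s0 : 0 <= beta - 2 by lra.
rewrite [X in X - _]nslopeE [X in _ - X]nslopeE.
apply: le_trans (powR_sub_weighted s0 _) _; first by rewrite r0.
rewrite -nslopeE -mulrA [leRHS]mulrCA ler_wpM2l//.
rewrite ler_pM ?subr_ge0 ?nslope_ge0//; first exact: nslope_le.
by rewrite lerBlDl; exact: sqrt_sqn_lip.
Qed.

Lemma le_sqrt_sqnl x z : `|x| <= Num.sqrt (sqn x z).
Proof. by rewrite -sqrtr_sqr ler_sqrt ?sqn_ge0// lerDl sqr_ge0. Qed.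

Lemma le_sqrt_sqnr x z : `|z| <= Num.sqrt (sqn x z).
Proof. by rewrite -sqrtr_sqr ler_sqrt ?sqn_ge0// lerDr sqr_ge0. Qed.

Lemma nslopel_lip B x z x' z' (beta2 : 2 <= beta) : sqn x z <= B -> sqn x' z' <= B ->
  `|x * nslope x z - x' * nslope x' z'| <=
    B `^ (beta / 2 - 1) * (beta - 1) * (`|x - x'| + `|z - z'|).
Proof.
move=> SB S'B.
apply: le_trans (mul_nslope_lip beta2 SB S'B (le_sqrt_sqnl _ _) (le_sqrt_sqnl _ _)) _.
rewrite -mulrA ler_wpM2l ?powR_ge0//.
by move: (normr_ge0 (z - z')) (normr_ge0 (x - x')); nra.
Qed.

Lemma nsloper_lip B x z x' z' (beta2 : 2 <= beta) : sqn x z <= B -> sqn x' z' <= B ->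
  `|z * nslope x z - z' * nslope x' z'| <=
    B `^ (beta / 2 - 1) * (beta - 1) * (`|x - x'| + `|z - z'|).
Proof.
move=> SB S'B.
apply: le_trans (mul_nslope_lip beta2 SB S'B (le_sqrt_sqnr _ _) (le_sqrt_sqnr _ _)) _.
rewrite -mulrA ler_wpM2l ?powR_ge0//.
by move: (normr_ge0 (z - z')) (normr_ge0 (x - x')); nra.
Qed.

Lemma npow_lip B x z x' z' (beta2 : 2 <= beta) : sqn x z <= B -> sqn x' z' <= B ->
  `|npow x z - npow x' z'| <=
    beta * B `^ (beta / 2 - 1) * Num.sqrt B * (`|x - x'| + `|z - z'|).
Proof.
wlog le : x z x' z' / npow x' z' <= npow x z.
  move=> wl SB S'B; have [le|/ltW le] := leP (npow x' z') (npow x z).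
    exact: wl.
  rewrite [leLHS]distrC (distrC x) (distrC z); exact: wl.
move=> SB S'B; rewrite ger0_norm ?subr_ge0//.
have := npow_convex x z x' z' beta2.
have hx : `|x * (x' - x)| <= Num.sqrt B * `|x - x'|.
  rewrite normrM distrC ler_wpM2r// (le_trans (le_sqrt_sqnl x z))// ler_sqrt//.
  exact: le_trans (sqn_ge0 _ _) SB.
have hz : `|z * (z' - z)| <= Num.sqrt B * `|z - z'|.
  rewrite normrM distrC ler_wpM2r// (le_trans (le_sqrt_sqnr x z))// ler_sqrt//.
  exact: le_trans (sqn_ge0 _ _) SB.
move=> h; suff : - (beta * nslope x z * (x * (x' - x) + z * (z' - z))) <=
    beta * B `^ (beta / 2 - 1) * Num.sqrt B * (`|x - x'| + `|z - z'|) by lra.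
rewrite (le_trans (ler_norm _))// normrN normrM -[leRHS]mulrA ler_pM//.
  rewrite ger0_norm ?mulr_ge0 ?nslope_ge0//; last lra.
  by rewrite ler_wpM2l ?nslope_le//; lra.
by rewrite (le_trans (ler_normD _ _))// [leRHS]mulrDr lerD.
Qed.

End PowerOfNorm.
(** * The numerical Hamiltonian and its derivatives *)

Lemma is_derive_eps (R : realType) (w : R -> R) y d :
  (forall e, 0 < e -> exists2 r, 0 < r & forall z, z != y ->
     `|z - y| < r -> `|(w z - w y) / (z - y) - d| <= e) -> is_derive y 1 w d.
Proof.
move=> h; have cv : (fun t => t^-1 *: ((w \o shift y) (t *: 1) - w y)) @ 0^' --> d.
  apply/cvgrPdist_le => e /h[r r0 hr]; rewrite near_withinE; exists r => //= t tr t0.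
  have {}tr : `|t| < r by have : `|0 - t| < r := tr; rewrite sub0r normrN.
  have := hr (t + y); rewrite addrK => /(_ _ tr)/=.
  rewrite /GRing.scale/= mulr1 distrC [_^-1 * _]mulrC; apply.
  by rewrite -subr_eq0 addrK.
by apply: DeriveDef; [apply/cvg_ex; exists d | rewrite /derive; exact/cvg_lim].
Qed.

Lemma is_derive_quad (R : realType) (F : R -> R) q d C :
  (forall q', `|q' - q| <= 1 ->
     `|F q' - F q - d * (q' - q)| <= C * `|q' - q| ^+ 2) ->
  is_derive q 1 F d.
Proof.
move=> FC; apply: is_derive_eps => e e0; have c0 : 0 < `|C| + 1 by rewrite ltr_wpDl.
exists (Num.min 1 (e / (`|C| + 1))) => [|z zq].
  by rewrite lt_min ltr01 divr_gt0.
rewrite lt_min => /andP[/ltW z1 /ltW ze]; have z0 : z - q != 0 by rewrite subr_eq0.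
have -> : (F z - F q) / (z - q) - d = (F z - F q - d * (z - q)) / (z - q) by field.
rewrite normrM normfV ler_pdivrMr ?normr_gt0//; apply: le_trans (FC z z1) _.
rewrite expr2 mulrA ler_wpM2r//; move: ze; rewrite ler_pdivlMr// mulrC.
by apply: le_trans; rewrite ler_wpM2r// (le_trans (ler_norm _))// lerDl.
Qed.

Section NumericalHamiltonian.
Context {R : realType} {n : nat}.
Variables (beta : R) (f : 'rV[R]_n -> R).
Implicit Types (x : 'rV[R]_n) (p q : R).

Definition negp q : R := Num.max (- q) 0.
Definition posp q : R := Num.max q 0.

Lemma negp_ge0 q : 0 <= negp q. Proof. by rewrite le_max lexx orbT. Qed.
Lemma posp_ge0 q : 0 <= posp q. Proof. by rewrite le_max lexx orbT. Qed.

Lemma pospBnegp q : posp q - negp q = q.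
Proof. by rewrite /posp /negp; case: (lerP q 0); case: (lerP (- q) 0); lra. Qed.

Lemma posp_lip p q : `|posp p - posp q| <= `|p - q|.
Proof.
rewrite /posp; case: (lerP p 0); case: (lerP q 0) => hq hp.
- by rewrite subrr normr0.
- by rewrite sub0r normrN gtr0_norm// ler_normr; apply/orP; right; lra.
- by rewrite subr0 gtr0_norm// ler_normr; apply/orP; left; lra.
- by [].
Qed.

Lemma negp_lip p q : `|negp p - negp q| <= `|p - q|.
Proof. by have := posp_lip (- p) (- q); rewrite -opprD normrN. Qed.

Lemma posp_le p : posp p <= `|p|.
Proof. by rewrite ge_max normr_ge0 ler_norm. Qed.

Lemma negp_le p : negp p <= `|p|.
Proof. by rewrite ge_max normr_ge0 andbT -normrN ler_norm. Qed.

Definition nham q1 q2 : R := npow beta (negp q1) (posp q2).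
Definition nham1 q1 q2 : R :=
  - (beta * (negp q1 * nslope beta (negp q1) (posp q2))).
Definition nham2 q1 q2 : R :=
  beta * (posp q2 * nslope beta (negp q1) (posp q2)).

Lemma nham1_le0 q1 q2 : 2 <= beta -> nham1 q1 q2 <= 0.
Proof.
by move=> b2; rewrite oppr_le0 !mulr_ge0 ?negp_ge0 ?nslope_ge0//; lra.
Qed.

Lemma nham2_ge0 q1 q2 : 2 <= beta -> 0 <= nham2 q1 q2.
Proof. by move=> b2; rewrite !mulr_ge0 ?posp_ge0 ?nslope_ge0//; lra. Qed.

Lemma nham_euler q1 q2 : 2 <= beta ->
  nham1 q1 q2 * q1 + nham2 q1 q2 * q2 = beta * nham q1 q2.
Proof.
move=> b2; rewrite /nham npowE// /nham1 /nham2; set s := nslope _ _ _.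
have e1 : negp q1 * q1 = - negp q1 ^+ 2.
  rewrite /negp; case: lerP => _; first by rewrite mul0r expr0n oppr0.
  by ring.
have e2 : posp q2 * q2 = posp q2 ^+ 2.
  by rewrite /posp; case: lerP => _; [rewrite mul0r expr0n | rewrite expr2].
have -> : - (beta * (negp q1 * s)) * q1 = - (beta * s) * (negp q1 * q1) by ring.
have -> : beta * (posp q2 * s) * q2 = beta * s * (posp q2 * q2) by ring.
by rewrite e1 e2 /sqn; ring.
Qed.

Definition gap q1 q2 q1' q2' : R :=
  nham q1' q2' - nham q1 q2
  - (nham1 q1 q2 * (q1' - q1) + nham2 q1 q2 * (q2' - q2)).

(** The numerical Hamiltonian is nonincreasing in [q1] and nondecreasing in
    [q2], so replacing a slope by its negative or positive part only
    decreases the convexity gap. *)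
Lemma gap_ge q1 q2 q1' q2' : 2 <= beta ->
  2 * (sqn (negp q1' - negp q1) (posp q2' - posp q2) / 4) `^ (beta / 2)
  <= gap q1 q2 q1' q2'.
Proof.
move=> b2.
have := npow_gap (negp q1) (posp q2) (negp q1') (posp q2') b2.
rewrite /gap /nham /nham1 /nham2; set s := nslope _ _ _.
set A := npow _ _ _; set B := npow _ _ _; set D := _ `^ _.
have s0 : 0 <= s by exact: nslope_ge0.
have h1 : - (negp q1 * (q1' - q1)) <= negp q1 * (negp q1' - negp q1).
  rewrite /negp; case: (lerP (- q1) 0) => ?; first by rewrite !mul0r oppr0.
  by case: (lerP (- q1') 0) => ?; nra.
have h2 : posp q2 * (q2' - q2) <= posp q2 * (posp q2' - posp q2).
  rewrite /posp; case: (lerP q2 0) => ?; first by rewrite !mul0r.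
  by case: (lerP q2' 0) => ?; nra.
move=> h; apply: (@le_trans _ _ (B - A - beta * s *
   (negp q1 * (negp q1' - negp q1) + posp q2 * (posp q2' - posp q2)))).
  lra.
rewrite lerD2l lerN2 -subr_ge0.
have -> : beta * s * (negp q1 * (negp q1' - negp q1) +
     posp q2 * (posp q2' - posp q2)) -
   (- (beta * (negp q1 * s)) * (q1' - q1) + beta * (posp q2 * s) * (q2' - q2)) =
   beta * s * ((negp q1 * (negp q1' - negp q1) - - (negp q1 * (q1' - q1))) +
     (posp q2 * (posp q2' - posp q2) - posp q2 * (q2' - q2))) by ring.
apply: mulr_ge0; first by apply: mulr_ge0 => //; lra.
by apply: addr_ge0; rewrite subr_ge0.
Qed.

Lemma gap_ge0 q1 q2 q1' q2' : 2 <= beta -> 0 <= gap q1 q2 q1' q2'.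
Proof.
by move=> b2; apply: le_trans (gap_ge _ _ _ _ b2); rewrite mulr_ge0// powR_ge0.
Qed.

Definition hbox K : R := (K ^+ 2 + K ^+ 2) `^ (beta / 2 - 1).

Lemma sqn_box K q1 q2 : `|q1| <= K -> `|q2| <= K ->
  sqn (negp q1) (posp q2) <= K ^+ 2 + K ^+ 2.
Proof.
move=> h1 h2; have K0 : 0 <= K := le_trans (normr_ge0 _) h1.
have hn := le_trans (negp_le _) h1; have hp := le_trans (posp_le _) h2.
by rewrite /sqn lerD// ler_pXn2r ?nnegrE ?negp_ge0 ?posp_ge0.
Qed.

Lemma nham1_le K q1 q2 : 2 <= beta -> `|q1| <= K -> `|q2| <= K ->
  `|nham1 q1 q2| <= beta * (K * hbox K).
Proof.
move=> b2 h1 h2; rewrite normrN !normrM !ger0_norm ?negp_ge0 ?nslope_ge0//; last lra.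
rewrite ler_wpM2l//; first lra.
rewrite ler_pM ?negp_ge0 ?nslope_ge0//; first exact: le_trans (negp_le _) h1.
by apply: nslope_le => //; exact: sqn_box.
Qed.

Lemma nham2_le K q1 q2 : 2 <= beta -> `|q1| <= K -> `|q2| <= K ->
  `|nham2 q1 q2| <= beta * (K * hbox K).
Proof.
move=> b2 h1 h2; rewrite !normrM !ger0_norm ?posp_ge0 ?nslope_ge0//; last lra.
rewrite ler_wpM2l//; first lra.
rewrite ler_pM ?posp_ge0 ?nslope_ge0//; first exact: le_trans (posp_le _) h2.
by apply: nslope_le => //; exact: sqn_box.
Qed.

Definition hlip K : R := beta * (hbox K * (beta - 1)).

Lemma hlip_ge0 K : 2 <= beta -> 0 <= hlip K.
Proof. by move=> b2; rewrite !mulr_ge0 ?powR_ge0//; lra. Qed.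

Section OnBox.
Variables K q1 q2 q1' q2' : R.
Let dist := `|negp q1 - negp q1'| + `|posp q2 - posp q2'|.

Lemma nham1_lip : 2 <= beta -> `|q1| <= K -> `|q2| <= K ->
  `|q1'| <= K -> `|q2'| <= K ->
  `|nham1 q1 q2 - nham1 q1' q2'| <= hlip K * dist.
Proof.
move=> b2 h1 h2 h1' h2'; rewrite /nham1 -opprD normrN -mulrBr normrM.
rewrite ger0_norm; last lra.
rewrite /hlip -mulrA ler_wpM2l//; first lra.
by apply: nslopel_lip => //; exact: sqn_box.
Qed.

Lemma nham2_lip : 2 <= beta -> `|q1| <= K -> `|q2| <= K ->
  `|q1'| <= K -> `|q2'| <= K ->
  `|nham2 q1 q2 - nham2 q1' q2'| <= hlip K * dist.
Proof.
move=> b2 h1 h2 h1' h2'; rewrite /nham2 -mulrBr normrM.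
rewrite ger0_norm; last lra.
rewrite /hlip -mulrA ler_wpM2l//; first lra.
by apply: nsloper_lip => //; exact: sqn_box.
Qed.

Lemma nham_lip : 2 <= beta -> `|q1| <= K -> `|q2| <= K ->
  `|q1'| <= K -> `|q2'| <= K ->
  `|nham q1 q2 - nham q1' q2'| <=
    beta * hbox K * Num.sqrt (K ^+ 2 + K ^+ 2) * dist.
Proof. by move=> b2 h1 h2 h1' h2'; apply: npow_lip => //; exact: sqn_box. Qed.

End OnBox.

(** The gap seen from the other point is nonnegative, so the gap is at most the
    pairing of the increment of the gradient, which is Lipschitz, with that of
    the slopes. *)
Lemma gap_le K q1 q2 q1' q2' : 2 <= beta -> `|q1| <= K -> `|q2| <= K ->
  `|q1'| <= K -> `|q2'| <= K ->
  gap q1 q2 q1' q2' <= hlip K * (`|q1 - q1'| + `|q2 - q2'|) ^+ 2.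
Proof.
move=> b2 h1 h2 h1' h2'.
have := gap_ge0 q1' q2' q1 q2 b2.
have l1 := nham1_lip b2 h1 h2 h1' h2'.
have l2 := nham2_lip b2 h1 h2 h1' h2'.
set d := `|q1 - q1'| + `|q2 - q2'|.
have L0 := hlip_ge0 K b2.
have dd : `|negp q1 - negp q1'| + `|posp q2 - posp q2'| <= d.
  by rewrite lerD ?negp_lip ?posp_lip.
have {}l1 : `|nham1 q1 q2 - nham1 q1' q2'| <= hlip K * d.
  by apply: le_trans l1 _; rewrite ler_wpM2l.
have {}l2 : `|nham2 q1 q2 - nham2 q1' q2'| <= hlip K * d.
  by apply: le_trans l2 _; rewrite ler_wpM2l.
rewrite /gap => g0.
have m1 : (nham1 q1 q2 - nham1 q1' q2') * (q1 - q1') <= hlip K * d * `|q1 - q1'|.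
  by rewrite (le_trans (ler_norm _))// normrM ler_wpM2r.
have m2 : (nham2 q1 q2 - nham2 q1' q2') * (q2 - q2') <= hlip K * d * `|q2 - q2'|.
  by rewrite (le_trans (ler_norm _))// normrM ler_wpM2r.
have -> : hlip K * d ^+ 2 = hlip K * d * `|q1 - q1'| + hlip K * d * `|q2 - q2'|.
  by rewrite /d; ring.
lra.
Qed.

(** The gap is a remainder of second order, which yields the derivatives in all
    directions, also at points where a slope changes sign. *)
Lemma nham_is_derive (q1 q2 d1 d2 : R) : 2 <= beta ->
  `|d1| <= 1 -> `|d2| <= 1 ->
  is_derive (0 : R) 1 (fun t => nham (q1 + t * d1) (q2 + t * d2))
    (nham1 q1 q2 * d1 + nham2 q1 q2 * d2).
Proof.
move=> b2 d11 d21; set K := `|q1| + `|q2| + 1.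
apply: (@is_derive_quad _ _ _ _ (hlip K * 4)) => t; rewrite subr0 !mul0r !addr0 => t1.
have td d : `|d| <= 1 -> `|t * d| <= `|t|.
  by move=> d1'; rewrite normrM ler_piMr.
have tK d : `|d| <= 1 -> `|t * d| <= 1 by move=> /td; lra.
have h1 : `|q1| <= K by have := normr_ge0 q2; rewrite /K; lra.
have h2 : `|q2| <= K by have := normr_ge0 q1; rewrite /K; lra.
have h1' : `|q1 + t * d1| <= K.
  rewrite (le_trans (ler_normD _ _))//; have := tK _ d11; have := normr_ge0 q2.
  by rewrite /K; lra.
have h2' : `|q2 + t * d2| <= K.
  rewrite (le_trans (ler_normD _ _))//; have := tK _ d21; have := normr_ge0 q1.
  by rewrite /K; lra.
have := gap_le b2 h1 h2 h1' h2'; have := gap_ge0 q1 q2 (q1 + t * d1) (q2 + t * d2) b2.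
have L0 := hlip_ge0 K b2.
have -> : q1 - (q1 + t * d1) = - (t * d1) by ring.
have -> : q2 - (q2 + t * d2) = - (t * d2) by ring.
have -> : nham (q1 + t * d1) (q2 + t * d2) - nham q1 q2 -
    (nham1 q1 q2 * d1 + nham2 q1 q2 * d2) * t =
    gap q1 q2 (q1 + t * d1) (q2 + t * d2) by rewrite /gap; ring.
rewrite !normrN => g0 gl; rewrite [leLHS]ger0_norm//; apply: le_trans gl _.
rewrite -[leRHS]mulrA ler_wpM2l//.
have -> : 4 * `|t| ^+ 2 = (2 * `|t|) ^+ 2 by ring.
rewrite ler_pXn2r ?nnegrE ?addr_ge0 ?mulr_ge0//.
by have := td _ d11; have := td _ d21; lra.
Qed.

Lemma num_hamE x q1 q2 : num_ham beta f x q1 q2 = nham q1 q2 + f x.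
Proof. by []. Qed.

Lemma derive1_nham (F : R -> R) (q q1 q2 d1 d2 c : R) : 2 <= beta ->
  `|d1| <= 1 -> `|d2| <= 1 ->
  (forall t, F (q + t) = nham (q1 + t * d1) (q2 + t * d2) + c) ->
  derive1 F q = nham1 q1 q2 * d1 + nham2 q1 q2 * d2.
Proof.
move=> b2 h1 h2 FE.
have [_ <-] : is_derive (0 : R) 1 (fun t => F (q + t))
    (nham1 q1 q2 * d1 + nham2 q1 q2 * d2).
  rewrite -[X in is_derive _ _ _ X]addr0.
  rewrite (_ : (fun t => _) = (fun t => nham (q1 + t * d1) (q2 + t * d2)) \+ cst c).
    by apply: is_deriveD; exact: nham_is_derive.
  by apply/funext => t; exact: FE.
rewrite derive1E /derive.
set k := fun t => _; set k' := fun t => _; suff -> : k = k' by [].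
by apply/funext => t; rewrite /k /k' /= !addr0 [_ + q]addrC.
Qed.

Lemma num_ham_q1E x q1 q2 : 2 <= beta ->
  num_ham_q1 beta f x q1 q2 = nham1 q1 q2.
Proof.
move=> b2; rewrite -[RHS]addr0 -[X in X + _]mulr1 -[X in _ + X](mulr0 (nham2 q1 q2)).
by apply: (@derive1_nham _ _ _ _ _ _ (f x)); rewrite ?normr1 ?normr0// => t;
  rewrite num_hamE mulr1 mulr0 addr0.
Qed.

Lemma num_ham_q2E x q1 q2 : 2 <= beta ->
  num_ham_q2 beta f x q1 q2 = nham2 q1 q2.
Proof.
move=> b2; rewrite -[RHS]add0r -[X in _ + X]mulr1 -[X in X + _](mulr0 (nham1 q1 q2)).
by apply: (@derive1_nham _ _ _ _ _ _ (f x)); rewrite ?normr1 ?normr0// => t;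
  rewrite num_hamE mulr1 mulr0 addr0.
Qed.

Lemma npow_absE p : npow beta (negp p) (posp p) = `|p| `^ beta.
Proof.
rewrite /npow; have -> : sqn (negp p) (posp p) = `|p| ^+ 2.
  rewrite /sqn /negp /posp real_normK ?num_real//.
  by case: (lerP p 0); case: (lerP (- p) 0); nra.
rewrite -powR_mulrn// -powRrM; congr (_ `^ _); by field.
Qed.

Lemma hamE x p : ham beta f x p = nham p p + f x.
Proof. by rewrite /ham /nham npow_absE. Qed.

Lemma ham_pE x p : 2 <= beta -> ham_p beta f x p = nham1 p p + nham2 p p.
Proof.
move=> b2; rewrite -[X in X + _]mulr1 -[X in _ + X]mulr1.
by apply: (@derive1_nham _ _ _ _ _ _ (f x)); rewrite ?normr1// => t;
  rewrite hamE mulr1.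
Qed.

End NumericalHamiltonian.
(** * Summation over the cells and the nodes of a grid *)

Section SummationByParts.
Context {R : realType}.
Implicit Types a p : nat -> R.

Lemma summation_by_parts a p N :
  \sum_(0 <= k < N.+1) a k * (p k.+1 - p k) =
  a N * p N.+1 - a 0 * p 0 - \sum_(1 <= k < N.+1) p k * (a k - a k.-1).
Proof.
elim: N => [|N IH].
  by rewrite big_nat1 big_geq// subr0; ring.
by rewrite big_nat_recr//= IH [in RHS]big_nat_recr//=; ring.
Qed.

Lemma telescope_sum p N :
  \sum_(0 <= k < N) (p k.+1 - p k) = p N - p 0.
Proof. by rewrite telescope_sumr. Qed.

(** An upwind flux reads one unknown on each side of a cell; sorted by nodes
    instead of cells, its pairing with the increments of a test function is
    the node-centred one of the scheme. *)
Lemma sum_cells_to_nodes a1 a2 p N : (0 < N)%N ->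
  \sum_(0 <= k < N) ((if k.+1 == N then 0 else a2 k.+1) +
     (if k == 0%N then 0 else a1 k)) * (p k.+1 - p k) =
  \sum_(1 <= k < N) (a1 k * (p k.+1 - p k) + a2 k * (p k - p k.-1)).
Proof.
case: N => // N _; under eq_bigr do rewrite mulrDl.
rewrite big_split/= [RHS]big_split/= addrC; congr (_ + _).
  rewrite big_nat_recl//= mul0r add0r big_add1/=.
  by apply: eq_bigr.
rewrite big_nat_recr//= eqxx mul0r addr0 big_add1/= !big_nat.
apply: eq_bigr => k /andP[_ kN].
by rewrite eqSS ltn_eqF.
Qed.

End SummationByParts.

Section VertexSums.
Context {R : realType} {n : nat} {I J : finType} (G : network R n I J).

Definition src (j : J) : I := projT1 (cid (arc_source G j)).
Definition tgt (j : J) : I := projT1 (cid (arc_target G j)).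

Lemma srcP j : arc G j 0 = vtx G (src j).
Proof. by rewrite /src; case: cid. Qed.

Lemma tgtP j : arc G j (len G j) = vtx G (tgt j).
Proof. by rewrite /tgt; case: cid. Qed.

Lemma incpE i j : incp G i j = (i == src j).
Proof. by rewrite /incp srcP (inj_eq (@vtx_inj _ _ _ _ G)). Qed.

Lemma incmE i j : incm G i j = (i == tgt j).
Proof. by rewrite /incm tgtP (inj_eq (@vtx_inj _ _ _ _ G)). Qed.

Lemma sum_incp (F : I -> J -> R) :
  \sum_i \sum_(j | incp G i j) F i j = \sum_j F (src j) j.
Proof.
rewrite (exchange_big_dep xpredT)//=; apply: eq_bigr => j _.
by under eq_bigl do rewrite incpE; rewrite big_pred1_eq.
Qed.

Lemma sum_incm (F : I -> J -> R) :
  \sum_i \sum_(j | incm G i j) F i j = \sum_j F (tgt j) j.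
Proof.
rewrite (exchange_big_dep xpredT)//=; apply: eq_bigr => j _.
by under eq_bigl do rewrite incmE; rewrite big_pred1_eq.
Qed.

Definition kirchhoff (c : J -> R) : Prop :=
  forall i, \sum_(j | incp G i j) c j - \sum_(j | incm G i j) c j = 0.

Lemma kirchhoff_sum c (v : I -> R) : kirchhoff c ->
  \sum_j c j * (v (tgt j) - v (src j)) = 0.
Proof.
move=> K; under eq_bigr do rewrite mulrBr; rewrite sumrB.
rewrite -(sum_incm (fun i j => c j * v i)) -(sum_incp (fun i j => c j * v i)).
rewrite -sumrB; apply: big1 => i _.
by rewrite -!mulr_suml -mulrBl -opprB K oppr0 mul0r.
Qed.

End VertexSums.

Section GridSums.
Context {R : realType} {n : nat} {I J : finType} {G : network R n I J}.
Variable h : step G.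
Implicit Types (U W M p : gridfun h) (F : J -> nat -> R).

Definition cells F : R := \sum_j \sum_(0 <= k < nst h j) F j k.
Definition nodes F : R := \sum_j \sum_(1 <= k < nst h j) F j k.

Definition incr p j k : R := gat p j k.+1 - gat p j k.

Lemma nst_gt1 j : (1 < nst h j)%N. Proof. exact: nst_ge2. Qed.
Lemma nst_gt0 j : (0 < nst h j)%N. Proof. exact: ltnW (nst_gt1 j). Qed.

Lemma stp_ge0 j : 0 <= h j. Proof. exact: ltW (stp_gt0 h j). Qed.
Lemma stp_neq0 j : h j != 0. Proof. by rewrite gt_eqF ?stp_gt0. Qed.

Lemma DpE p j k : Dp p j k = incr p j k / h j. Proof. by []. Qed.

Lemma incrE p j k : incr p j k = h j * Dp p j k.
Proof. by rewrite DpE mulrCA divff ?mulr1// stp_neq0. Qed.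

Lemma eq_cells F F' : (forall j k, (k < nst h j)%N -> F j k = F' j k) ->
  cells F = cells F'.
Proof.
by move=> e; apply: eq_bigr => j _; apply: eq_big_nat => k /andP[_]; exact: e.
Qed.

Lemma eq_nodes F F' : (forall j k, (1 <= k < nst h j)%N -> F j k = F' j k) ->
  nodes F = nodes F'.
Proof. by move=> e; apply: eq_bigr => j _; apply: eq_big_nat => k; exact: e. Qed.

Lemma le_cells F F' : (forall j k, (k < nst h j)%N -> F j k <= F' j k) ->
  cells F <= cells F'.
Proof.
by move=> e; apply: ler_sum => j _; apply: ler_sum_nat => k /andP[_]; exact: e.
Qed.

Lemma le_nodes F F' : (forall j k, (1 <= k < nst h j)%N -> F j k <= F' j k) ->
  nodes F <= nodes F'.
Proof. by move=> e; apply: ler_sum => j _; apply: ler_sum_nat => k; exact: e. Qed.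

Lemma cellsD F F' : cells F + cells F' = cells (fun j k => F j k + F' j k).
Proof. by rewrite /cells -big_split; apply: eq_bigr => j _; rewrite -big_split. Qed.

Lemma nodesD F F' : nodes F + nodes F' = nodes (fun j k => F j k + F' j k).
Proof. by rewrite /nodes -big_split; apply: eq_bigr => j _; rewrite -big_split. Qed.

Lemma cellsZ a F : a * cells F = cells (fun j k => a * F j k).
Proof. by rewrite /cells mulr_sumr; apply: eq_bigr => j _; rewrite mulr_sumr. Qed.

Lemma nodesZ a F : a * nodes F = nodes (fun j k => a * F j k).
Proof. by rewrite /nodes mulr_sumr; apply: eq_bigr => j _; rewrite mulr_sumr. Qed.

Lemma cellsN F : - cells F = cells (fun j k => - F j k).
Proof. by rewrite -mulN1r cellsZ; apply: eq_cells => j k _; rewrite mulN1r. Qed.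

Lemma nodesN F : - nodes F = nodes (fun j k => - F j k).
Proof. by rewrite -mulN1r nodesZ; apply: eq_nodes => j k _; rewrite mulN1r. Qed.

Lemma cellsB F F' : cells F - cells F' = cells (fun j k => F j k - F' j k).
Proof. by rewrite cellsN cellsD. Qed.

Lemma cells_ge0 F : (forall j k, (k < nst h j)%N -> 0 <= F j k) -> 0 <= cells F.
Proof.
move=> e; apply: sumr_ge0 => j _; rewrite big_nat; apply: sumr_ge0 => k.
by move=> /andP[_]; exact: e.
Qed.

Lemma nodes_ge0 F : (forall j k, (1 <= k < nst h j)%N -> 0 <= F j k) ->
  0 <= nodes F.
Proof.
by move=> e; apply: sumr_ge0 => j _; rewrite big_nat; apply: sumr_ge0 => k; exact: e.
Qed.

Lemma norm_cells F : `|cells F| <= cells (fun j k => `|F j k|).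
Proof.
apply: le_trans (ler_norm_sum _ _ _) _; apply: ler_sum => j _.
exact: ler_norm_sum.
Qed.

Lemma norm_nodes F : `|nodes F| <= nodes (fun j k => `|F j k|).
Proof.
apply: le_trans (ler_norm_sum _ _ _) _; apply: ler_sum => j _.
exact: ler_norm_sum.
Qed.

Lemma nodes_le_cells F : (forall j k, (k < nst h j)%N -> 0 <= F j k) ->
  nodes F <= cells F.
Proof.
move=> F0; apply: ler_sum => j _; rewrite [leRHS]big_ltn ?nst_gt0//.
by rewrite lerDr F0 ?nst_gt0.
Qed.

(** Pointwise values on an edge are controlled by the total over all cells. *)
Lemma le_cells_edge F j N : (N <= nst h j)%N ->
  (forall j k, (k < nst h j)%N -> 0 <= F j k) ->
  \sum_(0 <= k < N) F j k <= cells F.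
Proof.
move=> Nj F0; rewrite /cells (bigD1 j)//= ler_wpDr//.
  apply: sumr_ge0 => i _; rewrite big_nat; apply: sumr_ge0 => k /andP[_].
  exact: F0.
rewrite (big_cat_nat _ Nj)//= lerDl big_nat.
by apply: sumr_ge0 => k /andP[_]; exact: F0.
Qed.

Definition total_len : R := \sum_j len G j.

Lemma cells_step : cells (fun j _ => h j) = total_len.
Proof.
apply: eq_bigr => j _; rewrite -(nst_stp h j).
by rewrite sumr_const_nat subn0 mulr_natl.
Qed.

Lemma ginnerE U W : ginner U W = nodes (fun j k => h j * gat U j k * gat W j k) +
  \sum_j (h j / 2 * gat U j 0 * gat W j 0 +
          h j / 2 * gat U j (nst h j) * gat W j (nst h j)).
Proof.
rewrite /ginner /nodes; congr (_ + _).
rewrite big_split/=.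
rewrite (sum_incp G (fun i j => h j / 2 * gat U j 0 * gat W j 0)).
rewrite (sum_incm G (fun i j => h j / 2 * gat U j (nst h j) * gat W j (nst h j))).
by rewrite -big_split.
Qed.

(** Half weights at both ends of each edge: the trapezoidal rule. *)
Lemma ginner_trapezoid U W : ginner U W =
  cells (fun j k => h j * ((gat U j k * gat W j k + gat U j k.+1 * gat W j k.+1) / 2)).
Proof.
rewrite ginnerE /nodes -big_split; apply: eq_bigr => j _ /=.
case: (nst h j) (nst_gt0 j) => // N _.
have -> : \sum_(0 <= k < N.+1) h j * ((gat U j k * gat W j k +
     gat U j k.+1 * gat W j k.+1) / 2) =
   \sum_(0 <= k < N.+1) h j / 2 * gat U j k * gat W j k +
   \sum_(0 <= k < N.+1) h j / 2 * gat U j k.+1 * gat W j k.+1.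
  by rewrite -big_split; apply: eq_bigr => k _ /=; ring.
rewrite (@big_ltn _ _ _ 0 N.+1)//=.
have -> : \sum_(0 <= i < N.+1) h j / 2 * gat U j i.+1 * gat W j i.+1 =
   \sum_(1 <= i < N.+1) h j / 2 * gat U j i * gat W j i +
   h j / 2 * gat U j N.+1 * gat W j N.+1.
  by rewrite big_nat_recr//= big_add1.
have -> : \sum_(1 <= k < N.+1) h j * gat U j k * gat W j k =
   \sum_(1 <= k < N.+1) h j / 2 * gat U j k * gat W j k +
   \sum_(1 <= k < N.+1) h j / 2 * gat U j k * gat W j k.
  by rewrite -big_split; apply: eq_bigr => k _ /=; field.
ring.
Qed.

Definition vertex_values p (v : I -> R) : Prop :=
  (forall j, gat p j 0 = v (src G j)) /\
  (forall j, gat p j (nst h j) = v (tgt G j)).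

Lemma gcontinuousP p : gcontinuous p -> exists v, vertex_values p v.
Proof.
move=> /choice[v vP]; exists v; split => j.
  by apply: (vP _).1; rewrite incpE.
by apply: (vP _).2; rewrite incmE.
Qed.

Lemma vertex_valuesP p v : vertex_values p v -> gcontinuous p.
Proof.
move=> [v0 v1] i; exists (v i); split => j; rewrite ?incpE ?incmE => /eqP->.
  exact: v0.
exact: v1.
Qed.

Lemma kirchhoff_cells c p : kirchhoff G c -> gcontinuous p ->
  cells (fun j k => c j * incr p j k) = 0.
Proof.
move=> K /gcontinuousP[v [v0 v1]]; rewrite -(kirchhoff_sum v K).
apply: eq_bigr => j _; rewrite -mulr_sumr; congr (_ * _).
by rewrite /incr telescope_sum v0 v1.
Qed.

Section WeakForms.
Variable nu : J -> R.

(** Summation by parts on each edge. The test function has one value per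
    vertex, so the boundary terms of the edges meet in [S_op]. *)
Lemma hjb_weak U W p v : vertex_values p v ->
  cells (fun j k => nu j * Dp U j k * incr p j k) =
  ginner W p
  + nodes (fun j k => h j * (- nu j * D2 U j k - gat W j k) * gat p j k)
  - \sum_i v i * S_op nu U W i.
Proof.
move=> [v0 v1]; rewrite ginnerE.
have -> : \sum_i v i * S_op nu U W i =
   \sum_j (v (src G j) * (nu j * Dp U j 0 + h j / 2 * gat W j 0) -
    v (tgt G j) * (nu j * Dp U j (nst h j).-1 - h j / 2 * gat W j (nst h j))).
  rewrite sumrB.
  rewrite -(sum_incp G (fun i j => v i * (nu j * Dp U j 0 + h j / 2 * gat W j 0))).
  rewrite -(sum_incm G (fun i j => v i *
     (nu j * Dp U j (nst h j).-1 - h j / 2 * gat W j (nst h j)))).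
  by rewrite -sumrB; apply: eq_bigr => i _; rewrite -!mulr_sumr -mulrBr.
rewrite [X in X - _]addrAC nodesD /nodes -big_split -sumrB; apply: eq_bigr => j _ /=.
rewrite -v0 -v1 /incr; case: (nst h j) (nst_gt0 j) => // N _ /=.
rewrite summation_by_parts.
have -> : \sum_(1 <= k < N.+1) gat p j k *
     (nu j * Dp U j k - nu j * Dp U j k.-1) =
   - \sum_(1 <= k < N.+1) (h j * gat W j k * gat p j k +
     h j * (- nu j * D2 U j k - gat W j k) * gat p j k).
  rewrite -sumrN; apply: eq_big_nat => -[//|k] _ /=.
  by rewrite /Dp /D2; field; exact: stp_neq0.
ring.
Qed.

(** Diffusion plus upwind transport across the cell between the nodes [k] and
    [k.+1]; as in [B_op], no drift is evaluated at a vertex. *)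
Definition flux (g1 g2 : J -> nat -> R) M j k : R :=
  nu j * Dp M j k +
  ((if k.+1 == nst h j then 0 else gat M j k.+1 * g2 j k.+1) +
   (if k == 0%N then 0 else gat M j k * g1 j k)).

Definition conserved g1 g2 M c : Prop :=
  kirchhoff G c /\ forall j k, (k < nst h j)%N -> flux g1 g2 M j k = c j.

Lemma fp_weak g1 g2 M c p : kirchhoff G c -> gcontinuous p ->
  nodes (fun j k => gat M j k * (g1 j k * incr p j k + g2 j k * incr p j k.-1))
  + cells (fun j k => nu j * Dp M j k * incr p j k) =
  cells (fun j k => (flux g1 g2 M j k - c j) * incr p j k).
Proof.
move=> K pc; have E := kirchhoff_cells K pc.
transitivity (cells (fun j k => flux g1 g2 M j k * incr p j k)); last first.
  by rewrite -[LHS]subr0 -E cellsB; apply: eq_cells => j k _; rewrite mulrBl.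
rewrite addrC /cells /nodes -big_split; apply: eq_bigr => j _ /=.
under [RHS]eq_bigr do rewrite mulrDl.
rewrite big_split/= /incr; congr (_ + _).
have := @sum_cells_to_nodes R (fun k => gat M j k * g1 j k)
  (fun k => gat M j k * g2 j k) (gat p j) (nst h j) (nst_gt0 j).
move=> ->; apply: eq_big_nat => -[//|k] _ /=; ring.
Qed.

Section Scheme.
Variables (beta : R) (f : 'rV[R]_n -> R).

(** The Fokker-Planck equation at a node equates the fluxes of the two cells
    around it; the transmission condition is Kirchhoff's law for the values on
    the edges. *)
Lemma scheme_flux U M :
  (forall j k, (1 <= k < nst h j)%N ->
     nu j * D2 M j k + B_op beta f U M j k = 0) ->
  (forall i, T_op beta f nu M U i = 0) ->
  exists c, conserved (g1_at beta f U) (g2_at beta f U) M c.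
Proof.
move=> E T; pose F := flux (g1_at beta f U) (g2_at beta f U) M.
have FE j k : (k < nst h j)%N -> F j k = F j 0.
  elim: k => // k IH kN; rewrite -{}IH; last exact: ltnW.
  have := E j k.+1; rewrite /= kN => /(_ isT) Ek.
  apply/eqP; rewrite -subr_eq0; apply/eqP.
  transitivity (h j * (nu j * D2 M j k.+1 + B_op beta f U M j k.+1)); last first.
    by rewrite Ek mulr0.
  rewrite /F /flux /B_op /D2 /Dp /= (ltn_eqF kN) eqSS.
  by field; exact: stp_neq0.
exists (fun j => F j 0); split=> // i.
transitivity (T_op beta f nu M U i) => //; rewrite /T_op; congr (_ - _).
  apply: eq_bigr => j _; rewrite /F /flux (ltn_eqF (nst_gt1 j)) /=.
  by rewrite addr0.
apply: eq_bigr => j _; rewrite -(FE j (nst h j).-1); last first.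
  by rewrite prednK// nst_gt0.
rewrite /F /flux prednK ?nst_gt0// eqxx add0r.
by case: (nst h j) (nst_gt1 j) => // -[].
Qed.

End Scheme.
End WeakForms.

Section Oscillation.
Variable p : gridfun h.
Hypothesis pc : gcontinuous p.

Definition variation : R := cells (fun j k => `|incr p j k|).

Lemma variation_ge0 : 0 <= variation. Proof. exact: cells_ge0. Qed.

Lemma osc_edge0 j k : (k <= nst h j)%N -> `|gat p j k - gat p j 0| <= variation.
Proof.
move=> kN; rewrite -telescope_sum; apply: le_trans (ler_norm_sum _ _ _) _.
exact: (@le_cells_edge (fun j k => `|incr p j k|)).
Qed.

Lemma osc_path v i s : vertex_values p v ->
  path (fun a b => [exists j,
    ((arc G j 0 == vtx G a) && (arc G j (len G j) == vtx G b)) ||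
    ((arc G j 0 == vtx G b) && (arc G j (len G j) == vtx G a))]) i s ->
  `|v i - v (last i s)| <= (size s)%:R * variation.
Proof.
move=> [v0 v1]; elim: s i => [|b s IH] i /=; first by rewrite subrr normr0 mul0r.
move=> /andP[/existsP[j ej] /IH le].
have -> : v i - v (last b s) = (v i - v b) + (v b - v (last b s)) by ring.
apply: le_trans (ler_normD _ _) _.
rewrite -addn1 natrD mulrDl mul1r addrC lerD//.
have vj : `|v (tgt G j) - v (src G j)| <= variation.
  by rewrite -v0 -v1 osc_edge0.
case/orP: ej => /andP[]; rewrite srcP tgtP !(inj_eq (@vtx_inj _ _ _ _ G)).
  by move=> /eqP<- /eqP<-; rewrite distrC.
by move=> /eqP<- /eqP<-.
Qed.

(** A simple path of the network has fewer edges than there are vertices; two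
    more account for the pieces of edges at both ends. *)
Lemma osc_le j k j' k' : (k <= nst h j)%N -> (k' <= nst h j')%N ->
  `|gat p j k - gat p j' k'| <= (#|I|.+2)%:R * variation.
Proof.
move=> kN k'N; have [v vP] := gcontinuousP pc; have [v0 v1] := vP.
have := @vtx_connect _ _ _ _ G (src G j) (src G j').
move=> /connectP[s sP]; case/shortenP: sP => {}s sP us _ e.
have := osc_path vP sP; rewrite -e -!v0 => vs.
have ss : (size s <= #|I|)%N.
  by rewrite ltnW// -[X in (X <= _)%N]/(size (src G j :: s)) -(card_uniqP us) max_card.
have -> : gat p j k - gat p j' k' = (gat p j k - gat p j 0)
  + (gat p j 0 - gat p j' 0) - (gat p j' k' - gat p j' 0) by ring.
apply: le_trans (ler_normB _ _) _.
apply: le_trans (lerD (ler_normD _ _) (lexx _)) _.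
have := osc_edge0 kN; have := osc_edge0 k'N.
have : (size s)%:R * variation <= #|I|%:R * variation.
  by rewrite ler_wpM2r ?variation_ge0// ler_nat.
by rewrite -[#|I|.+2]addn2 natrD mulrDl; lra.
Qed.

End Oscillation.

End GridSums.
(** * Identities and estimates on a fixed grid *)

Section FixedGrid.
Context {R : realType} {n : nat} {I J : finType} {G : network R n I J}.
Variable h : step G.
Implicit Types (U W M p w mu : gridfun h) (F : J -> nat -> R).

Local Notation one := (grid_const 1 : gridfun h).

Lemma DpB U W j k : Dp (grid_sub U W) j k = Dp U j k - Dp W j k.
Proof. by rewrite /Dp /gat /grid_sub; ring. Qed.

Lemma gcontinuousB U W : gcontinuous U -> gcontinuous W ->
  gcontinuous (grid_sub U W).
Proof.
move=> /gcontinuousP[v [v0 v1]] /gcontinuousP[v' [v0' v1']].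
apply: (@vertex_valuesP _ _ _ _ _ _ _ (fun i => v i - v' i)); split => j.
  by rewrite -v0 -v0'.
by rewrite -v1 -v1'.
Qed.

Lemma ginnerBl U W p : ginner (grid_sub U W) p = ginner U p - ginner W p.
Proof.
rewrite !ginner_trapezoid cellsB; apply: eq_cells => j k _.
by rewrite /gat /grid_sub; field.
Qed.

Lemma ginner_constl a p : ginner (grid_const a) p = a * ginner p one.
Proof.
rewrite !ginner_trapezoid cellsZ; apply: eq_cells => j k _.
by rewrite /gat /grid_const; field.
Qed.

Lemma gat_const (a : R) j k : gat (grid_const a : gridfun h) j k = a.
Proof. by []. Qed.

Lemma ginner1 : ginner one one = total_len (G := G).
Proof.
rewrite ginner_trapezoid -(cells_step h); apply: eq_cells => j k _.
by rewrite /gat /grid_const; field.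
Qed.

Lemma ginner_norm_le U p B : (forall j k, (k <= nst h j)%N -> 0 <= gat p j k) ->
  (forall j k, (k <= nst h j)%N -> `|gat U j k| <= B) ->
  `|ginner U p| <= B * ginner p one.
Proof.
move=> p0 UB; rewrite !ginner_trapezoid cellsZ.
apply: le_trans (norm_cells _ _) _; apply: le_cells => j k kN.
rewrite normrM (gtr0_norm (stp_gt0 h j)) mulrCA ler_wpM2l ?stp_ge0//.
rewrite normrM [X in _ * X]gtr0_norm// mulrA ler_wpM2r//.
have pk := p0 j k (ltnW kN); have pk1 := p0 j k.+1 kN.
apply: le_trans (ler_normD _ _) _; rewrite !normrM.
rewrite (ger0_norm pk) (ger0_norm pk1).
have : `|gat U j k| * gat p j k <= B * gat p j k.
  by rewrite ler_wpM2r ?UB// ltnW.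
have : `|gat U j k.+1| * gat p j k.+1 <= B * gat p j k.+1.
  by rewrite ler_wpM2r ?UB.
by rewrite /gat /grid_const; lra.
Qed.

Lemma ginner_mean U p a B : (forall j k, (k <= nst h j)%N -> 0 <= gat p j k) ->
  (forall j k, (k <= nst h j)%N -> `|gat U j k - a| <= B) ->
  `|ginner U p - a * ginner p one| <= B * ginner p one.
Proof.
move=> p0 UB; rewrite -ginner_constl -ginnerBl; exact: ginner_norm_le.
Qed.

Lemma nodes_le_ginner U p : (forall j k, (k <= nst h j)%N -> 0 <= gat U j k) ->
  (forall j k, (k <= nst h j)%N -> 0 <= gat p j k) ->
  nodes h (fun j k => h j * gat U j k * gat p j k) <= ginner U p.
Proof.
move=> U0 p0; rewrite ginnerE lerDl; apply: sumr_ge0 => j _.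
by rewrite addr_ge0// !mulr_ge0 ?U0 ?p0 ?stp_ge0.
Qed.

Definition grid_div U W : gridfun h := fun j k => U j k / W j k.

Lemma grid_div_continuous M mu : gcontinuous M -> gcontinuous mu ->
  gcontinuous (grid_div M mu).
Proof.
move=> /gcontinuousP[v [v0 v1]] /gcontinuousP[v' [v0' v1']].
apply: (@vertex_valuesP _ _ _ _ _ _ _ (fun i => v i / v' i)); split => j.
  by rewrite -v0 -v0'.
by rewrite -v1 -v1'.
Qed.

Section Identities.
Variables (nu : J -> R) (beta : R) (f : 'rV[R]_n -> R).

Definition slopes (phi : R -> R -> R) U j k : R := phi (Dp U j k) (Dp U j k.-1).

Lemma g_atE U j k : g_at beta f U j k = slopes (nham beta) U j k + f (node h j k).
Proof. by []. Qed.

Definition discrete_hjb U W (Lam : R) : Prop :=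
  (forall j k, (1 <= k < nst h j)%N ->
     - nu j * D2 U j k + g_at beta f U j k + Lam = gat W j k) /\
  (forall i, S_op nu U (grid_sub W (grid_const Lam)) i = 0).

Lemma g1_atE U j k : 2 <= beta -> g1_at beta f U j k = slopes (nham1 beta) U j k.
Proof. exact: num_ham_q1E. Qed.

Lemma g2_atE U j k : 2 <= beta -> g2_at beta f U j k = slopes (nham2 beta) U j k.
Proof. exact: num_ham_q2E. Qed.

(** The diffusion is symmetric, so it cancels between the Hamilton-Jacobi
    equations tested with [M - mu] and the Fokker-Planck equations tested with
    [U - w]; what the Hamiltonian contributes to both are the gaps. The
    residuals of [w] and [mu] are [tau] at the nodes, [S_op] at the vertices
    and [e] in the cells. *)
Lemma gap_identity U M VM w mu Vmu Lam lam (tau e : J -> nat -> R)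
    (cM c : J -> R) v : 2 <= beta ->
  gcontinuous U -> gcontinuous w -> ginner M one = ginner mu one ->
  vertex_values (grid_sub M mu) v ->
  discrete_hjb U VM Lam ->
  conserved nu (g1_at beta f U) (g2_at beta f U) M cM ->
  (forall j k, (1 <= k < nst h j)%N ->
     - nu j * D2 w j k + g_at beta f w j k + lam = gat Vmu j k + tau j k) ->
  kirchhoff G c ->
  (forall j k, (k < nst h j)%N ->
     flux nu (g1_at beta f w) (g2_at beta f w) mu j k = c j + e j k) ->
  nodes h (fun j k => h j * gat M j k *
     gap beta (Dp U j k) (Dp U j k.-1) (Dp w j k) (Dp w j k.-1)) +
  nodes h (fun j k => h j * gat mu j k *
     gap beta (Dp w j k) (Dp w j k.-1) (Dp U j k) (Dp U j k.-1)) +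
  ginner (grid_sub VM Vmu) (grid_sub M mu) =
  nodes h (fun j k => h j * tau j k * gat (grid_sub M mu) j k)
  - \sum_i v i * S_op nu w (grid_sub Vmu (grid_const lam)) i
  - cells h (fun j k => e j k * incr (grid_sub U w) j k).
Proof.
move=> b2 Uc wc mass vP [HU SU] [KM FM] Hw Kc Fw.
have E1 := hjb_weak nu U (grid_sub VM (grid_const Lam)) vP.
have E2 := hjb_weak nu w (grid_sub Vmu (grid_const lam)) vP.
have pc : gcontinuous (grid_sub U w) by exact: gcontinuousB.
have E3 := fp_weak nu (g1_at beta f U) (g2_at beta f U) M KM pc.
have E4 := fp_weak nu (g1_at beta f w) (g2_at beta f w) mu Kc pc.
rewrite big1 ?subr0 in E1; last by move=> i _; rewrite SU mulr0.
rewrite !ginnerBl !ginner_constl in E1 E2.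
have m0 : ginner (grid_sub M mu) one = 0 by rewrite ginnerBl mass subrr.
rewrite m0 !mulr0 !subr0 in E1 E2.
have {}E3 : nodes h (fun j k => gat M j k *
    (g1_at beta f U j k * incr (grid_sub U w) j k +
     g2_at beta f U j k * incr (grid_sub U w) j k.-1)) =
  - cells h (fun j k => nu j * Dp M j k * incr (grid_sub U w) j k).
  apply/eqP; rewrite -addr_eq0 E3; apply/eqP.
  rewrite [LHS](_ : _ = cells h (fun _ _ => 0)).
    by rewrite /cells big1// => j _; rewrite big1.
  by apply: eq_cells => j k kN; rewrite FM// subrr mul0r.
have {}E4 : nodes h (fun j k => gat mu j k *
    (g1_at beta f w j k * incr (grid_sub U w) j k +
     g2_at beta f w j k * incr (grid_sub U w) j k.-1)) =
  cells h (fun j k => e j k * incr (grid_sub U w) j k)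
  - cells h (fun j k => nu j * Dp mu j k * incr (grid_sub U w) j k).
  rewrite -[LHS](addrK (cells h (fun j k => nu j * Dp mu j k * incr (grid_sub U w) j k))).
  congr (_ - _); rewrite E4; apply: eq_cells => j k kN.
  by rewrite Fw// addrAC subrr add0r.
have E5 : cells h (fun j k => nu j * Dp U j k * incr (grid_sub M mu) j k) -
   cells h (fun j k => nu j * Dp w j k * incr (grid_sub M mu) j k) =
   cells h (fun j k => nu j * Dp M j k * incr (grid_sub U w) j k) -
   cells h (fun j k => nu j * Dp mu j k * incr (grid_sub U w) j k).
  rewrite !cellsB; apply: eq_cells => j k _.
  by rewrite !incrE !DpB; ring.
(* The definition of the gaps, with the equations inserted for the values of
   the Hamiltonian. *)
have E6 : nodes h (fun j k => h j * gat M j k *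
     gap beta (Dp U j k) (Dp U j k.-1) (Dp w j k) (Dp w j k.-1)) +
  nodes h (fun j k => h j * gat mu j k *
     gap beta (Dp w j k) (Dp w j k.-1) (Dp U j k) (Dp U j k.-1)) =
  nodes h (fun j k => h j * (- nu j * D2 U j k -
     gat (grid_sub VM (grid_const Lam)) j k) * gat (grid_sub M mu) j k) -
  nodes h (fun j k => h j * (- nu j * D2 w j k -
     gat (grid_sub Vmu (grid_const lam)) j k) * gat (grid_sub M mu) j k) +
  nodes h (fun j k => h j * tau j k * gat (grid_sub M mu) j k) +
  nodes h (fun j k => gat M j k *
    (g1_at beta f U j k * incr (grid_sub U w) j k +
     g2_at beta f U j k * incr (grid_sub U w) j k.-1)) -
  nodes h (fun j k => gat mu j k *
    (g1_at beta f w j k * incr (grid_sub U w) j k +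
     g2_at beta f w j k * incr (grid_sub U w) j k.-1)).
  rewrite !nodesN !nodesD; apply: eq_nodes => j k kN.
  have eU : - nu j * D2 U j k - gat (grid_sub VM (grid_const Lam)) j k =
      - g_at beta f U j k.
    rewrite -[gat (grid_sub _ _) j k]/(gat VM j k - Lam) -HU//; ring.
  have ew : - nu j * D2 w j k - gat (grid_sub Vmu (grid_const lam)) j k =
      tau j k - g_at beta f w j k.
    have -> : tau j k = - nu j * D2 w j k + g_at beta f w j k + lam - gat Vmu j k.
      by rewrite Hw// addrAC subrr add0r.
    by rewrite -[gat (grid_sub _ _) j k]/(gat Vmu j k - lam); ring.
  rewrite eU ew !g_atE !g1_atE// !g2_atE// /slopes /gap !incrE !DpB.
  by rewrite /gat /grid_sub; ring.
have lin (a a' b b' x x' y y' S T E g B B' : R) :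
    g = x - x' + T + B - B' -> B = - b -> B' = E - b' -> a = y + x ->
    a' = y' + x' - S -> a - a' = b - b' ->
    g + (y - y') = T - S - E.
  by clear; lra.
by rewrite ginnerBl; exact: lin E6 E3 E4 E1 E2 E5.
Qed.

(** The density [mu] is used as an integrating factor: written for the ratio
    [M / mu], the Fokker-Planck equation has no zeroth-order term up to the
    residual flux of [mu]. Its test function is the ratio itself, and the signs
    of the drifts make the upwinding dissipative. *)
Lemma energy_estimate (g1 g2 : J -> nat -> R) M mu (cM c : J -> R) :
  (forall j k, g1 j k <= 0) -> (forall j k, 0 <= g2 j k) ->
  (forall j k, (k <= nst h j)%N -> 0 < gat mu j k) ->
  gcontinuous M -> gcontinuous mu ->
  conserved nu g1 g2 M cM ->
  kirchhoff G c ->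
  cells h (fun j k => nu j * ((gat mu j k + gat mu j k.+1) / 2) *
     (Dp (grid_div M mu) j k * incr (grid_div M mu) j k)) <=
  - cells h (fun j k => (flux nu g1 g2 mu j k - c j) *
     ((gat (grid_div M mu) j k + gat (grid_div M mu) j k.+1) / 2) *
     incr (grid_div M mu) j k).
Proof.
move=> g10 g20 mu0 Mc muc [KM FM] Kc; have rc := grid_div_continuous Mc muc.
set rho := grid_div M mu in rc *.
pose rho2 : gridfun h := fun j k => rho j k ^+ 2 / 2.
have r2c : gcontinuous rho2.
  have [a [a0 a1]] := gcontinuousP rc.
  apply: (@vertex_valuesP _ _ _ _ _ _ _ (fun i => a i ^+ 2 / 2)); split => j.
    by rewrite -a0.
  by rewrite -a1.
have Z1 := kirchhoff_cells KM rc; have Z2 := kirchhoff_cells Kc r2c.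
(* Fluxes satisfying Kirchhoff's law do not see continuous functions: that of
   [M] is paired with the ratio, [c] with half of its square. *)
have E0 : cells h (fun j k => c j * incr rho2 j k
    - flux nu g1 g2 M j k * incr rho j k) = 0.
  rewrite -[RHS]subr0 -{1}Z2 -Z1 cellsB; apply: eq_cells => j k kN.
  by rewrite FM.
rewrite -subr_ge0 cellsN cellsB -[leLHS]E0; apply: le_cells => j k kN.
have m0 := mu0 j k (ltnW kN); have m1 := mu0 j k.+1 kN.
have MrE i : gat M j i = gat rho j i * gat mu j i \/ gat mu j i = 0.
  have [z|nz] := eqVneq (gat mu j i) 0; first by right.
  by left; rewrite /rho /grid_div /gat divfK.
have {MrE}-[M0 M1] : gat M j k = gat rho j k * gat mu j k /\
    gat M j k.+1 = gat rho j k.+1 * gat mu j k.+1.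
  split; first by case: (MrE k) => // z; rewrite z ltxx in m0.
  by case: (MrE k.+1) => // z; rewrite z ltxx in m1.
set a1 := if k == 0%N then 0 else gat mu j k * g1 j k.
set a2 := if k.+1 == nst h j then 0 else gat mu j k.+1 * g2 j k.+1.
have a10 : a1 <= 0 by rewrite /a1; case: ifP => // _; rewrite pmulr_rle0.
have a20 : 0 <= a2 by rewrite /a2; case: ifP => // _; rewrite pmulr_rge0.
have fM : flux nu g1 g2 M j k = nu j * Dp M j k + (gat rho j k.+1 * a2 + gat rho j k * a1).
  rewrite /flux /a1 /a2 M0 M1; congr (_ + (_ + _)); case: ifP => _; ring.
have fm : flux nu g1 g2 mu j k = nu j * Dp mu j k + (a2 + a1) by [].
rewrite fM fm.
have -> : incr rho2 j k = (gat rho j k.+1 ^+ 2 - gat rho j k ^+ 2) / 2.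
  by rewrite /incr /gat /rho2; field.
rewrite /Dp M0 M1 /incr -subr_ge0.
set r0 := gat rho j k; set r1 := gat rho j k.+1.
set x := (X in 0 <= X); have -> : x = (r1 - r0) ^+ 2 / 2 * (a2 - a1).
  rewrite /x; field; exact: stp_neq0.
by rewrite mulr_ge0 ?subr_ge0 ?divr_ge0 ?sqr_ge0//; lra.
Qed.
End Identities.
End FixedGrid.
(** * A priori bounds for the scheme *)

Section FixedGridEstimates.
Context {R : realType} {n : nat} {I J : finType} {G : network R n I J}.
Variable h : step G.
Implicit Types (U W M p w mu : gridfun h) (F : J -> nat -> R).

Local Notation one := (grid_const 1 : gridfun h).
Local Notation L := (total_len (G := G)).

Lemma total_len_ge0 : 0 <= L.
Proof. by apply: sumr_ge0 => j _; exact: ltW (len_gt0 _ _). Qed.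

Lemma nodes_const_le F B : 0 <= B ->
  (forall j k, (1 <= k < nst h j)%N -> F j k <= h j * B) -> nodes h F <= B * L.
Proof.
move=> B0 FB; apply: (@le_trans _ _ (nodes h (fun j k => B * h j))).
  by apply: le_nodes => j k kN; rewrite mulrC FB.
rewrite -(cells_step h) cellsZ; apply: nodes_le_cells => j k _.
by rewrite mulr_ge0// ltW ?stp_gt0.
Qed.

Lemma cells0 F : (forall j k, (k < nst h j)%N -> F j k = 0) -> cells h F = 0.
Proof.
by move=> F0; rewrite /cells big1// => j _; rewrite big_nat big1// => k /andP[_]; exact: F0.
Qed.

Lemma grid_density_gat M j k : grid_density M -> 0 <= gat M j k.
Proof. by case=> _ M0 _; exact: M0. Qed.

Section Apriori.
Variables (nu : J -> R) (beta : R) (f : 'rV[R]_n -> R).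
Variables (U M V : gridfun h) (cM : J -> R).

Local Notation P := (slopes (nham beta) U).

Lemma slopes_nham_ge0 j k : 0 <= P j k. Proof. exact: npow_ge0. Qed.

(** Testing the Hamilton-Jacobi equation with the density and the
    Fokker-Planck equation with the value function eliminates the diffusion
    and bounds the ergodic constant from below, by Euler's identity for the
    homogeneous part of the Hamiltonian. *)
Lemma ergodic_ge (Lam C Cf : R) : 2 <= beta -> gcontinuous U -> grid_density M ->
  discrete_hjb nu beta f U V Lam ->
  conserved nu (g1_at beta f U) (g2_at beta f U) M cM ->
  (forall j k, (k <= nst h j)%N -> `|gat V j k| <= C) ->
  0 <= Cf -> (forall j k, (1 <= k < nst h j)%N -> `|f (node h j k)| <= Cf) ->
  - (C + Cf) <= Lam.
Proof.
have lin (C' Cf' a c c' y g g' l x : R) : c = g - l + a -> y + c' = 0 -> c' = c ->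
    y + a = x - g' -> 0 <= x -> g' <= Cf' -> - C' <= g -> - (C' + Cf') <= l.
  by lra.
move=> b2 Uc Md [HU SU] [KM FM] VC Cf0 fC.
have [Mc M0 M1] := Md; have [v vP] := gcontinuousP Mc.
have E1 := hjb_weak nu U (grid_sub V (grid_const Lam)) vP.
rewrite big1 ?subr0 in E1; last by move=> i _; rewrite SU mulr0.
rewrite ginnerBl ginner_constl M1 mulr1 in E1.
have E3 := fp_weak nu (g1_at beta f U) (g2_at beta f U) M KM Uc.
rewrite [RHS]cells0 in E3; last by move=> j k kN; rewrite FM// subrr mul0r.
have E5 : cells h (fun j k => nu j * Dp M j k * incr U j k) =
          cells h (fun j k => nu j * Dp U j k * incr M j k).
  by apply: eq_cells => j k _; rewrite !incrE; ring.
have E6 : nodes h (fun j k => gat M j k *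
    (g1_at beta f U j k * incr U j k + g2_at beta f U j k * incr U j k.-1)) +
  nodes h (fun j k => h j * (- nu j * D2 U j k -
     gat (grid_sub V (grid_const Lam)) j k) * gat M j k) =
  nodes h (fun j k => h j * gat M j k * ((beta - 1) * P j k)) -
  nodes h (fun j k => h j * gat M j k * f (node h j k)).
  rewrite nodesN !nodesD; apply: eq_nodes => j k kN.
  rewrite -[gat (grid_sub _ _) j k]/(gat V j k - Lam) -HU// g_atE g1_atE// g2_atE//.
  rewrite !incrE; have := nham_euler (Dp U j k) (Dp U j k.-1) b2.
  rewrite -/(slopes (nham1 beta) U j k) -/(slopes (nham2 beta) U j k).
  rewrite -/(slopes (nham beta) U j k) => e.
  have -> : gat M j k * (slopes (nham1 beta) U j k * (h j * Dp U j k) +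
      slopes (nham2 beta) U j k * (h j * Dp U j k.-1)) =
    h j * gat M j k * (beta * slopes (nham beta) U j k) by rewrite -e; ring.
  ring.
have hM j k : 0 <= h j * gat M j k.
  by rewrite mulr_ge0 ?grid_density_gat// ltW ?stp_gt0.
have P0 : 0 <= nodes h (fun j k => h j * gat M j k * ((beta - 1) * P j k)).
  apply: nodes_ge0 => j k _; rewrite mulr_ge0// mulr_ge0 ?slopes_nham_ge0//; lra.
have fM : nodes h (fun j k => h j * gat M j k * f (node h j k)) <= Cf.
  apply: (@le_trans _ _ (nodes h (fun j k => Cf * (h j * gat M j k * gat one j k)))).
    apply: le_nodes => j k kN; have -> : gat one j k = 1 by [].
    rewrite mulr1 mulrC.
    by rewrite ler_wpM2r// (le_trans (ler_norm _))// fC.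
  rewrite -nodesZ -[leRHS]mulr1 ler_wpM2l// -[leRHS]M1.
  by apply: nodes_le_ginner => // j k _; exact: M0.
have VM : `|ginner V M| <= C * ginner M one.
  by apply: ginner_norm_le => // j k _; exact: M0.
rewrite M1 mulr1 in VM; move: VM; rewrite ler_norml => /andP[VM _].
exact: lin E1 E3 E5 E6 P0 fM VM.
Qed.

Lemma nodes_nhamE (Lam : R) : 2 <= beta ->
  discrete_hjb nu beta f U V Lam ->
  nodes h (fun j k => h j * P j k) =
  ginner V one - Lam * L - nodes h (fun j k => h j * f (node h j k)).
Proof.
have lin (a b c d : R) : 0 = a + b -> c + d = - b -> c = a - d by lra.
move=> b2 [HU SU].
have vP : vertex_values one (fun=> 1) by split.
have := hjb_weak nu U (grid_sub V (grid_const Lam)) vP.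
rewrite [X in _ - X]big1 ?subr0; last by move=> i _; rewrite SU mulr0.
rewrite cells0; last first.
  by move=> j k _; rewrite /incr /gat /grid_const subrr mulr0.
rewrite ginnerBl ginner_constl ginner1 => E.
apply: lin E _; rewrite nodesD nodesN; apply: eq_nodes => j k kN.
rewrite -[gat (grid_sub _ _) j k]/(gat V j k - Lam) -HU// g_atE.
have -> : gat one j k = 1 by [].
ring.
Qed.

Lemma nodes_nham_le (Lam C Cf : R) : 2 <= beta -> 0 <= Cf -> - (C + Cf) <= Lam ->
  discrete_hjb nu beta f U V Lam ->
  (forall j k, (k <= nst h j)%N -> `|gat V j k| <= C) ->
  (forall j k, (1 <= k < nst h j)%N -> `|f (node h j k)| <= Cf) ->
  nodes h (fun j k => h j * P j k) <= 2 * (C + Cf) * L /\ Lam * L <= (C + Cf) * L.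
Proof.
have lin (c c' T x g l y : R) : x = g - l - y -> 0 <= x -> g <= c * T ->
    - y <= c' * T -> - (c + c') * T <= l ->
    x <= 2 * (c + c') * T /\ l <= (c + c') * T.
  by lra.
move=> b2 Cf0 lamD HS VC fC.
have E := nodes_nhamE b2 HS.
have P0 : 0 <= nodes h (fun j k => h j * P j k).
  by apply: nodes_ge0 => j k _; rewrite mulr_ge0 ?slopes_nham_ge0// ltW ?stp_gt0.
have : `|ginner V one| <= C * ginner one one.
  by apply: ginner_norm_le => // j k _; exact: ler01.
rewrite ginner1 ler_norml => /andP[_ V1].
have f1 : - nodes h (fun j k => h j * f (node h j k)) <= Cf * L.
  rewrite nodesN; apply: nodes_const_le => // j k kN.
  rewrite -mulrN ler_wpM2l//; first by rewrite ltW ?stp_gt0.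
  by rewrite (le_trans (ler_norm _))// normrN fC.
have lL : - (C + Cf) * L <= Lam * L by rewrite ler_wpM2r ?total_len_ge0.
exact: lin E P0 V1 f1 lL.
Qed.

(** Beyond 1, a number is dominated by its [beta]-th power. *)
Lemma slope_parts_le_nham q1 q2 : 2 <= beta ->
  posp q2 <= 1 + nham beta q1 q2 /\ negp q1 <= 1 + nham beta q1 q2.
Proof.
move=> b2; rewrite /nham /npow.
have b1 : 1 <= beta / 2 by lra.
have b0 : 0 <= beta / 2 by lra.
have key x s : 0 <= x -> x ^+ 2 <= s -> x <= 1 + s `^ (beta / 2).
  move=> x0 xs; have [x1|x1] := lerP x 1.
    by apply: le_trans x1 _; rewrite lerDl powR_ge0.
  have s1 : 1 <= s by nra.
  apply: (@le_trans _ _ (s `^ (beta / 2))); last by rewrite lerDr.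
  by apply: le_trans (le1r_powR s1 b1); nra.
by split; apply: key; rewrite ?posp_ge0 ?negp_ge0// ?lerDr ?lerDl sqr_ge0.
Qed.

(** [slope_osc] bounds the total variation of the slope on an edge. To it
    [slope_bound] adds the bound of one slope, obtained by averaging the
    Hamiltonian over the interior nodes, which carry at least half of the
    edge. *)
Definition slope_osc (D : R) j : R := 4 * D * L / nu j.
Definition slope_bound (D : R) j : R :=
  4 * (2 * D * L + (1 + slope_osc D j) * L) / len G j + slope_osc D j.

(** The second difference of [U] is bounded in L^1 by the Hamilton-Jacobi
    equation, so the slope oscillates little on an edge; it cannot be large
    everywhere since its beta-th power is summable. *)
Lemma slope_le (Lam C Cf : R) : 2 <= beta -> (forall j, 0 < nu j) -> 0 <= C -> 0 <= Cf ->
  - (C + Cf) <= Lam -> 0 < L ->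
  discrete_hjb nu beta f U V Lam ->
  (forall j k, (k <= nst h j)%N -> `|gat V j k| <= C) ->
  (forall j k, (1 <= k < nst h j)%N -> `|f (node h j k)| <= Cf) ->
  forall j k, (k < nst h j)%N -> `|Dp U j k| <= slope_bound (C + Cf) j.
Proof.
have lin1 (c c' l a b x : R) : - c <= b -> b <= c -> - c' <= x -> x <= c' ->
    0 <= a -> l <= c + c' -> - (c + c') <= l -> 0 <= c -> 0 <= c' ->
    - (a + 2 * (c + c')) <= a + x + l - b <= a + 2 * (c + c').
  by move=> *; apply/andP; split; lra.
have lin2 (d a b : R) : a <= 2 * d -> b <= 2 * d -> b + a <= 4 * d by lra.
have lin3 (x l t : R) : x * (l / 2) <= t -> x * l <= 2 * t by lra.
have lin4 (O a b c : R) : a <= 1 + c -> `|a - b| <= O -> b <= c + (1 + O).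
  by rewrite ler_norml => h1 /andP[h2 h3]; lra.
move=> b2 nu0 C0 Cf0 lamD L0 HS VC fC j; have [HU _] := HS.
have [PD lamL] := nodes_nham_le b2 Cf0 lamD HS VC fC.
have {}lamL : Lam <= (C + Cf) by move: lamL; rewrite ler_pM2r.
have hj := stp_gt0 h j; have nj := nu0 j; have lj := len_gt0 G j.
set O := slope_osc (C + Cf) j.
have O0 : 0 <= O by rewrite /O /slope_osc divr_ge0 ?mulr_ge0 ?addr_ge0// ltW.
have jump k : (1 <= k < nst h j)%N ->
    nu j * `|Dp U j k - Dp U j k.-1| <= h j * P j k + h j * (2 * (C + Cf)).
  move=> kN; have k1 : k.-1.+1 = k by rewrite prednK//; case/andP: kN.
  have e : nu j * (Dp U j k - Dp U j k.-1) =
      h j * (P j k + f (node h j k) + Lam - gat V j k).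
    rewrite -HU// g_atE /D2 /Dp k1; field; exact: stp_neq0.
  rewrite -(gtr0_norm nj) -normrM e normrM (gtr0_norm hj) -mulrDr ler_pM2l//.
  have := VC j k; rewrite ltnW; last by case/andP: kN.
  move=> /(_ isT); rewrite ler_norml => /andP[V1 V2].
  have := fC j k kN; rewrite ler_norml => /andP[f1 f2].
  have := slopes_nham_ge0 j k => p0.
  by rewrite ler_norml; exact: lin1.
have Psum N : (N <= nst h j)%N -> \sum_(1 <= k < N) h j * P j k <= 2 * (C + Cf) * L.
  move=> NN; apply: le_trans PD; rewrite /nodes (bigD1 j)//= ler_wpDr//.
    apply: sumr_ge0 => i _; apply: sumr_ge0 => k _.
    by rewrite mulr_ge0 ?slopes_nham_ge0// ltW ?stp_gt0.
  case: N NN => [|N] NN; first by rewrite big_geq// sumr_ge0// => k _;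
    rewrite mulr_ge0 ?slopes_nham_ge0// ltW.
  rewrite (big_cat_nat _ NN)//= lerDl; apply: sumr_ge0 => k _.
  by rewrite mulr_ge0 ?slopes_nham_ge0// ltW.
have Nh : (nst h j)%:R * h j = len G j := nst_stp h j.
have lenL : len G j <= L.
  by rewrite /total_len (bigD1 j)//= lerDl sumr_ge0// => i _; exact: ltW (len_gt0 _ _).
have osc k : (k < nst h j)%N -> `|Dp U j k - Dp U j 0| <= O.
  move=> kN; rewrite -telescope_sum; apply: le_trans (ler_norm_sum _ _ _) _.
  rewrite /O /slope_osc ler_pdivlMr// mulrC mulr_sumr.
  apply: (@le_trans _ _ (\sum_(1 <= i < k.+1) (h j * P j i + h j * (2 * (C + Cf))))).
    rewrite [leRHS]big_add1/=; apply: ler_sum_nat => i /andP[_ ik].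
    by apply: jump => /=; apply: leq_ltn_trans kN.
  rewrite big_split/= sumr_const_nat subSS subn0 -[leRHS]mulrA.
  apply: lin2; last by rewrite [leRHS]mulrA; exact: Psum.
  rewrite [leRHS]mulrA.
  have D0 : 0 <= (C + Cf) by rewrite addr_ge0.
  have -> : h j * (2 * (C + Cf)) *+ k = 2 * (C + Cf) * (k%:R * h j).
    by rewrite -mulr_natr; ring.
  rewrite ler_wpM2l ?mulr_ge0//.
  by apply: le_trans lenL; rewrite -Nh ler_pM2r// ler_nat ltnW.
set T := 2 * (C + Cf) * L + (1 + O) * L.
(* There are at least two cells. *)
have half : len G j / 2 <= (nst h j).-1%:R * h j.
  rewrite -Nh mulrAC ler_pM2r// ler_pdivrMr//.
  have := nst_gt1 h j; case: (nst h j) => // N /=.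
  by rewrite ltnS => N1; rewrite -natrM ler_nat; rewrite muln2 -addnn -addn1 leq_add2l.
have part x : 0 <= x -> (forall k, (1 <= k < nst h j)%N -> x <= P j k + (1 + O)) ->
    x <= 2 * T / len G j.
  move=> x0 xP; rewrite ler_pdivlMr//.
  apply: lin3.
  apply: (@le_trans _ _ (x * ((nst h j).-1%:R * h j))); first by rewrite ler_wpM2l.
  have -> : x * ((nst h j).-1%:R * h j) = \sum_(1 <= k < nst h j) h j * x.
    by rewrite sumr_const_nat subn1 -mulr_natl; ring.
  apply: (@le_trans _ _ (\sum_(1 <= k < nst h j) (h j * P j k + h j * (1 + O)))).
    by apply: ler_sum_nat => k kN; rewrite -mulrDr ler_pM2l// xP.
  rewrite big_split/= lerD ?Psum// sumr_const_nat -mulr_natl mulrA mulrC.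
  rewrite ler_wpM2l ?addr_ge0//; apply: le_trans lenL; rewrite -Nh ler_pM2r//.
  by rewrite ler_nat leq_subr.
have p0T : posp (Dp U j 0) <= 2 * T / len G j.
  apply: part; first exact: posp_ge0.
  move=> k kN; have kN' : (k.-1 < nst h j)%N.
    by case/andP: kN => _; apply: leq_ltn_trans; exact: leq_pred.
  have [h1 _] := slope_parts_le_nham (Dp U j k) (Dp U j k.-1) b2.
  have h2 := le_trans (posp_lip (Dp U j k.-1) (Dp U j 0)) (osc _ kN').
  exact: lin4 h1 h2.
have n0T : negp (Dp U j 0) <= 2 * T / len G j.
  apply: part; first exact: negp_ge0.
  move=> k kN; have kN' : (k < nst h j)%N by case/andP: kN.
  have [_ h1] := slope_parts_le_nham (Dp U j k) (Dp U j k.-1) b2.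
  have h2 := le_trans (negp_lip (Dp U j k) (Dp U j 0)) (osc _ kN').
  exact: lin4 h1 h2.
have P0 : `|Dp U j 0| <= 4 * T / len G j.
  rewrite -[X in `|X|]pospBnegp (le_trans (ler_normB _ _))//.
  rewrite !ger0_norm ?posp_ge0 ?negp_ge0//.
  have -> : 4 * T / len G j = 2 * T / len G j + 2 * T / len G j by rewrite -mulrDl; congr (_ / _); ring.
  exact: lerD.
move=> k kN; have := osc k kN; rewrite /slope_bound -/O -/T => ok.
have -> : Dp U j k = Dp U j 0 + (Dp U j k - Dp U j 0) by ring.
by rewrite (le_trans (ler_normD _ _))// lerD.
Qed.

End Apriori.
End FixedGridEstimates.
(** * Stability of the densities and of the slopes *)

Section FixedGridStability.
Context {R : realType} {n : nat} {I J : finType} {G : network R n I J}.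
Variable h : step G.
Implicit Types (U W M p w mu rho : gridfun h) (F : J -> nat -> R).

Local Notation one := (grid_const 1 : gridfun h).
Local Notation L := (total_len (G := G)).
Local Notation diam := ((#|I|.+2)%:R : R).

Definition mid p j k : R := (gat p j k + gat p j k.+1) / 2.

(** The energy estimate after absorbing the gradient by Young's inequality. *)
Lemma energy_L2 nu (g1 g2 : J -> nat -> R) M mu (cM c : J -> R) (a : R) :
  0 < a ->
  (forall j k, (k < nst h j)%N -> a <= nu j * mid mu j k) ->
  (forall j k, g1 j k <= 0) -> (forall j k, 0 <= g2 j k) ->
  (forall j k, (k <= nst h j)%N -> 0 < gat mu j k) ->
  gcontinuous M -> gcontinuous mu ->
  conserved nu g1 g2 M cM ->
  kirchhoff G c ->
  a ^+ 2 * cells h (fun j k => h j * Dp (grid_div M mu) j k ^+ 2) <=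
  cells h (fun j k => h j *
    ((flux nu g1 g2 mu j k - c j) * mid (grid_div M mu) j k) ^+ 2).
Proof.
have young (b e d : R) : 0 < b -> - (e * d) <= b / 2 * d ^+ 2 + (2 * b)^-1 * e ^+ 2.
  move=> b0; rewrite -subr_ge0.
  have -> : b / 2 * d ^+ 2 + (2 * b)^-1 * e ^+ 2 - - (e * d) =
    (2 * b)^-1 * (b * d + e) ^+ 2 by field; exact: lt0r_neq0.
  by rewrite mulr_ge0 ?sqr_ge0// invr_ge0 mulr_ge0// ltW.
have lin (b X E : R) : 0 < b -> b * X <= b / 2 * X + (2 * b)^-1 * E -> b ^+ 2 * X <= E.
  move=> b0 le; have : b / 2 * X <= (2 * b)^-1 * E by move: (_ * E) le => z; lra.
  have b2 : 0 < 2 * b by rewrite mulr_gt0.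
  rewrite -(ler_pM2l b2) (_ : 2 * b * ((2 * b)^-1 * E) = E).
    by rewrite (_ : 2 * b * (b / 2 * X) = b ^+ 2 * X)//; field.
  by rewrite mulVKf// lt0r_neq0.
move=> a0 aP g10 g20 mu0 Mc muc HM Kc.
have E := energy_estimate g10 g20 mu0 Mc muc HM Kc.
set rho := grid_div M mu in E *.
apply: lin => //; rewrite !cellsZ cellsD.
apply: (le_trans _ (le_trans E _)).
  apply: le_cells => j k kN; rewrite incrE.
  have -> : nu j * ((gat mu j k + gat mu j k.+1) / 2) *
      (Dp rho j k * (h j * Dp rho j k)) = nu j * mid mu j k * (h j * Dp rho j k ^+ 2).
    by rewrite /mid; ring.
  by rewrite ler_wpM2r ?aP// mulr_ge0 ?sqr_ge0 ?stp_ge0.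
rewrite cellsN; apply: le_cells => j k kN; rewrite incrE -/(mid rho j k).
set e := (_ - _) * _; set d := Dp _ _ _.
have -> : - (e * (h j * d)) = h j * - (e * d) by ring.
have -> : a / 2 * (h j * d ^+ 2) + (2 * a)^-1 * (h j * e ^+ 2) =
   h j * (a / 2 * d ^+ 2 + (2 * a)^-1 * e ^+ 2) by ring.
by rewrite ler_wpM2l ?stp_ge0 ?young.
Qed.

Lemma norm_young (b x : R) : 0 < b -> `|x| <= b + b^-1 * x ^+ 2.
Proof.
move=> b0; have [xb|bx] := lerP `|x| b.
  by apply: le_trans xb _; rewrite lerDl mulr_ge0 ?sqr_ge0// invr_ge0 ltW.
apply: (@le_trans _ _ (b^-1 * x ^+ 2)); last by rewrite lerDr ltW.
rewrite mulrC ler_pdivlMr// -real_normK ?num_real// expr2.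
by rewrite ler_wpM2l// ltW.
Qed.

Lemma variation_le p d : 0 < d ->
  variation p <= d * L + d^-1 * cells h (fun j k => h j * Dp p j k ^+ 2).
Proof.
move=> d0; rewrite /variation -(cells_step h) !cellsZ cellsD; apply: le_cells => j k kN.
rewrite incrE normrM (ger0_norm (stp_ge0 h j)).
have -> : d * h j + d^-1 * (h j * Dp p j k ^+ 2) = h j * (d + d^-1 * Dp p j k ^+ 2).
  by ring.
by rewrite ler_wpM2l ?stp_ge0 ?norm_young.
Qed.

(** Every value is within the oscillation of any weighted mean. *)
Lemma mean_osc p w a : gcontinuous p ->
  (forall j k, (k <= nst h j)%N -> 0 <= gat w j k) -> 0 < ginner w one ->
  forall j k, (k <= nst h j)%N ->
  `|gat p j k - a| <= diam * variation p + `|ginner p w - a * ginner w one| / ginner w one.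
Proof.
move=> pc w0 W0 j k kN.
have E : `|ginner p w - gat p j k * ginner w one| <=
    diam * variation p * ginner w one.
  by apply: ginner_mean => // j' k' kN'; exact: osc_le.
have -> : gat p j k - a = (ginner p w - a * ginner w one) / ginner w one -
    (ginner p w - gat p j k * ginner w one) / ginner w one.
  by field; exact: lt0r_neq0.
rewrite (le_trans (ler_normB _ _))// addrC lerD//.
  by rewrite normrM normfV (gtr0_norm W0) ler_pdivrMr.
by rewrite normrM normfV (gtr0_norm W0).
Qed.

Lemma ratio_osc M mu : gcontinuous M -> gcontinuous mu ->
  (forall j k, (k <= nst h j)%N -> 0 < gat mu j k) ->
  ginner M one = 1 -> ginner mu one = 1 ->
  forall j k, (k <= nst h j)%N ->
  `|gat (grid_div M mu) j k - 1| <= diam * variation (grid_div M mu).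
Proof.
move=> Mc muc mu0 M1 mu1 j k kN.
have rc := grid_div_continuous Mc muc.
have E : ginner (grid_div M mu) mu = 1.
  rewrite -M1 !ginner_trapezoid; apply: eq_cells => i l lN.
  have e q : (q <= nst h i)%N -> gat (grid_div M mu) i q * gat mu i q = gat M i q.
    by move=> qN; rewrite /grid_div /gat divfK// lt0r_neq0//; exact: mu0.
  by rewrite (e _ lN) (e _ (ltnW lN)) !gat_const !mulr1.
have := @mean_osc (grid_div M mu) mu 1 rc _ _ j k kN.
rewrite E mu1 mulr1 subrr normr0 mul0r addr0; apply => //.
by move=> i l lN; exact/ltW/mu0.
Qed.

(** With the weight [d], at most half of the variation is absorbed. *)
Definition ratio_bound (a b E : R) : R :=
  let A := E ^+ 2 / (a ^+ 2 * b) in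
  let d := 2 * A * diam + 1 in
  1 + diam * (2 * (d * L + A / d)).

(** The mass of [M] bounds its ratio to [mu] in L^1, so the energy grows only
    linearly with the maximum of the ratio. The square root of the energy
    controls the variation, and the latter the maximum: this closes. *)
Lemma ratio_le nu (g1 g2 : J -> nat -> R) M mu (cM c : J -> R) (a b E : R) :
  0 < a -> 0 < b ->
  (forall j k, (k < nst h j)%N -> a <= nu j * mid mu j k) ->
  (forall j k, g1 j k <= 0) -> (forall j k, 0 <= g2 j k) ->
  (forall j k, (k <= nst h j)%N -> b <= gat mu j k) ->
  grid_density M -> gcontinuous mu -> ginner mu one = 1 ->
  conserved nu g1 g2 M cM ->
  kirchhoff G c ->
  (forall j k, (k < nst h j)%N -> `|flux nu g1 g2 mu j k - c j| <= E) ->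
  forall j k, (k <= nst h j)%N -> gat (grid_div M mu) j k <= ratio_bound a b E.
Proof.
have lin (A d D v T X : R) : 0 <= A -> 0 < d -> 2 * A * D <= d -> 0 <= v ->
    v <= d * T + d^-1 * X -> X <= A * (1 + D * v) -> v <= 2 * (d * T + A / d).
  move=> A0 d0 Dd v0 vX XA.
  have : d^-1 * X <= A / d + v / 2.
    rewrite mulrC ler_pdivrMr// mulrDl divfK ?lt0r_neq0//.
    apply: le_trans XA _; rewrite mulrDr mulr1 lerD2l.
    have : (2 * A * D) * v <= d * v by rewrite ler_wpM2r.
    by lra.
  by move: (A / d) (d^-1 * X) vX => y z; lra.
move=> a0 b0 aP g10 g20 mub Md muc mu1 HM Kc eE.
have mu0 j k : (k <= nst h j)%N -> 0 < gat mu j k.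
  by move=> kN; exact: lt_le_trans b0 (mub j k kN).
have [Mc M0 M1] := Md.
have X2 := energy_L2 a0 aP g10 g20 mu0 Mc muc HM Kc.
set rho := grid_div M mu in X2 *.
have rc : gcontinuous rho := grid_div_continuous Mc muc.
have osc := ratio_osc Mc muc mu0 M1 mu1; rewrite -/rho in osc.
have r0 j k : (k <= nst h j)%N -> 0 <= gat rho j k.
  by move=> kN; rewrite /rho /grid_div /gat divr_ge0//; exact/ltW/mu0.
set v := variation rho in osc.
have rv j k : (k <= nst h j)%N -> gat rho j k <= 1 + diam * v.
  move=> kN; have := osc j k kN; rewrite ler_norml => /andP[_].
  by rewrite lerBlDl.
set B := 1 + diam * v in rv.
have B0 : 0 <= B by rewrite addr_ge0// mulr_ge0// variation_ge0.
set X := cells h _ in X2.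
have massle : cells h (fun j k => h j * mid rho j k) <= b^-1.
  rewrite -[leRHS]mul1r ler_pdivlMr// mulrC cellsZ -M1 ginner_trapezoid.
  apply: le_cells => j k kN; rewrite mulrCA ler_wpM2l ?stp_ge0//.
  rewrite !gat_const !mulr1 /mid mulrA ler_wpM2r// mulrDr.
  have e q : (q <= nst h j)%N -> b * gat rho j q <= gat M j q.
    move=> qN; have -> : gat M j q = gat mu j q * gat rho j q.
      by rewrite /rho /grid_div /gat mulrC divfK// lt0r_neq0//; exact: mu0.
    by rewrite ler_wpM2r ?r0 ?mub.
  by rewrite lerD ?e// ltnW.
have XA : X <= E ^+ 2 / (a ^+ 2 * b) * B.
  have a2 : 0 < a ^+ 2 by rewrite exprn_gt0.
  rewrite -(ler_pM2l a2).
  have -> : a ^+ 2 * (E ^+ 2 / (a ^+ 2 * b) * B) = E ^+ 2 * B * b^-1.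
    by field; rewrite !lt0r_neq0.
  apply: le_trans X2 _.
  apply: (@le_trans _ _ (E ^+ 2 * B * cells h (fun j k => h j * mid rho j k))).
    rewrite cellsZ; apply: le_cells => j k kN; rewrite [leRHS]mulrCA ler_wpM2l ?stp_ge0//.
    have m0 : 0 <= mid rho j k by rewrite divr_ge0// addr_ge0 ?r0// ltnW.
    rewrite [leLHS]exprMn -[leRHS]mulrA; apply: ler_pM; rewrite ?sqr_ge0//.
      rewrite -real_normK ?num_real// ler_pXn2r ?nnegrE ?eE//.
      exact: le_trans (normr_ge0 _) (eE _ _ kN).
    rewrite expr2 ler_wpM2r// /mid ler_pdivrMr//.
    have := rv j k.+1 kN; have := rv j k (ltnW kN); lra.
  by rewrite ler_wpM2l// mulr_ge0// sqr_ge0.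
set A := E ^+ 2 / (a ^+ 2 * b) in XA.
have A0 : 0 <= A by rewrite divr_ge0 ?sqr_ge0// mulr_ge0 ?sqr_ge0// ltW.
have AD : 0 <= 2 * A * diam by apply: mulr_ge0 => //; apply: mulr_ge0.
have d0 : 0 < 2 * A * diam + 1 by rewrite ltr_wpDl.
have dD : 2 * A * diam <= 2 * A * diam + 1 by rewrite lerDl.
have vle := lin _ _ _ _ _ _ A0 d0 dD (variation_ge0 rho) (variation_le rho d0) XA.
move=> j k kN; apply: le_trans (rv j k kN) _.
by rewrite /B /ratio_bound -/A lerD2l ler_wpM2l.
Qed.

(** Once the ratio is bounded, its oscillation is governed by the residual flux
    of [mu] in L^2. *)
Lemma variation_ratio_le nu (g1 g2 : J -> nat -> R) M mu (cM c : J -> R)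
    (a B d : R) :
  0 < a -> 0 < d ->
  (forall j k, (k < nst h j)%N -> a <= nu j * mid mu j k) ->
  (forall j k, g1 j k <= 0) -> (forall j k, 0 <= g2 j k) ->
  (forall j k, (k <= nst h j)%N -> 0 < gat mu j k) ->
  gcontinuous M -> gcontinuous mu ->
  conserved nu g1 g2 M cM ->
  kirchhoff G c ->
  (forall j k, (k <= nst h j)%N -> 0 <= gat (grid_div M mu) j k <= B) ->
  variation (grid_div M mu) <= d * L + B ^+ 2 / (a ^+ 2 * d) *
    cells h (fun j k => h j * (flux nu g1 g2 mu j k - c j) ^+ 2).
Proof.
move=> a0 d0 aP g10 g20 mu0 Mc muc HM Kc rB.
have X2 := energy_L2 a0 aP g10 g20 mu0 Mc muc HM Kc.
set rho := grid_div M mu in X2 rB *.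
apply: le_trans (variation_le rho d0) _; rewrite lerD2l.
set X := cells h _ in X2 *; set Y := cells h _.
have a2 : 0 < a ^+ 2 by rewrite exprn_gt0.
rewrite -(ler_pM2l d0) mulVKf ?lt0r_neq0// -(ler_pM2l a2).
have -> : a ^+ 2 * (d * (B ^+ 2 / (a ^+ 2 * d) * Y)) = B ^+ 2 * Y.
  by field; rewrite !lt0r_neq0.
apply: le_trans X2 _; rewrite cellsZ; apply: le_cells => j k kN.
rewrite [leRHS]mulrCA ler_wpM2l ?stp_ge0// exprMn mulrC ler_wpM2r ?sqr_ge0//.
have /andP[r0 r1] := rB j k (ltnW kN); have /andP[r2 r3] := rB j k.+1 kN.
have m0 : 0 <= mid rho j k by rewrite divr_ge0// addr_ge0.
have mB : mid rho j k <= B.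
  by rewrite ler_pdivrMr// mulr_natr mulr2n lerD.
by rewrite ler_pXn2r ?nnegrE//; exact: le_trans m0 mB.
Qed.

Section SlopeDistance.
Variables (beta : R) (U w : gridfun h).

Definition dneg j k : R := negp (Dp U j k) - negp (Dp w j k).
Definition dpos j k : R := posp (Dp U j k.-1) - posp (Dp w j k.-1).
Definition dslope2 j k : R := sqn (dneg j k) (dpos j k).

Lemma dslope_le (d : R) j k : 0 < d ->
  `|dneg j k| + `|dpos j k| <= 2 * d + d^-1 * dslope2 j k.
Proof.
move=> d0; rewrite /dslope2 /sqn.
have -> : 2 * d + d^-1 * (dneg j k ^+ 2 + dpos j k ^+ 2) =
  (d + d^-1 * dneg j k ^+ 2) + (d + d^-1 * dpos j k ^+ 2) by ring.
by rewrite lerD ?norm_young.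
Qed.

Lemma nodes_dslope_le (d : R) : 0 < d ->
  nodes h (fun j k => h j * (`|dneg j k| + `|dpos j k|)) <=
  2 * d * L + d^-1 * nodes h (fun j k => h j * dslope2 j k).
Proof.
move=> d0; rewrite nodesZ -(cells_step h) cellsZ.
have -> : cells h (fun j k => 2 * d * h j) = cells h (fun j k => h j * (2 * d)).
  by apply: eq_cells => j k _; rewrite mulrC.
apply: le_trans (lerD (nodes_le_cells _) (lexx _)); last first.
  by move=> j k _; rewrite !mulr_ge0 ?stp_ge0// ltW.
rewrite nodesD; apply: le_nodes => j k kN.
have -> : h j * (2 * d) + d^-1 * (h j * dslope2 j k) =
  h j * (2 * d + d^-1 * dslope2 j k) by ring.
by rewrite ler_wpM2l ?stp_ge0//; exact: dslope_le.
Qed.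

(** The gap controls the beta-th power of the slope distance, hence its square
    up to an arbitrarily small threshold [d]. *)
Lemma nodes_dslope2_le mu (b d : R) : 2 <= beta -> 0 < b -> 0 < d ->
  (forall j k, (k <= nst h j)%N -> b <= gat mu j k) ->
  nodes h (fun j k => h j * dslope2 j k) <=
  4 * d * L + 2 / (b * d `^ (beta / 2 - 1)) * nodes h (fun j k => h j * gat mu j k *
     gap beta (Dp w j k) (Dp w j k.-1) (Dp U j k) (Dp U j k.-1)).
Proof.
move=> b2 b0 d0 mub.
have p0 : 0 < d `^ (beta / 2 - 1) by exact: powR_gt0.
have key t : 0 <= t -> t <= d + t `^ (beta / 2) / d `^ (beta / 2 - 1).
  move=> t0; have [td|dt] := lerP t d.
    by apply: le_trans td _; rewrite lerDl divr_ge0 ?powR_ge0.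
  apply: (@le_trans _ _ (t `^ (beta / 2) / d `^ (beta / 2 - 1))); last first.
    by rewrite lerDr ltW.
  have be0 : 0 < beta / 2 by lra.
  have be1 : 0 <= beta / 2 - 1 by lra.
  rewrite ler_pdivlMr// -(mulr_powRB1 t0 be0) ler_wpM2l//.
  by apply: ge0_ler_powR; rewrite ?nnegrE// ltW.
set q := d `^ _ in p0 key *.
rewrite nodesZ -(cells_step h) cellsZ.
have -> : cells h (fun j k => 4 * d * h j) = cells h (fun j k => h j * (4 * d)).
  by apply: eq_cells => j k _; rewrite mulrC.
apply: le_trans (lerD (nodes_le_cells _) (lexx _)); last first.
  by move=> j k _; rewrite !mulr_ge0 ?stp_ge0// ltW.
rewrite nodesD; apply: le_nodes => j k /andP[_ kN].
set g := gap _ _ _ _ _.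
have -> : h j * (4 * d) + 2 / (b * q) * (h j * gat mu j k * g) =
  h j * (4 * d + 2 / (b * q) * (gat mu j k * g)) by ring.
rewrite ler_wpM2l ?stp_ge0//.
have g1 := gap_ge (Dp w j k) (Dp w j k.-1) (Dp U j k) (Dp U j k.-1) b2.
have g0 := gap_ge0 (Dp w j k) (Dp w j k.-1) (Dp U j k) (Dp U j k.-1) b2.
rewrite -/g -[sqn _ _]/(dslope2 j k) in g1 g0.
have s0 : 0 <= dslope2 j k / 4 by rewrite divr_ge0 ?sqn_ge0.
have K := key _ s0.
apply: (@le_trans _ _ (4 * (d + (dslope2 j k / 4) `^ (beta / 2) / q))).
  by rewrite -ler_pdivrMl// mulrC.
rewrite mulrDr lerD2l.
have -> : 2 / (b * q) * (gat mu j k * g) = 2 * (gat mu j k * g / b) / q.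
  by field; rewrite !lt0r_neq0.
rewrite mulrA ler_pM2r ?invr_gt0//.
have -> : 4 * (dslope2 j k / 4) `^ (beta / 2) = 2 * (2 * (dslope2 j k / 4) `^ (beta / 2)).
  by ring.
rewrite ler_pM2l//; apply: le_trans g1 _.
rewrite ler_pdivlMr// mulrC ler_wpM2r// mub// ltnW//.
Qed.

(** For quantities which are small except in the two end cells of an edge,
    where the flux loses one of its transport terms. *)
Lemma cells_ends F (a e : R) : 0 <= a -> 0 <= e ->
  (forall j k, (0 < k)%N -> (k.+1 < nst h j)%N -> F j k <= h j * a) ->
  (forall j k, (k < nst h j)%N -> F j k <= h j * e) ->
  cells h F <= a * L + 2 * e * \sum_j h j.
Proof.
move=> a0 e0 Fa Fe.
apply: (@le_trans _ _ (cells h (fun j k => h j * a + (if k == 0%N then h j * e else 0)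
   + (if k.+1 == nst h j then h j * e else 0)))).
  apply: le_cells => j k kN.
  have he : 0 <= h j * e by rewrite mulr_ge0 ?stp_ge0.
  have ha : 0 <= h j * a by rewrite mulr_ge0 ?stp_ge0.
  case: eqVneq => [k0|k0].
    by apply: le_trans (Fe j k kN) _; rewrite addrAC lerDr addr_ge0//; case: ifP.
  case: eqVneq => [kN1|kN1].
    by apply: le_trans (Fe j k kN) _; rewrite lerDr addr0.
  by rewrite !addr0 Fa ?lt0n// ltn_neqAle kN1.
rewrite -2!cellsD -addrA; apply: lerD.
  by rewrite -(cells_step h) cellsZ; apply: le_cells => j k _; rewrite mulrC.
have -> : 2 * e * \sum_j h j = \sum_j h j * e + \sum_j h j * e.
  by rewrite -mulr_suml; ring.
apply: lerD; apply: ler_sum => j _.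
  case: (nst h j) (nst_gt0 h j) => // N _.
  by rewrite big_nat_recl//= big1 ?addr0.
case: (nst h j) (nst_gt0 h j) => // N _.
rewrite big_nat_recr//= eqxx big_nat big1 ?add0r// => k /andP[_ kN].
by rewrite eqSS ltn_eqF.
Qed.

(** The negative part of the slope in a cell belongs to its left node and the
    positive part to its right node. Summing over the interior nodes misses one
    part in each end cell. *)
Lemma variation_sub_le K :
  (forall j k, (k < nst h j)%N -> `|Dp U j k| <= K) ->
  (forall j k, (k < nst h j)%N -> `|Dp w j k| <= K) ->
  variation (grid_sub U w) <=
  nodes h (fun j k => h j * (`|dneg j k| + `|dpos j k|)) + 4 * K * \sum_j h j.
Proof.
have lin (a b c d x : R) : a <= x -> d <= x -> a + b + (c + d) <= b + c + (x + x).
  lra.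
move=> UK wK.
rewrite mulr_sumr /nodes -big_split; apply: ler_sum => j _ /=.
have dK k : (k < nst h j)%N -> `|posp (Dp U j k) - posp (Dp w j k)| <= 2 * K /\
    `|negp (Dp U j k) - negp (Dp w j k)| <= 2 * K.
  move=> kN; have h1 := UK j k kN; have h2 := wK j k kN.
  have h3 : `|Dp U j k - Dp w j k| <= 2 * K.
    by rewrite (le_trans (ler_normB _ _))// mulr_natl mulr2n lerD.
  by split; apply: le_trans h3; [exact: posp_lip | exact: negp_lip].
apply: (@le_trans _ _ (\sum_(0 <= k < nst h j)
    (h j * `|dneg j k| + h j * `|dpos j k.+1|))).
  apply: ler_sum => k _; rewrite incrE normrM (ger0_norm (stp_ge0 h j)) -mulrDr.
  rewrite ler_wpM2l ?stp_ge0// DpB /dneg /dpos /=.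
  rewrite -{1}[Dp U j k]pospBnegp -{1}[Dp w j k]pospBnegp [leRHS]addrC.
  have sub (a b c d : R) : a - b - (c - d) = (a - c) - (b - d) by ring.
  by rewrite sub ler_normB.
rewrite big_split/=.
case: (nst h j) (nst_gt0 h j) dK => // N _ dK.
have -> : \sum_(0 <= k < N.+1) h j * `|dneg j k| =
    h j * `|dneg j 0| + \sum_(1 <= k < N.+1) h j * `|dneg j k| by rewrite big_ltn.
have -> : \sum_(0 <= k < N.+1) h j * `|dpos j k.+1| =
    \sum_(1 <= k < N.+1) h j * `|dpos j k| + h j * `|dpos j N.+1|.
  by rewrite big_nat_recr//= big_add1.
have -> : \sum_(1 <= k < N.+1) h j * (`|dneg j k| + `|dpos j k|) =
   \sum_(1 <= k < N.+1) h j * `|dneg j k| + \sum_(1 <= k < N.+1) h j * `|dpos j k|.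
  by rewrite -big_split; apply: eq_bigr => k _; rewrite mulrDr.
have e0 : h j * `|dneg j 0| <= h j * (2 * K).
  by rewrite ler_wpM2l ?stp_ge0//; exact: (dK 0%N isT).2.
have e1 : h j * `|dpos j N.+1| <= h j * (2 * K).
  by rewrite ler_wpM2l ?stp_ge0//; exact: (dK N (ltnSn N)).1.
have -> : 4 * K * h j = h j * (2 * K) + h j * (2 * K) by ring.
exact: lin.
Qed.

(** Only the transport depends on the drift. The constant 16 comes from three
    squares of sums, for the reference flux, the two ends of a cell and the two
    parts of the slope, and from the two cells around a node. *)
Lemma flux_sub_le nu (g1 g2 g1' g2' : J -> nat -> R) mu c (H b : R) : 0 <= H ->
  (forall j k, (1 <= k < nst h j)%N ->
     `|g1 j k - g1' j k| <= H * (`|dneg j k| + `|dpos j k|)) ->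
  (forall j k, (1 <= k < nst h j)%N ->
     `|g2 j k - g2' j k| <= H * (`|dneg j k| + `|dpos j k|)) ->
  (forall j k, (k <= nst h j)%N -> 0 <= gat mu j k <= b) ->
  cells h (fun j k => h j * (flux nu g1 g2 mu j k - c j) ^+ 2) <=
  2 * cells h (fun j k => h j * (flux nu g1' g2' mu j k - c j) ^+ 2) +
  16 * (b * H) ^+ 2 * nodes h (fun j k => h j * dslope2 j k).
Proof.
have sq2 (x y : R) : (x + y) ^+ 2 <= 2 * x ^+ 2 + 2 * y ^+ 2.
  by have := sqr_ge0 (x - y); rewrite -subr_ge0 => ?; nra.
have fin (x y z a a' t : R) : x - y = a + a' -> 2 * (a + a') ^+ 2 <= t ->
    (x - z) ^+ 2 <= 2 * (y - z) ^+ 2 + t.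
  move=> e le; have -> : x - z = (y - z) + (a + a') by rewrite -e; ring.
  by apply: le_trans (sq2 _ _) _; rewrite lerD2l.
have sub2 (d x y x' y' : R) :
  d + (x + y) - (d + (x' + y')) = (x - x') + (y - y') by ring.
have lin (b' s x y p q : R) : x <= 2 * b' * s -> y <= 2 * b' * q ->
  p <= 2 * y + 2 * x -> 2 * p <= 8 * b' * (q + s) by lra.
have sqM (x y z : R) : (x * (y * z)) ^+ 2 = (x * y) ^+ 2 * z ^+ 2 by ring.
have mul2 (x y : R) : 2 * x * y = x * (2 * y) by ring.
move=> H0 g1H g2H mub.
pose s1 j k := if k == 0%N then 0 else dslope2 j k.
pose s2 j k := if k.+1 == nst h j then 0 else dslope2 j k.+1.
have sumE : cells h (fun j k => h j * (s2 j k + s1 j k)) =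
    2 * nodes h (fun j k => h j * dslope2 j k).
  rewrite nodesZ; apply: eq_bigr => j _.
  have := @sum_cells_to_nodes R (fun k => h j * dslope2 j k)
    (fun k => h j * dslope2 j k) (fun k => k%:R) (nst h j) (nst_gt0 h j).
  rewrite (eq_bigr (fun k => h j * (s2 j k + s1 j k))); last first.
    move=> k _; rewrite -natr1 addrAC subrr add0r mulr1 /s1 /s2.
    by case: ifP => _; case: ifP => _; ring.
  move=> ->; apply: eq_big_nat => -[//|k] _ /=.
  by rewrite -!natr1; ring.
have key j k : (k < nst h j)%N ->
    (flux nu g1 g2 mu j k - c j) ^+ 2 <=
    2 * (flux nu g1' g2' mu j k - c j) ^+ 2 +
    8 * (b * H) ^+ 2 * (s2 j k + s1 j k).
  move=> kN.
  pose a1 := if k == 0%N then 0 else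
    gat mu j k * (g1 j k - g1' j k).
  pose a2 := if k.+1 == nst h j then 0 else
    gat mu j k.+1 * (g2 j k.+1 - g2' j k.+1).
  apply: (fin _ _ _ a2 a1).
    rewrite /flux sub2 /a1 /a2.
    by apply: f_equal2; case: ifP => _; [exact: subr0|exact/esym/mulrBr
                                        |exact: subr0|exact/esym/mulrBr].
  have ds i l : (1 <= l < nst h i)%N -> forall x : R,
     `|x| <= H * (`|dneg i l| + `|dpos i l|) ->
     (gat mu i l * x) ^+ 2 <= 2 * (b * H) ^+ 2 * dslope2 i l.
    move=> /andP[_ lN] x xle; have /andP[m0 mb] := mub i l (ltnW lN).
    have bb : 0 <= b := le_trans m0 mb.
    apply: (@le_trans _ _ ((b * (H * (`|dneg i l| + `|dpos i l|))) ^+ 2)).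
      have S0 : 0 <= `|dneg i l| + `|dpos i l| by rewrite addr_ge0.
      have HS : 0 <= H * (`|dneg i l| + `|dpos i l|) by rewrite mulr_ge0.
      rewrite -[leLHS]real_normK ?num_real//.
      rewrite ler_pXn2r ?nnegrE ?normr_ge0 ?(mulr_ge0 bb HS)//.
      by rewrite normrM (ger0_norm m0) ler_pM.
    rewrite (sqM b H) (mul2 _ (dslope2 i l)) ler_wpM2l ?sqr_ge0//.
    apply: le_trans (sq2 _ _) _.
    by rewrite !real_normK ?num_real// -mulrDr.
  have i1 : a1 ^+ 2 <= 2 * (b * H) ^+ 2 * s1 j k.
    rewrite /a1 /s1; case: eqP => [_|/eqP k0]; first by rewrite expr0n/= mulr0.
    have k0N : (0 < k < nst h j)%N by rewrite lt0n k0.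
    by apply: ds => //; exact: g1H.
  have i2 : a2 ^+ 2 <= 2 * (b * H) ^+ 2 * s2 j k.
    rewrite /a2 /s2; case: eqP => [_|/eqP k0]; first by rewrite expr0n/= mulr0.
    have kN1 : (k.+1 < nst h j)%N by rewrite ltn_neqAle k0.
    by apply: ds => //; exact: g2H.
  exact: lin i1 i2 (sq2 a2 a1).
have -> : 16 * (b * H) ^+ 2 * nodes h (fun j k => h j * dslope2 j k) =
  8 * (b * H) ^+ 2 * (2 * nodes h (fun j k => h j * dslope2 j k)) by ring.
rewrite -sumE !cellsZ cellsD; apply: le_cells => j k kN.
have := key j k kN; set x := (_ - _) ^+ 2; set y := (_ - _) ^+ 2.
set z := 8 * _; move: (s2 j k + s1 j k) => t xy.
have -> : 2 * (h j * y) + z * (h j * t) = h j * (2 * y + z * t) by ring.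
by rewrite ler_wpM2l ?stp_ge0.
Qed.

(** Testing with constants removes the diffusion. *)
Lemma ergodic_sub_le nu f VM Vmu (Lam lam : R) (tau : J -> nat -> R) :
  2 <= beta ->
  discrete_hjb nu beta f U VM Lam ->
  (forall j k, (1 <= k < nst h j)%N ->
     - nu j * D2 w j k + g_at beta f w j k + lam = gat Vmu j k + tau j k) ->
  (Lam - lam) * L = ginner (grid_sub VM Vmu) one
   - nodes h (fun j k => h j * (slopes (nham beta) U j k - slopes (nham beta) w j k))
   - nodes h (fun j k => h j * tau j k)
   + \sum_i S_op nu w (grid_sub Vmu (grid_const lam)) i.
Proof.
have lin (a b c d S x t l l' : R) : 0 = a - l + b -> 0 = c - l' + d - S ->
    b - d = - x - t -> l - l' = a - c - x - t + S by lra.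
move=> b2 [HU SU] Hw.
have vP : vertex_values one (fun=> 1) by split.
have E1 := hjb_weak nu U (grid_sub VM (grid_const Lam)) vP.
have E2 := hjb_weak nu w (grid_sub Vmu (grid_const lam)) vP.
rewrite [X in _ - X]big1 ?subr0 in E1; last by move=> i _; rewrite SU mulr0.
rewrite cells0 in E1; last by move=> j k _; rewrite /incr !gat_const subrr mulr0.
rewrite cells0 in E2; last by move=> j k _; rewrite /incr !gat_const subrr mulr0.
rewrite ginnerBl (ginner_constl Lam) ginner1 in E1.
rewrite ginnerBl (ginner_constl lam) ginner1 in E2.
rewrite [X in _ - X](_ : _ =
  \sum_i S_op nu w (grid_sub Vmu (grid_const lam)) i) in E2; last first.
  by apply: eq_bigr => i _; rewrite mul1r.
rewrite mulrBl ginnerBl; apply: lin E1 E2 _.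
rewrite !nodesN !nodesD; apply: eq_nodes => j k kN.
rewrite -[gat (grid_sub VM _) j k]/(gat VM j k - Lam) -HU// g_atE.
have -> : tau j k = - nu j * D2 w j k + g_at beta f w j k + lam - gat Vmu j k.
  by rewrite Hw// addrAC subrr add0r.
rewrite -[gat (grid_sub Vmu _) j k]/(gat Vmu j k - lam) g_atE gat_const.
ring.
Qed.
End SlopeDistance.
End FixedGridStability.
(** * Calculus on a segment *)

Section SegmentCalculus.
Context {R : realType}.
Implicit Types (l a b y d : R) (w v : R -> R).

Lemma quot_cvgP l w y d : quot_filter l w y --> d <->
  (forall e, 0 < e -> exists2 r, 0 < r & forall z, z \in `[0, l] -> z != y ->
     `|z - y| < r -> `|(w z - w y) / (z - y) - d| <= e).
Proof.
split=> [/cvgrPdist_le h e e0|h].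
  have /= := h e e0; rewrite near_withinE near_withinE => -[r /= r0 hr].
  exists r => // z zl zy zr; rewrite distrC; apply: hr => //=.
  by rewrite distrC.
apply/cvgrPdist_le => e /h[r r0 hr]; rewrite near_withinE near_withinE.
exists r => //= z zr zy zl; rewrite distrC; apply: hr => //.
by rewrite distrC.
Qed.

Lemma dseg_cvgP l w y : derivable_seg l w -> y \in `[0, l] ->
  forall e, 0 < e -> exists2 r, 0 < r & forall z, z \in `[0, l] -> z != y ->
     `|z - y| < r -> `|(w z - w y) / (z - y) - dseg l w y| <= e.
Proof. by move=> D yl; apply/quot_cvgP; exact: D. Qed.

(** An end point of the segment is a limit point of it as well, so limits of
    difference quotients are unique. *)
Lemma dseg_unique l w y d : 0 < l -> y \in `[0, l] -> quot_filter l w y --> d ->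
  dseg l w y = d.
Proof.
move=> l0 yl cv.
suff FF : ProperFilter (within `[0, l] y^') by exact: cvg_lim.
apply: Build_ProperFilter_ex => A -[r /= r0 hr].
move: yl; rewrite in_itv/= => /andP[y0 yl].
have [yl2|yl2] := lerP y (l / 2).
  pose t := Num.min (r / 2) (l / 2).
  have t0 : 0 < t by rewrite lt_min !divr_gt0.
  have tr : t <= r / 2 by rewrite ge_min lexx.
  have tl : t <= l / 2 by rewrite ge_min lexx orbT.
  exists (y + t); apply: hr => /=; rewrite ?in_itv/=.
  - by rewrite opprD addNKr normrN gtr0_norm//; lra.
  - by rewrite gt_eqF// ltrDl.
  - by apply/andP; split; lra.
pose t := Num.min (r / 2) (l / 2).
have t0 : 0 < t by rewrite lt_min !divr_gt0.
have tr : t <= r / 2 by rewrite ge_min lexx.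
have tl : t <= l / 2 by rewrite ge_min lexx orbT.
exists (y - t); apply: hr => /=; rewrite ?in_itv/=.
- by rewrite opprB addrC subrK gtr0_norm//; lra.
- by rewrite lt_eqF// ltrBlDr ltrDl.
- by apply/andP; split; lra.
Qed.

Lemma eps_is_derive w y d : is_derive y 1 w d ->
  forall e, 0 < e -> exists2 r, 0 < r & forall z, z != y ->
     `|z - y| < r -> `|(w z - w y) / (z - y) - d| <= e.
Proof.
move=> [+ <-] e e0; rewrite /derivable /derive => /cvgrPdist_le/(_ e e0).
rewrite near_withinE => -[r /= r0 hr]; exists r => // z zy zr.
have := hr (z - y); rewrite /= sub0r normrN subr_eq0 => /(_ zr zy); rewrite /GRing.scale/= mulr1 subrK.
by rewrite distrC [_^-1 * _]mulrC.
Qed.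

Lemma dseg_is_derive l w y : derivable_seg l w -> y \in `]0, l[ ->
  is_derive y 1 w (dseg l w y).
Proof.
move=> D yl; have yl' : y \in `[0, l] by apply: subset_itv_oo_cc.
apply: is_derive_eps => e e0; have [r r0 hr] := dseg_cvgP D yl' e0.
move: yl; rewrite in_itv/= => /andP[y0 yl].
exists (Num.min r (Num.min y (l - y))).
  by rewrite !lt_min r0 y0 subr_gt0.
move=> z zy; rewrite !lt_min => /and3P[zr z1 z2]; apply: hr => //.
rewrite in_itv/=; move: z1 z2; rewrite !ltr_norml.
by move=> /andP[? ?] /andP[? ?]; apply/andP; split; lra.
Qed.

Lemma is_derive_dseg l w y d : y \in `]0, l[ -> is_derive y 1 w d ->
  dseg l w y = d.
Proof.
move=> yl wd; have yl' : y \in `[0, l] by apply: subset_itv_oo_cc.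
apply: dseg_unique => //.
  by move: yl; rewrite in_itv/= => /andP[]; exact: lt_trans.
apply/quot_cvgP => e e0; have [r r0 hr] := eps_is_derive wd e0.
by exists r => // z _ zy zr; exact: hr.
Qed.

Lemma within_continuousP l w : {within `[0, l], continuous w} <->
  forall y, y \in `[0, l] -> forall e, 0 < e -> exists2 r, 0 < r &
    forall z, z \in `[0, l] -> `|z - y| < r -> `|w z - w y| <= e.
Proof.
split=> [/subspace_continuousP c y yl e e0|h].
  have /cvgrPdist_le/(_ e e0) := c y yl.
  rewrite near_withinE => -[r /= r0 hr]; exists r => // z zl zr.
  by rewrite distrC; apply: hr => //=; rewrite distrC.
apply/subspace_continuousP => y yl; apply/cvgrPdist_le => e /(h y yl)[r r0 hr].
rewrite near_withinE; exists r => //= z zr zl; rewrite distrC; apply: hr => //.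
by rewrite distrC.
Qed.

Lemma derivable_seg_continuous l w : derivable_seg l w ->
  {within `[0, l], continuous w}.
Proof.
move=> D; apply/within_continuousP => y yl e e0.
have [r r0 hr] := dseg_cvgP D yl ltr01.
set c := `|dseg l w y| + 1; have c0 : 0 < c by rewrite ltr_wpDl.
exists (Num.min r (e / c)); first by rewrite lt_min r0 divr_gt0.
move=> z zl; rewrite lt_min => /andP[zr ze].
have [->|zy] := eqVneq z y; first by rewrite subrr normr0 ltW.
have zy0 : z - y != 0 by rewrite subr_eq0.
have := hr z zl zy zr => hq.
have qc : `|(w z - w y) / (z - y)| <= c.
  have -> : (w z - w y) / (z - y) = dseg l w y + ((w z - w y) / (z - y) - dseg l w y).
    by ring.
  by rewrite (le_trans (ler_normD _ _))// /c lerD2l.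
have -> : w z - w y = (w z - w y) / (z - y) * (z - y) by rewrite divfK.
rewrite normrM (le_trans (ler_pM _ _ qc (ltW ze)))//.
by rewrite mulrCA divff ?mulr1// gt_eqF.
Qed.

Lemma within_sub l w a b : 0 <= a -> b <= l -> {within `[0, l], continuous w} ->
  {within `[a, b], continuous w}.
Proof.
move=> a0 bl; apply: continuous_subspaceW => z /=; rewrite !in_itv/=.
by move=> /andP[az zb]; apply/andP; split; lra.
Qed.

Lemma seg_MVT l w a b : derivable_seg l w -> 0 <= a -> a < b -> b <= l ->
  exists2 c, a < c < b & w b - w a = dseg l w c * (b - a).
Proof.
move=> D a0 ab bl.
have dw x : x \in `]a, b[ -> is_derive x 1 w (dseg l w x).
  rewrite in_itv/= => /andP[ax xb]; apply: dseg_is_derive => //.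
  by rewrite in_itv/=; apply/andP; split; lra.
have [c cab e] := MVT ab dw (within_sub a0 bl (derivable_seg_continuous D)).
by exists c.
Qed.

Lemma within_bounded l w : 0 < l -> {within `[0, l], continuous w} ->
  exists C, forall y, y \in `[0, l] -> `|w y| <= C.
Proof.
move=> l0 c; have [p pl pP] := EVT_max (ltW l0) c.
have [q ql qP] := EVT_min (ltW l0) c.
exists (`|w p| + `|w q|) => y yl; have := pP y yl; have := qP y yl.
rewrite ler_norml => h1 h2.
have := ler_norm (w p); have := ler_norm (- w q); rewrite normrN.
have := normr_ge0 (w p); have := normr_ge0 (w q).
by move=> *; apply/andP; split; lra.
Qed.

Lemma seg_lipschitz l w C : derivable_seg l w ->
  (forall y, y \in `[0, l] -> `|dseg l w y| <= C) ->
  forall y z, y \in `[0, l] -> z \in `[0, l] -> `|w y - w z| <= C * `|y - z|.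
Proof.
move=> D DC y z; wlog yz : y z / y <= z.
  move=> wl yl zl; have /orP[yz|zy] := le_total y z; first exact: wl.
  by rewrite (distrC (w y)) (distrC y); exact: wl.
rewrite !in_itv/= => /andP[y0 yl] /andP[z0 zl].
move: yz; rewrite le_eqVlt => /orP[/eqP->|yz].
  by rewrite !subrr normr0 mulr0.
have [c /andP[yc cz] e] := seg_MVT D y0 yz zl.
rewrite distrC e normrM distrC ler_wpM2r// DC// in_itv/=.
by apply/andP; split; lra.
Qed.

Lemma seg_slope l w C y s t : derivable_seg l w ->
  (forall y z, y \in `[0, l] -> z \in `[0, l] ->
     `|dseg l w y - dseg l w z| <= C * `|y - z|) ->
  0 <= C -> 0 <= y -> 0 < s -> y + s <= l -> y <= t <= y + s ->
  `|(w (y + s) - w y) / s - dseg l w t| <= C * s.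
Proof.
move=> D DC C0 y0 s0 ysl /andP[yt ts].
have yys : y < y + s by rewrite ltrDl.
have [c /andP[yc cs] e] := seg_MVT D y0 yys ysl.
have -> : (w (y + s) - w y) / s = dseg l w c.
  by rewrite e addrC addKr mulfK// gt_eqF.
apply: le_trans (DC _ _ _ _) _; rewrite ?in_itv/=.
- by apply/andP; split; lra.
- by apply/andP; split; lra.
- by rewrite ler_wpM2l// ler_norml; apply/andP; split; lra.
Qed.

(** Second differences are values of the second derivative: apply the mean
    value theorem to t |-> w t - w (t - s), then to w'. *)
Lemma seg_second_difference l w y s : derivable_seg l w ->
  derivable_seg l (dseg l w) -> 0 < s -> 0 <= y - s -> y + s <= l ->
  exists2 c, `|c - y| <= s & w (y - s) - 2 * w y + w (y + s) =
     dseg l (dseg l w) c * s ^+ 2.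
Proof.
move=> D D2 s0 ys0 ysl; pose p t := w t - w (t - s).
have dp x : x \in `]y, y + s[ -> is_derive x 1 p (dseg l w x - dseg l w (x - s)).
  rewrite in_itv/= => /andP[yx xs].
  apply: is_deriveB.
    by apply: dseg_is_derive => //; rewrite in_itv/=; apply/andP; split; lra.
  apply: is_derive_eps => e e0.
  have xsl : x - s \in `]0, l[ by rewrite in_itv/=; apply/andP; split; lra.
  have [r r0 hr] := eps_is_derive (dseg_is_derive D xsl) e0.
  exists r => // z zx zr; have := hr (z - s).
  have -> : z - s - (x - s) = z - x by ring.
  by apply => //; apply: contra_neq zx => /addIr.
have cp : {within `[y, y + s], continuous p}.
  apply/subspace_continuousP => x xy.
  have /within_continuousP cw := derivable_seg_continuous D.
  have [x0 x1] : x \in `[0, l] /\ x - s \in `[0, l].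
    move: xy; rewrite /= !in_itv/= => /andP[? ?].
    by split; apply/andP; split; lra.
  apply/cvgrPdist_le => e e0; have e20 : 0 < e / 2 by rewrite divr_gt0.
  have [r r0 hr] := cw x x0 _ e20; have [q q0 hq] := cw (x - s) x1 _ e20.
  rewrite near_withinE; exists (Num.min r q); first by rewrite /= lt_min r0.
  move=> z /=; rewrite lt_min distrC => /andP[zr zq]; rewrite !in_itv/= => /andP[z0 z1].
  have := hr z; have := hq (z - s).
  have -> : z - s - (x - s) = z - x by ring.
  rewrite !in_itv/= => /(_ _ zq) h1 /(_ _ zr) h2.
  have {}h1 : `|w (z - s) - w (x - s)| <= e / 2 by apply: h1; apply/andP; split; lra.
  have {}h2 : `|w z - w x| <= e / 2 by apply: h2; apply/andP; split; lra.
  rewrite distrC /p; have -> : w z - w (z - s) - (w x - w (x - s)) =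
    (w z - w x) - (w (z - s) - w (x - s)) by ring.
  by rewrite (le_trans (ler_normB _ _))//; lra.
have ys : y < y + s by rewrite ltrDl.
have [c] := MVT ys dp cp; rewrite in_itv/= => /andP[yc cs].
rewrite (addrC y s) addrK /p => e.
have c0 : 0 <= c - s by lra. have cc : c - s < c by lra. have cl : c <= l by lra.
have [x /andP[x0 x1] e2] := seg_MVT D2 c0 cc cl.
exists x; first by rewrite ler_norml; apply/andP; split; lra.
have -> : w (y - s) - 2 * w y + w (s + y) =
   w (s + y) - w (s + y - s) - (w y - w (y - s)).
  by rewrite (addrC s y) addrK; ring.
rewrite e e2; ring.
Qed.

End SegmentCalculus.
(** * The exact solution on the edges *)

Section HamiltonianSlope.
Context {R : realType}.
Variable beta : R.

(** The derivative of p |-> |p|^beta. *)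
Definition hslope p : R := nham1 beta p p + nham2 beta p p.

Lemma sqn_parts (p : R) : sqn (negp p) (posp p) = p ^+ 2.
Proof.
rewrite /sqn /negp /posp.
by case: (lerP p 0); case: (lerP (- p) 0) => ? ?; nra.
Qed.

Lemma hslopeE p : hslope p = beta * (p * (p ^+ 2) `^ (beta / 2 - 1)).
Proof.
rewrite /hslope /nham1 /nham2 /nslope sqn_parts.
set S := _ `^ _; transitivity (beta * ((posp p - negp p) * S)); first by ring.
by rewrite pospBnegp.
Qed.

Lemma hslopeN p : hslope (- p) = - hslope p.
Proof. by rewrite !hslopeE sqrrN mulNr mulrN. Qed.

Lemma hslope_derivable p : 2 <= beta -> derivable hslope p 1.
Proof.
move=> b2; have s0 : 0 <= beta / 2 - 1 by lra.
rewrite (_ : hslope = fun q => beta * (q * (q ^+ 2) `^ (beta / 2 - 1))); last first.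
  by apply/funext => q; rewrite hslopeE.
set s := beta / 2 - 1 in s0 *.
have [->|p0] := eqVneq p 0.
  suff [d dP] : exists d, is_derive (0 : R) 1 (fun q => beta * (q * (q ^+ 2) `^ s)) d.
    by case: dP.
  exists (beta * 0 `^ s); apply: is_derive_eps => e e0.
  have [s00|sn0] := eqVneq s 0.
    exists 1 => // z z0 _; rewrite s00 !powRr0 !subr0 mul0r mulr0 subr0 !mulr1.
    by rewrite mulfK// subrr normr0 ltW.
  have sp : 0 < s by rewrite lt0r sn0.
  have b0 : 0 < beta by lra.
  exists (Num.min 1 ((e / beta) `^ s^-1)).
    by rewrite lt_min ltr01 powR_gt0// divr_gt0.
  move=> z z0; rewrite subr0 lt_min => /andP[z1 ze].
  rewrite mul0r mulr0 subr0 (@powR0 _ s)// mulr0 subr0.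
  have -> : beta * (z * (z ^+ 2) `^ s) / z = beta * (z ^+ 2) `^ s by field.
  rewrite ger0_norm ?mulr_ge0 ?powR_ge0//; last exact: ltW.
  rewrite mulrC -ler_pdivlMr//.
  have eb0 : 0 <= e / beta by rewrite divr_ge0// ltW.
  rewrite -[leRHS]powRr1// -(mulVf sn0) powRrM.
  apply: ge0_ler_powR; rewrite ?nnegrE ?sqr_ge0 ?powR_ge0//.
  rewrite -real_normK ?num_real// expr2.
  by apply: le_trans (ltW ze); rewrite ler_piMl// ltW.
have dsq : derivable (fun q : R => q ^+ 2) p 1 by exact: exprn_derivable.
have dpw : derivable (fun q : R => (q ^+ 2) `^ s) p 1.
  apply/derivable1_diffP; apply: (@differentiable_comp _ _ _ _ (fun q : R => q ^+ 2) (@powR R ^~ s)).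
    exact/derivable1_diffP.
  apply/derivable1_diffP; apply: derivable_powR.
  by rewrite in_itv/= andbT exprn_even_gt0.
have did : derivable (fun q : R => q) p 1 by exact: derivable_id.
exact: (derivableM (derivable_cst beta p 1) (derivableM did dpw)).
Qed.

Lemma hslope_continuous : 2 <= beta -> continuous hslope.
Proof.
move=> b2 p; apply: differentiable_continuous; apply/derivable1_diffP.
exact: hslope_derivable.
Qed.

End HamiltonianSlope.

Section OrientedDerivatives.
Context {R : realType} {n : nat} {I J : finType} (G : network R n I J).
Implicit Types (u m : 'rV[R]_n -> R) (i : I) (j : J).

Lemma len_neq0 j : len G j != 0. Proof. by rewrite gt_eqF ?len_gt0. Qed.

Lemma len_itv0 j : 0 \in `[0, len G j].
Proof. by rewrite in_itv/= lexx ltW ?len_gt0. Qed.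

Lemma len_itv1 j : len G j \in `[0, len G j].
Proof. by rewrite in_itv/= lexx ltW ?len_gt0. Qed.

Lemma inc_excl i j : incm G i j -> ~~ incp G i j.
Proof.
rewrite /incm /incp => /eqP->; apply/negP => /eqP e.
by have := arc_inj (len_itv1 j) (len_itv0 j) e; apply/eqP; exact: len_neq0.
Qed.

Lemma sum_inc i (F : J -> R) : \sum_(j | inc G i j) F j =
  \sum_(j | incp G i j) F j + \sum_(j | incm G i j) F j.
Proof.
rewrite (bigID (incp G i))/=; congr (_ + _); apply: eq_bigl => j; rewrite /inc.
  by case: (incp G i j); rewrite ?andbF ?andbT.
case e : (incm G i j); first by rewrite orbT (inc_excl e).
by case: (incp G i j).
Qed.

Lemma oriented_deriv_src u i j : incp G i j -> derivable_seg (len G j) (edge G u j) ->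
  oriented_deriv G u i j = dseg (len G j) (edge G u j) 0.
Proof.
move=> ij D; rewrite /oriented_deriv ij; apply: cvg_lim => //.
apply/cvgrPdist_le => e e0; have [r r0 hr] := dseg_cvgP D (len_itv0 j) e0.
near=> t; have t0 : 0 < t by near: t; exact: nbhs_right_gt.
have tr : t < r by near: t; exact: nbhs_right_lt.
have tl : t < len G j by near: t; apply: nbhs_right_lt; exact: len_gt0.
have := hr t; rewrite !subr0 in_itv/= distrC; apply.
- by rewrite (ltW t0) ltW.
- by rewrite gt_eqF.
- by rewrite gtr0_norm.
Unshelve. all: by end_near.
Qed.

Lemma oriented_deriv_tgt u i j : incm G i j -> derivable_seg (len G j) (edge G u j) ->
  oriented_deriv G u i j = - dseg (len G j) (edge G u j) (len G j).
Proof.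
move=> ij D; rewrite /oriented_deriv (negbTE (inc_excl ij)); apply: cvg_lim => //.
apply/cvgrPdist_le => e e0; have [r r0 hr] := dseg_cvgP D (len_itv1 j) e0.
near=> t; have t0 : 0 < t by near: t; exact: nbhs_right_gt.
have tr : t < r by near: t; exact: nbhs_right_lt.
have tl : t < len G j by near: t; apply: nbhs_right_lt; exact: len_gt0.
have := hr (len G j - t).
have -> : len G j - t - len G j = - t by ring.
rewrite normrN invrN mulrN -opprD normrN in_itv/= => h.
rewrite -opprD normrN addrC; apply: h.
- by rewrite subr_ge0 (ltW tl) lerBlDr lerDl ltW.
- by rewrite lt_eqF// ltrBlDr ltrDl.
- by rewrite gtr0_norm.
Unshelve. all: by end_near.
Qed.

Section ExactFlux.
Variables (nu : J -> R) (beta : R) (f : 'rV[R]_n -> R).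
Variables u m : 'rV[R]_n -> R.
Hypothesis beta2 : 2 <= beta.
Hypothesis uD : forall j, derivable_seg (len G j) (edge G u j).
Hypothesis uD2 : forall j, derivable_seg (len G j) (dseg (len G j) (edge G u j)).
Hypothesis mD : forall j, derivable_seg (len G j) (edge G m j).
Hypothesis mD2 : forall j, derivable_seg (len G j) (dseg (len G j) (edge G m j)).

Local Notation du j := (dseg (len G j) (edge G u j)).
Local Notation dm j := (dseg (len G j) (edge G m j)).

(** Constant along the edges, by the Fokker-Planck equation; the transmission
    condition is Kirchhoff's law for its values. *)
Definition exact_flux j y : R := nu j * dm j y + edge G m j y * hslope beta (du j y).

Lemma exact_flux_const : fp_equation G nu beta f u m ->
  forall j y, y \in `[0, len G j] -> exact_flux j y = exact_flux j 0.
Proof.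
move=> FP j y; rewrite in_itv/= => /andP[y0 yl].
have dF x : x \in `]0, y[ -> is_derive x 1 (exact_flux j) 0.
  move=> xy; have xl : x \in `]0, len G j[.
    by move: xy; rewrite !in_itv/= => /andP[-> xy]; exact: lt_le_trans xy yl.
  have h1 := dseg_is_derive (@mD2 j) xl.
  have h2 := dseg_is_derive (@mD j) xl.
  have h3 := dseg_is_derive (@uD2 j) xl.
  have h4 : derivable (fun z => edge G m j z * hslope beta (du j z)) x 1.
    apply: derivableM; first by case: h2.
    apply/derivable1_diffP.
    apply: (@differentiable_comp _ _ _ _ (du j) (hslope beta)).
      by apply/derivable1_diffP; case: h3.
    by apply/derivable1_diffP; exact: hslope_derivable.
  have h5 := derivableP h4.
  have := FP j x xl; rewrite /=.
  have -> : (fun z => edge G m j z * ham_p beta f (arc G j z) (du j z)) =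
      (fun z => edge G m j z * hslope beta (du j z)).
    by apply/funext => z; rewrite ham_pE.
  rewrite (is_derive_dseg xl h5) => e0.
  have := is_deriveD (is_deriveZ (nu j) h1) h5; rewrite -[_ *: _]/(_ * _) e0.
  by [].
have cF : {within `[0, y], continuous (exact_flux j)}.
  have w := within_sub (lexx 0) yl; rewrite /exact_flux => x.
  apply: cvgD.
    apply: cvgM; first exact: cvg_cst.
    exact: (w _ (derivable_seg_continuous (@mD2 j)) x).
  apply: cvgM; first exact: (w _ (derivable_seg_continuous (@mD j)) x).
  apply: (@continuous_comp _ _ _ (du j : subspace `[0, y]%classic -> R) (hslope beta)).
    exact: (w _ (derivable_seg_continuous (@uD2 j)) x).
  exact: hslope_continuous.
have [c _ e] := MVT_segment y0 dF cF.
by apply/eqP; rewrite -subr_eq0 e mul0r.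
Qed.

Lemma exact_flux_kirchhoff : fp_equation G nu beta f u m ->
  (forall i, \sum_(j | inc G i j) (nu j * oriented_deriv G m i j
     + ham_p beta f (vtx G i) (oriented_deriv G u i j)
       * edge G m j (vcoord G i j)) = 0) ->
  kirchhoff G (fun j => exact_flux j 0).
Proof.
move=> FP T i; have := T i; rewrite sum_inc => Ti; apply: etrans Ti.
rewrite -sumrN; congr (_ + _).
  apply: eq_bigr => j ij; rewrite ham_pE// !oriented_deriv_src// /vcoord ij.
  by rewrite mulrC [X in _ = _ + X]mulrC; congr (_ + _); rewrite mulrC.
apply: eq_bigr => j ij; rewrite -(exact_flux_const FP (len_itv1 j)).
rewrite ham_pE// !oriented_deriv_tgt// /vcoord (negbTE (inc_excl ij)).
rewrite -/(hslope beta _) hslopeN /exact_flux; ring.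
Qed.

Lemma exact_slope_kirchhoff i :
  \sum_(j | inc G i j) nu j * oriented_deriv G u i j = 0 ->
  \sum_(j | incp G i j) nu j * du j 0 - \sum_(j | incm G i j) nu j * du j (len G j) = 0.
Proof.
rewrite sum_inc => S0; apply: etrans S0; rewrite -sumrN.
congr (_ + _); apply: eq_bigr => j ij.
  by rewrite oriented_deriv_src.
by rewrite oriented_deriv_tgt// mulrN.
Qed.

End ExactFlux.
End OrientedDerivatives.
(** * Sampling on the grid *)

Section Trapezoid.
Context {R : realType}.
Local Notation mu := (@lebesgue_measure R).

Lemma integral_cell (w : R -> R) (a b v e : R) : a < b ->
  mu.-integrable `]a, b] (EFin \o w) ->
  (forall y, y \in `]a, b] -> `|w y - v| <= e) ->
  `|\int[mu]_(y in `]a, b]) w y - v * (b - a)| <= e * (b - a).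
Proof.
have lin (r d : R) : (v - e) * d <= r -> r <= (v + e) * d -> `|r - v * d| <= e * d.
  rewrite mulrBl mulrDl => h1 h2; rewrite ler_norml; apply/andP; split; lra.
move=> ab iw we.
have muab : fine (mu `]a, b]) = b - a.
  by rewrite lebesgue_measure_itv/= lte_fin ab.
have ic r : mu.-integrable `]a, b] (EFin \o cst r).
  have : mu.-integrable `[a, b] (EFin \o cst r).
    apply: continuous_compact_integrable; first exact: segment_compact.
    by apply: continuous_subspaceT => x; exact: cvg_cst.
  by apply: integrableS => //; apply: subset_itvr; rewrite bnd_simp.
have le1 : \int[mu]_(y in `]a, b]) w y <= (v + e) * (b - a).
  rewrite -muab -Rintegral_cst//=; apply: le_Rintegral => //=; first exact: ic.
  by move=> y /= yab; have := we y yab; rewrite ler_norml => /andP[_]; rewrite lerBlDl.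
have le2 : (v - e) * (b - a) <= \int[mu]_(y in `]a, b]) w y.
  rewrite -muab -Rintegral_cst//=; apply: le_Rintegral => //=; first exact: ic.
  by move=> y /= yab; have := we y yab; rewrite ler_norml => /andP[+ _]; rewrite lerBrDl.
by apply: lin; [exact: le2|exact: le1].
Qed.

Lemma trapezoid_le (l s C : R) (w : R -> R) N : 0 < l -> 0 < s -> 0 <= C ->
  N%:R * s = l -> {within `[0, l], continuous w} ->
  (forall y z, y \in `[0, l] -> z \in `[0, l] -> `|w y - w z| <= C * `|y - z|) ->
  `|\sum_(0 <= k < N) s * ((w (k%:R * s) + w (k.+1%:R * s)) / 2)
    - \int[mu]_(y in `[0, l]) w y| <= C * s * l.
Proof.
have lin (x y z t p q : R) : `|x - y| <= p -> `|z - y - t * s| <= q ->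
    `|x + s * t - z| <= p + q.
  move=> h1 h2; have -> : x + s * t - z = (x - y) - (z - y - t * s) by ring.
  by rewrite (le_trans (ler_normB _ _))// lerD.
move=> l0 s0 C0 Nl cw wC.
have iw : mu.-integrable `[0, l] (EFin \o w).
  by apply: continuous_compact_integrable => //; exact: segment_compact.
have itvk k : (k <= N)%N -> k%:R * s \in `[0, l].
  move=> kN; rewrite in_itv/= mulr_ge0 ?(ltW s0)//= -Nl ler_pM2r//.
  by rewrite ler_nat.
have key k : (k <= N)%N ->
    `|\sum_(0 <= i < k) s * ((w (i%:R * s) + w (i.+1%:R * s)) / 2)
    - \int[mu]_(y in `[0, (k%:R * s)]) w y| <= C * s * (k%:R * s).
  elim: k => [_|k IH kN].
    by rewrite big_geq// mul0r set_itv1 Rintegral_set1 subrr normr0 mulr0.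
  have {}IH := IH (ltnW kN).
  set a := k%:R * s in IH *; set b := k.+1%:R * s.
  have ba : b - a = s by rewrite /a /b -natr1; ring.
  have ab : a < b by rewrite -subr_gt0 ba.
  have := itvk k (ltnW kN); rewrite -/a in_itv/= => /andP[a0 al].
  have := itvk k.+1 kN; rewrite -/b in_itv/= => /andP[b0 bl].
  have ib : mu.-integrable `[0, b] (EFin \o w).
    by apply: integrableS iw => //; apply: subset_itvl; rewrite bnd_simp.
  have := @Rintegral_itvB _ w (BLeft 0) (BRight b) a ib.
  rewrite !bnd_simp => /(_ a0 (ltW ab)) e.
  have i2 : mu.-integrable `]a, b] (EFin \o w).
    by apply: integrableS ib => //; apply: subset_itvr; rewrite bnd_simp.
  pose v := (w a + w b) / 2.
  have vC y : y \in `]a, b] -> `|w y - v| <= C * s.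
    rewrite in_itv/= => /andP[ay yb].
    have yl : y \in `[0, l] by rewrite in_itv/=; apply/andP; split; lra.
    have al' : a \in `[0, l] by rewrite in_itv/=; apply/andP; split.
    have bl' : b \in `[0, l] by rewrite in_itv/=; apply/andP; split.
    have h1 : `|w y - w a| <= C * s.
      apply: le_trans (wC _ _ yl al') _; rewrite ler_wpM2l// ger0_norm; lra.
    have h2 : `|w y - w b| <= C * s.
      apply: le_trans (wC _ _ yl bl') _; rewrite ler_wpM2l// ler0_norm; lra.
    have -> : w y - v = ((w y - w a) + (w y - w b)) / 2 by rewrite /v; field.
    rewrite normrM [X in _ * X]ger0_norm ?invr_ge0// ler_pdivrMr//.
    by rewrite (le_trans (ler_normD _ _))// mulr_natr mulr2n lerD.
  have -> : C * s * b = C * s * a + C * s * s by rewrite -ba; ring.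
  have := integral_cell ab i2 vC; rewrite -e ba => cell.
  rewrite big_nat_recr//= -/a -/b -/v; exact: lin IH cell.
by have := key N (leqnn _); rewrite Nl.
Qed.

End Trapezoid.

Section Sampling.
Context {R : realType} {n : nat} {I J : finType}.
Implicit Types (j : J).
Variable G : network R n I J.
Implicit Types (w : J -> R -> R).

Lemma unif_const (P : J -> R -> Prop) :
  (forall j c c', P j c -> c <= c' -> P j c') -> (forall j, exists c, P j c) ->
  exists2 C, 0 <= C & forall j, P j C.
Proof.
move=> mono /choice[c cP]; exists (\sum_j `|c j|); first exact: sumr_ge0.
move=> j; apply: mono (cP j) _; apply: le_trans (ler_norm _) _.
by rewrite (bigD1 j)//= lerDl sumr_ge0.
Qed.

Lemma unif_pos (P : J -> R -> Prop) :
  (forall j c c', P j c -> c' <= c -> P j c') ->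
  (forall j, exists2 c, 0 < c & P j c) -> exists2 c, 0 < c & forall j, P j c.
Proof.
move=> anti pos.
have [|j|C C0 CP] := @unif_const (fun j C => exists2 c, 0 < c & P j c /\ c^-1 <= C).
- by move=> j c c' [e e0 [Pe ec]] cc'; exists e => //; split=> //; exact: le_trans cc'.
- by have [c c0 Pc] := pos j; exists c^-1; exists c.
have C1 : 0 < C + 1 by rewrite ltr_wpDl.
exists (C + 1)^-1 => [|j]; first by rewrite invr_gt0.
have [c c0 [Pc cC]] := CP j; apply: anti Pc _.
rewrite -[leRHS]invrK lef_pV2 ?posrE ?invr_gt0//.
by apply: le_trans cC _; rewrite lerDl.
Qed.

Definition lip_slopes w (C : R) : Prop := forall j,
  [/\ forall y, y \in `[0, len G j] -> `|w j y| <= C,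
      forall y, y \in `[0, len G j] -> `|dseg (len G j) (w j) y| <= C &
      forall y z, y \in `[0, len G j] -> z \in `[0, len G j] ->
        `|dseg (len G j) (w j) y - dseg (len G j) (w j) z| <= C * `|y - z|].

Lemma C2_lip_slopes w : (forall j, C2_seg (len G j) (w j)) ->
  exists2 C, 0 <= C & lip_slopes w C.
Proof.
move=> wC2; apply: unif_const => [j c c' [h1 h2 h3] cc'|j].
  split=> [y yl|y yl|y z yl zl].
  - exact: le_trans (h1 y yl) cc'.
  - exact: le_trans (h2 y yl) cc'.
  - by apply: le_trans (h3 y z yl zl) _; rewrite ler_wpM2r.
have [D1 D2 C2] := wC2 j; have l0 := len_gt0 G j.
have [c0 h0] := within_bounded l0 (derivable_seg_continuous D1).
have [c1 h1] := within_bounded l0 (derivable_seg_continuous D2).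
have [c2 h2] := within_bounded l0 C2.
have c00 : 0 <= c0 := le_trans (normr_ge0 _) (h0 0 (len_itv0 G j)).
have c10 : 0 <= c1 := le_trans (normr_ge0 _) (h1 0 (len_itv0 G j)).
have c20 : 0 <= c2 := le_trans (normr_ge0 _) (h2 0 (len_itv0 G j)).
exists (c0 + c1 + c2); split=> [y yl|y yl|y z yl zl].
- by apply: le_trans (h0 y yl) _; lra.
- by apply: le_trans (h1 y yl) _; lra.
- apply: le_trans (seg_lipschitz D2 h2 yl zl) _; rewrite ler_wpM2r//; lra.
Qed.

End Sampling.

Section GridSampling.
Context {R : realType} {n : nat} {I J : finType} {G : network R n I J}.
Variable h : step G.
Implicit Types (j : J).

Lemma ycoordS j k : ycoord h j k.+1 = ycoord h j k + h j.
Proof. by rewrite /ycoord -natr1 mulrDl mul1r. Qed.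

Lemma ycoord_itv j k : (k <= nst h j)%N -> ycoord h j k \in `[0, len G j].
Proof.
move=> kN; rewrite in_itv/= /ycoord mulr_ge0 ?(ltW (stp_gt0 h j))//=.
by rewrite -(nst_stp h j) ler_pM2r ?stp_gt0// ler_nat.
Qed.

Lemma ycoord_itvo j k : (1 <= k < nst h j)%N -> ycoord h j k \in `]0, len G j[.
Proof.
move=> /andP[k1 kN]; rewrite in_itv/= /ycoord mulr_gt0 ?stp_gt0 ?ltr0n//=.
by rewrite -(nst_stp h j) ltr_pM2r ?stp_gt0// ltr_nat.
Qed.

Lemma ycoord_last j : ycoord h j (nst h j) = len G j.
Proof. exact: nst_stp. Qed.

Lemma ycoord0 j : ycoord h j 0 = 0.
Proof. exact: mul0r. Qed.

Lemma gat_proj u j k : (k <= nst h j)%N ->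
  gat (grid_proj h u) j k = edge G u j (ycoord h j k).
Proof. by move=> kN; rewrite /gat /grid_proj /node /edge inordK. Qed.

Lemma vertex_values_proj u : vertex_values (grid_proj h u) (fun i => u (vtx G i)).
Proof.
split=> j; rewrite gat_proj// /edge ?ycoord0 ?ycoord_last.
  by rewrite srcP.
by rewrite tgtP.
Qed.

Lemma gcontinuous_proj u : gcontinuous (grid_proj h u).
Proof. exact: vertex_valuesP (vertex_values_proj u). Qed.

Section Differences.
Variables (u : 'rV[R]_n -> R) (C : R).
Hypothesis C0 : 0 <= C.
Hypothesis uD : forall j, derivable_seg (len G j) (edge G u j).
Hypothesis uC : lip_slopes G (edge G u) C.

Local Notation du j := (dseg (len G j) (edge G u j)).

Lemma edge_lip j y z : y \in `[0, len G j] -> z \in `[0, len G j] ->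
  `|edge G u j y - edge G u j z| <= C * `|y - z|.
Proof. by have [_ dC _] := uC j; exact: seg_lipschitz. Qed.

Lemma Dp_proj j k t : (k < nst h j)%N -> ycoord h j k <= t <= ycoord h j k.+1 ->
  `|Dp (grid_proj h u) j k - du j t| <= C * h j.
Proof.
move=> kN; rewrite ycoordS => yt; have [_ _ dL] := uC j.
rewrite /Dp !gat_proj// ?(ltnW kN)// ycoordS.
have := ycoord_itv (ltnW kN); have := @ycoord_itv j k.+1 kN.
rewrite ycoordS !in_itv/= => /andP[_ h1] /andP[h2 _].
by apply: seg_slope; rewrite ?stp_gt0.
Qed.

Lemma Dp_proj_le j k : (k < nst h j)%N -> `|Dp (grid_proj h u) j k| <= C.
Proof.
move=> kN; rewrite /Dp !gat_proj// ?(ltnW kN)//.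
rewrite normrM normfV (gtr0_norm (stp_gt0 h j)) ler_pdivrMr ?stp_gt0//.
apply: le_trans (edge_lip (ycoord_itv kN) (ycoord_itv (ltnW kN))) _.
by rewrite ycoordS addrC addKr gtr0_norm ?stp_gt0.
Qed.

End Differences.

Lemma D2_proj u j k : derivable_seg (len G j) (edge G u j) ->
  derivable_seg (len G j) (dseg (len G j) (edge G u j)) -> (1 <= k < nst h j)%N ->
  exists c, [/\ c \in `[0, len G j], `|c - ycoord h j k| <= h j &
    D2 (grid_proj h u) j k = dseg (len G j) (dseg (len G j) (edge G u j)) c].
Proof.
move=> D1 D2' /andP[k1 kN].
have k1S : k.-1.+1 = k by rewrite prednK.
have kN1 : (k.-1 <= nst h j)%N by rewrite (leq_trans (leq_pred _))// ltnW.
have yP : ycoord h j k.-1 = ycoord h j k - h j by rewrite -{2}k1S ycoordS addrK.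
have := ycoord_itv kN1; rewrite yP in_itv/= => /andP[y0 _].
have := @ycoord_itv j k.+1 kN; rewrite ycoordS in_itv/= => /andP[_ yl].
have [c cy e] := seg_second_difference D1 D2' (stp_gt0 h j) y0 yl.
exists c; split=> //.
  by move: cy; rewrite ler_norml in_itv/= => /andP[? ?]; apply/andP; split; lra.
rewrite /D2 !gat_proj// ?(ltnW kN)// yP ycoordS e mulfK//.
by rewrite expf_neq0// stp_neq0.
Qed.

Lemma step_le_mesh j : h j <= mesh h.
Proof.
rewrite /mesh; have : j \in index_enum J by rewrite mem_index_enum.
elim: (index_enum J) => // i s IH; rewrite inE big_cons le_max.
by case/orP => [/eqP<-|/IH->]; rewrite ?lexx ?orbT.
Qed.

Lemma mesh_ge0 : 0 <= mesh h.
Proof.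
rewrite /mesh; elim/big_ind: _ => //; last by move=> j _; exact: ltW (stp_gt0 h j).
by move=> x y x0 y0; rewrite le_max x0.
Qed.

Lemma ginner_proj_integral u C : 0 <= C ->
  (forall j, derivable_seg (len G j) (edge G u j)) -> lip_slopes G (edge G u) C ->
  `|ginner (grid_proj h u) (grid_const 1) - net_integral G u| <=
  C * mesh h * total_len (G := G).
Proof.
move=> C0 uD uC; rewrite ginner_trapezoid /cells /net_integral -sumrB.
rewrite /total_len mulr_sumr; apply: le_trans (ler_norm_sum _ _ _) _.
apply: ler_sum => j _.
rewrite (eq_big_nat _ _ (F2 := fun k => h j *
  ((edge G u j (k%:R * h j) + edge G u j (k.+1%:R * h j)) / 2))); last first.
  by move=> k /andP[_ kN]; rewrite !gat_const !mulr1 !gat_proj// ltnW.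
have cu := derivable_seg_continuous (uD j).
apply: le_trans (trapezoid_le (len_gt0 G j) (stp_gt0 h j) C0 (nst_stp h j) cu _) _.
  by move=> y z yl zl; exact: edge_lip.
by rewrite ler_wpM2r ?(ltW (len_gt0 G j))// ler_wpM2l// step_le_mesh.
Qed.

(** The reconstruction is a convex combination of the grid values. *)
Lemma hat_sum N (t : R) : 0 <= t <= N%:R ->
  \sum_(k < N.+1) Num.max 0 (1 - `|t - k%:R|) = 1.
Proof.
elim: N => [|N IH].
  move=> /andP[t0 t1]; have -> : t = 0 by apply/eqP; rewrite eq_le t1.
  by rewrite big_ord_recl big_ord0 subrr normr0 subr0 addr0 max_r.
move=> /andP[t0 t1]; rewrite big_ord_recr/=.
have [tN|Nt] := leP t N%:R.
  rewrite IH ?t0//; have -> : `|t - N.+1%:R| = N.+1%:R - t.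
    by rewrite ler0_norm ?opprB// subr_le0.
  by rewrite max_l ?addr0// -natr1; lra.
rewrite big_ord_recr/= big1 => [|[k kN] _ /=]; last first.
  rewrite max_l// ger0_norm.
    have : k.+1%:R <= N%:R :> R by rewrite ler_nat.
    by rewrite -natr1; lra.
  have : k%:R <= N%:R :> R by rewrite ler_nat ltnW.
  by lra.
move: t1; rewrite -natr1 => t1.
have -> : `|t - N%:R| = t - N%:R by rewrite ger0_norm// subr_ge0 ltW.
have -> : `|t - (N%:R + 1)| = N%:R + 1 - t by rewrite ler0_norm ?opprB// subr_le0.
by rewrite add0r !max_r; lra.
Qed.

(** Only nodes at distance less than one step contribute. *)
Lemma interp_le (w : J -> R -> R) C e (M : gridfun h) j y : 0 <= C ->
  (forall y z, y \in `[0, len G j] -> z \in `[0, len G j] ->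
     `|w j y - w j z| <= C * `|y - z|) ->
  (forall k, (k <= nst h j)%N -> `|gat M j k - w j (ycoord h j k)| <= e) ->
  y \in `[0, len G j] -> `|w j y - interp M j y| <= e + C * h j.
Proof.
move=> C0 wC Me yl; have hj := stp_gt0 h j.
pose c (k : 'I_(nst h j).+1) : R := Num.max 0 (1 - `|y / h j - k%:R|).
have hs : \sum_k c k = 1.
  apply: hat_sum; move: yl; rewrite in_itv/= => /andP[y0 yl].
  by rewrite divr_ge0 ?(ltW hj)//= ler_pdivrMr// nst_stp.
have -> : interp M j y = \sum_k M j k * c k by [].
rewrite -[w j y]mulr1 -hs mulr_sumr -sumrB.
apply: le_trans (ler_norm_sum _ _ _) _.
rewrite -[leRHS]mulr1 -hs mulr_sumr; apply: ler_sum => k _; rewrite -mulrBl normrM.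
have c0 : 0 <= c k by rewrite le_max lexx.
rewrite [X in _ * X]ger0_norm//.
have [cz|cp] := eqVneq (c k) 0; first by rewrite cz !mulr0.
rewrite ler_wpM2r//.
have yk : `|y - ycoord h j k| <= h j.
  have : 0 < 1 - `|y / h j - k%:R|.
    by move: cp; rewrite /c; case: (ltP 0 (1 - `|y / h j - k%:R|)) => //; rewrite eqxx.
  rewrite subr_gt0 => lt1.
  have -> : y - ycoord h j k = (y / h j - k%:R) * h j.
    by rewrite mulrBl divfK ?stp_neq0.
  by rewrite normrM (gtr0_norm hj) ler_piMl// ltW.
have kN : (k <= nst h j)%N by rewrite -ltnS.
have -> : w j y - M j k = (w j y - w j (ycoord h j k)) - (gat M j k - w j (ycoord h j k)).
  by rewrite /gat inord_val; ring.
rewrite (le_trans (ler_normB _ _))// [leLHS]addrC lerD ?Me//.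
by apply: le_trans (wC _ _ yl (ycoord_itv kN)) _; rewrite ler_wpM2l.
Qed.

Lemma net_norm_interp (w : J -> R -> R) C e (M : gridfun h) : inhabited J -> 0 <= C ->
  (forall j y z, y \in `[0, len G j] -> z \in `[0, len G j] ->
     `|w j y - w j z| <= C * `|y - z|) ->
  (forall j k, (k <= nst h j)%N -> `|gat M j k - w j (ycoord h j k)| <= e) ->
  0 <= net_norm G (fun j y => w j y - interp M j y) <= e + C * mesh h.
Proof.
move=> [j0] C0 wC Me; rewrite /net_norm; set S := (X in sup X).
have Sle r : S r -> r <= e + C * mesh h.
  move=> [j [y yl ->]]; apply: le_trans (interp_le C0 (wC j) (Me j) yl) _.
  by rewrite lerD2l ler_wpM2l// step_le_mesh.
have S0 : S `|w j0 0 - interp M j0 0|.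
  by exists j0; exists 0 => //; exact: len_itv0.
apply/andP; split.
  apply: le_trans (normr_ge0 (w j0 0 - interp M j0 0)) _.
  by apply: ub_le_sup S0; exists (e + C * mesh h) => r /Sle.
by apply: ge_sup; [exists `|w j0 0 - interp M j0 0| | move=> r /Sle].
Qed.

Lemma gat_norm_le (U : gridfun h) j k : `|gat U j k| <= grid_norm U.
Proof.
rewrite /gat /grid_norm; set i := inord k.
apply: (@le_trans _ _ (\big[Num.max/0]_(k < (nst h j).+1) `|U j k|)).
  have : i \in index_enum 'I_(nst h j).+1 by rewrite mem_index_enum.
  elim: (index_enum _) => // a s IH; rewrite inE big_cons le_max.
  by case/orP => [/eqP<-|/IH->]; rewrite ?lexx ?orbT.
have : j \in index_enum J by rewrite mem_index_enum.
elim: (index_enum J) => // a s IH; rewrite inE big_cons le_max.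
by case/orP => [/eqP<-|/IH->]; rewrite ?lexx ?orbT.
Qed.

Lemma grid_norm_le (U : gridfun h) C : 0 <= C ->
  (forall j k, (k <= nst h j)%N -> `|gat U j k| <= C) -> grid_norm U <= C.
Proof.
move=> C0 UC; rewrite /grid_norm; apply/bigmax_leP; split=> // j _.
apply/bigmax_leP; split=> // k _.
have kN : (k <= nst h j)%N by rewrite -ltnS.
by have := UC j k kN; rewrite /gat inord_val.
Qed.

Lemma grid_norm_ge0 (U : gridfun h) : 0 <= grid_norm U.
Proof.
rewrite /grid_norm; elim/big_ind: _ => // [x y x0 _|j _]; first by rewrite le_max x0.
by elim/big_ind: _ => // x y x0 _; rewrite le_max x0.
Qed.

End GridSampling.
(** * Consistency of the exact solution *)

Section Consistency.
Context {R : realType} {n : nat} {I J : finType} {G : network R n I J}.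
Variables (nu : J -> R) (beta : R) (f : 'rV[R]_n -> R).
Variables u m : 'rV[R]_n -> R.
Hypothesis beta2 : 2 <= beta.
Hypothesis nu0 : forall j, 0 < nu j.
Hypothesis uD : forall j, derivable_seg (len G j) (edge G u j).
Hypothesis uD2 : forall j, derivable_seg (len G j) (dseg (len G j) (edge G u j)).
Variable Cu : R.
Hypothesis Cu0 : 0 <= Cu.
Hypothesis uC : lip_slopes G (edge G u) Cu.
Variable h : step G.

Local Notation du j := (dseg (len G j) (edge G u j)).
Local Notation w := (grid_proj h u : gridfun h).
Local Notation y j k := (ycoord h j k).

Lemma ycoord_le j k : y j k <= y j k.+1.
Proof. by rewrite ycoordS lerDl ltW ?stp_gt0. Qed.

Lemma Dp_proj_left j k : (k < nst h j)%N -> `|Dp w j k - du j (y j k)| <= Cu * h j.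
Proof. by move=> kN; apply: Dp_proj => //; rewrite lexx ycoord_le. Qed.

Lemma Dp_proj_right j k : (k < nst h j)%N ->
  `|Dp w j k - du j (y j k.+1)| <= Cu * h j.
Proof. by move=> kN; apply: Dp_proj => //; rewrite lexx ycoord_le. Qed.

Lemma Dp_proj_right2 j k : (k.+1 < nst h j)%N ->
  `|Dp w j k.+1 - du j (y j k)| <= 2 * Cu * h j.
Proof.
move=> kN; have -> : 2 * Cu * h j = Cu * h j + Cu * h j by ring.
have -> : Dp w j k.+1 - du j (y j k) = (Dp w j k.+1 - du j (y j k.+1)) +
   (du j (y j k.+1) - du j (y j k)) by ring.
apply: le_trans (ler_normD _ _) _; apply: lerD; first exact: Dp_proj_left.
have [_ _ dL] := uC j.
apply: le_trans (dL _ _ (ycoord_itv (ltnW kN)) (ycoord_itv (ltnW (ltnW kN)))) _.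
by rewrite ycoordS addrC addKr gtr0_norm ?stp_gt0.
Qed.

Lemma du_le j k : (k <= nst h j)%N -> `|du j (y j k)| <= Cu.
Proof. by move=> kN; have [_ dC _] := uC j; exact/dC/ycoord_itv. Qed.

(** The left-hand side is the distance in which the Hamiltonian and its gradient
    are Lipschitz; [q] will be the derivative at a node and [q1], [q2] the
    slopes in the cells around it. *)
Lemma slope_dist q1 q2 q (r s : R) : `|q1 - q| <= r -> `|q2 - q| <= s ->
  `|negp q1 - negp q| + `|posp q2 - posp q| <= r + s.
Proof.
by move=> h1 h2; rewrite lerD//;
   [exact: le_trans (negp_lip _ _) h1|exact: le_trans (posp_lip _ _) h2].
Qed.

Definition tau_rate : R := beta * hbox beta Cu * Num.sqrt (Cu ^+ 2 + Cu ^+ 2) * (2 * Cu).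

(** The second difference is a value of the second derivative at a distance of
    at most one step, hence the rate given by its Hoelder continuity. *)
Lemma tau_consistency V lambda alpha Ch j k :
  hjb_equation G nu beta f V u m lambda -> 0 <= Ch -> 0 <= alpha ->
  (forall y z, y \in `[0, len G j] -> z \in `[0, len G j] ->
     `|dseg (len G j) (du j) y - dseg (len G j) (du j) z| <= Ch * `|y - z| `^ alpha) ->
  (1 <= k < nst h j)%N ->
  `|- nu j * D2 w j k + g_at beta f w j k + lambda - V m (node h j k)| <=
  nu j * (Ch * h j `^ alpha) + tau_rate * h j.
Proof.
move=> HJB Ch0 al0 hol kN; have /andP[k1 kN'] := kN.
have k1S : k.-1.+1 = k by rewrite prednK.
have kN1 : (k.-1 < nst h j)%N by rewrite (leq_ltn_trans (leq_pred _)).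
have := HJB j (y j k) (ycoord_itvo kN); rewrite /= hamE => eV.
rewrite -[V m (node h j k)]/(edge G (V m) j (y j k)) -eV.
have [c [cl cy ->]] := D2_proj (@uD j) (@uD2 j) kN.
have yl := ycoord_itv (ltnW kN'); set q := du j (y j k).
rewrite g_atE /slopes -[f (node h j k)]/(f (arc G j (y j k))).
set a := dseg _ _ c; set b := dseg _ _ (y j k).
set p := nham beta _ _; set p' := nham beta _ _; set ff := f _.
have -> : - nu j * a + (p + ff) + lambda - (- nu j * b + (p' + ff) + lambda) =
   nu j * (b - a) + (p - p') by ring.
apply: le_trans (ler_normD _ _) _; apply: lerD.
  rewrite normrM (gtr0_norm (nu0 j)) ler_wpM2l ?(ltW (nu0 j))//.
  apply: le_trans (hol _ _ yl cl) _; rewrite ler_wpM2l//.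
  by apply: ge0_ler_powR; rewrite ?nnegrE ?(ltW (stp_gt0 h j))// distrC.
have Dle i : (i < nst h j)%N -> `|Dp w j i| <= Cu by exact: Dp_proj_le.
have qC : `|q| <= Cu by exact/du_le/ltnW.
apply: le_trans (nham_lip beta2 (Dle _ kN') (Dle _ kN1) qC qC) _.
rewrite /tau_rate -[leRHS]mulrA ler_wpM2l//.
  by rewrite !mulr_ge0 ?powR_ge0 ?sqrtr_ge0//; apply: le_trans beta2.
have -> : 2 * Cu * h j = Cu * h j + Cu * h j by ring.
apply: slope_dist; first exact: Dp_proj_left.
by rewrite /q -{2}k1S; exact: Dp_proj_right.
Qed.

(** [S_op] differs from the exact transmission condition by the variation of the
    slope in the adjacent cells and by half a step of the zeroth-order term. *)
Lemma sigma_consistency W Wb i : 0 <= Wb ->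
  \sum_(j | inc G i j) nu j * oriented_deriv G u i j = 0 ->
  (forall j k, (k <= nst h j)%N -> `|gat W j k| <= Wb) ->
  `|S_op nu w W i| <= mesh h * \sum_j 2 * (nu j * Cu + Wb).
Proof.
move=> Wb0 T Wle; have S0 := exact_slope_kirchhoff uD T.
have bnd j (d v : R) : `|d| <= Cu * h j -> `|v| <= Wb ->
    `|nu j * d + h j / 2 * v| <= mesh h * (nu j * Cu + Wb).
  move=> dC vW; have hm := step_le_mesh h j; have h0 := stp_gt0 h j.
  rewrite mulrDr (le_trans (ler_normD _ _))// lerD//.
    rewrite normrM (gtr0_norm (nu0 j)) mulrCA ler_wpM2l ?(ltW (nu0 j))//.
    by apply: le_trans dC _; rewrite mulrC ler_wpM2r.
  rewrite normrM ler_pM//; rewrite gtr0_norm ?divr_gt0//.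
  by apply: le_trans hm; rewrite ler_pdivrMr// ler_peMr ?ler1n// ltW.
have bnd' j (d v : R) : `|d| <= Cu * h j -> `|v| <= Wb ->
    `|nu j * d - h j / 2 * v| <= mesh h * (nu j * Cu + Wb).
  by move=> dC vW; rewrite -mulrN; apply: bnd; rewrite ?normrN.
have b0 j : 0 <= mesh h * (nu j * Cu + Wb).
  by apply: mulr_ge0; [exact: mesh_ge0|rewrite addr_ge0// mulr_ge0// ltW].
have -> : S_op nu w W i = S_op nu w W i - (\sum_(j | incp G i j) nu j * du j 0 -
    \sum_(j | incm G i j) nu j * du j (len G j)) by rewrite S0 subr0.
rewrite /S_op.
have -> (a b c d : R) : a - b - (c - d) = (a - c) - (b - d) by ring.
rewrite -!sumrB; apply: le_trans (ler_normB _ _) _.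
have -> : mesh h * \sum_j 2 * (nu j * Cu + Wb) =
   \sum_j mesh h * (nu j * Cu + Wb) + \sum_j mesh h * (nu j * Cu + Wb).
  rewrite -big_split mulr_sumr; apply: eq_bigr => j _ /=; ring.
have sub_sum (P : pred J) (F : J -> R) : (forall j, P j -> `|F j| <= mesh h * (nu j * Cu + Wb)) ->
    `|\sum_(j | P j) F j| <= \sum_j mesh h * (nu j * Cu + Wb).
  move=> FP; apply: le_trans (ler_norm_sum _ _ _) _.
  rewrite [leRHS](bigID P)/= ler_wpDr//; first exact: sumr_ge0.
  exact: ler_sum.
apply: lerD; apply: sub_sum => j _.
  have -> : nu j * Dp w j 0 + h j / 2 * gat W j 0 - nu j * du j 0 =
     nu j * (Dp w j 0 - du j 0) + h j / 2 * gat W j 0 by ring.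
  apply: bnd; last exact: Wle.
  by have := @Dp_proj_left j 0 (nst_gt0 h j); rewrite ycoord0.
have -> : nu j * Dp w j (nst h j).-1 - h j / 2 * gat W j (nst h j)
    - nu j * du j (len G j) =
  nu j * (Dp w j (nst h j).-1 - du j (len G j)) - h j / 2 * gat W j (nst h j) by ring.
have NS : (nst h j).-1.+1 = nst h j by rewrite prednK ?nst_gt0.
apply: bnd'; last exact: Wle.
by have := @Dp_proj_right j (nst h j).-1; rewrite NS ycoord_last; apply.
Qed.

Lemma flux_le (g1 g2 : J -> nat -> R) (M : gridfun h) (b Gb D : R) j k :
  0 <= Gb -> 0 <= b -> (k < nst h j)%N ->
  `|Dp M j k| <= D ->
  (forall k, (k <= nst h j)%N -> `|gat M j k| <= b) ->
  (forall k, (1 <= k < nst h j)%N -> `|g1 j k| <= Gb /\ `|g2 j k| <= Gb) ->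
  `|flux nu g1 g2 M j k| <= nu j * D + (b * Gb + b * Gb).
Proof.
move=> Gb0 b0 kN DD Mb gb; rewrite /flux (le_trans (ler_normD _ _))// lerD//.
  by rewrite normrM (gtr0_norm (nu0 j)) ler_wpM2l ?(ltW (nu0 j)).
have bG : 0 <= b * Gb by exact: mulr_ge0.
rewrite (le_trans (ler_normD _ _))// lerD//.
  case: eqP => [_|/eqP kN1]; first by rewrite normr0.
  have k1N : (0 < k.+1 < nst h j)%N by rewrite /= ltn_neqAle kN1.
  by rewrite normrM ler_pM ?Mb// (gb _ k1N).2.
case: eqP => [_|/eqP k0]; first by rewrite normr0.
have k0N : (0 < k < nst h j)%N by rewrite lt0n k0.
by rewrite normrM ler_pM ?Mb// ?(ltnW kN)// (gb _ k0N).1.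
Qed.

Hypothesis mD : forall j, derivable_seg (len G j) (edge G m j).
Hypothesis mD2 : forall j, derivable_seg (len G j) (dseg (len G j) (edge G m j)).
Variable Cm : R.
Hypothesis Cm0 : 0 <= Cm.
Hypothesis mC : lip_slopes G (edge G m) Cm.

Definition flux_rate j : R := nu j * Cm + (Cm * (hlip beta Cu * (3 * Cu))
  + Cm * (beta * (Cu * hbox beta Cu)) + Cm * (hlip beta Cu * (2 * Cu))).

(** In a cell without vertex both transport terms are present, and together they
    approximate the derivative of the Hamiltonian. *)
Lemma flux_consistency j k : fp_equation G nu beta f u m ->
  (0 < k)%N -> (k.+1 < nst h j)%N ->
  `|flux nu (g1_at beta f w) (g2_at beta f w) (grid_proj h m) j k
    - exact_flux G nu beta u m j 0| <= flux_rate j * h j.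
Proof.
move=> FP k0 kN; have k1S : k.-1.+1 = k by rewrite prednK.
have kN' : (k < nst h j)%N := ltnW kN.
have kN1 : (k.-1 < nst h j)%N by rewrite (leq_ltn_trans (leq_pred _)).
rewrite -(exact_flux_const beta2 uD2 mD mD2 FP (ycoord_itv (ltnW kN'))).
rewrite /flux (ltn_eqF kN) (gtn_eqF k0) g1_atE// g2_atE// /slopes /=.
rewrite /exact_flux /hslope !gat_proj ?(ltnW kN')//.
set q := du j (y j k); set a := edge G m j _; set b := edge G m j _.
set p2 := nham2 beta (Dp w j k.+1) _; set p1 := nham1 beta (Dp w j k) _.
set D := Dp _ _ _; set dm := dseg _ _ _.
have -> : nu j * D + (a * p2 + b * p1) -
    (nu j * dm + b * (nham1 beta q q + nham2 beta q q)) =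
  nu j * (D - dm) + (a * (p2 - nham2 beta q q) + (a - b) * nham2 beta q q +
   b * (p1 - nham1 beta q q)) by ring.
have h0 := stp_gt0 h j.
have L0 := hlip_ge0 Cu beta2.
have aC : `|a| <= Cm by have [mb _ _] := mC j; exact/mb/ycoord_itv.
have bC : `|b| <= Cm by have [mb _ _] := mC j; exact/mb/ycoord_itv/ltnW.
have qC : `|q| <= Cu by exact/du_le/ltnW.
have Dle i : (i < nst h j)%N -> `|Dp w j i| <= Cu by exact: Dp_proj_le.
have e1 : `|D - dm| <= Cm * h j by apply: Dp_proj => //; rewrite lexx ycoord_le.
have e2 : `|p2 - nham2 beta q q| <= hlip beta Cu * (3 * Cu) * h j.
  apply: le_trans (nham2_lip beta2 (Dle _ kN) (Dle _ kN') qC qC) _.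
  rewrite -[leRHS]mulrA ler_wpM2l//.
  have -> : 3 * Cu * h j = 2 * Cu * h j + Cu * h j by ring.
  by apply: slope_dist; [exact: Dp_proj_right2|exact: Dp_proj_left].
have e3 : `|a - b| <= Cm * h j.
  apply: le_trans (edge_lip mD mC (ycoord_itv _) (ycoord_itv (ltnW kN'))) _ => //.
  by rewrite ycoordS addrC addKr gtr0_norm.
have e4 : `|p1 - nham1 beta q q| <= hlip beta Cu * (2 * Cu) * h j.
  apply: le_trans (nham1_lip beta2 (Dle _ kN') (Dle _ kN1) qC qC) _.
  rewrite -[leRHS]mulrA ler_wpM2l//.
  have -> : 2 * Cu * h j = Cu * h j + Cu * h j by ring.
  apply: slope_dist; first exact: Dp_proj_left.
  by rewrite /q -{2}k1S; exact: Dp_proj_right.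
have e5 := nham2_le beta2 qC qC.
have -> : flux_rate j * h j = nu j * (Cm * h j) + (Cm * (hlip beta Cu * (3 * Cu) * h j)
  + Cm * h j * (beta * (Cu * hbox beta Cu)) + Cm * (hlip beta Cu * (2 * Cu) * h j)).
  by rewrite /flux_rate; ring.
apply: le_trans (ler_normD _ _) _; apply: lerD.
  by rewrite normrM (gtr0_norm (nu0 j)) ler_wpM2l ?(ltW (nu0 j)).
apply: le_trans (ler_normD _ _) _; apply: lerD.
  apply: le_trans (ler_normD _ _) _.
  by apply: lerD; rewrite normrM; apply: ler_pM.
by rewrite normrM; apply: ler_pM.
Qed.

End Consistency.

(** * Constants of the exact solution *)

Section Constants.
Context {R : realType} {n : nat} {I J : finType} (G : network R n I J).
Implicit Types (u m : 'rV[R]_n -> R).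

Lemma inhabited_edges m : net_integral G m = 1 -> inhabited J.
Proof.
move=> m1; case: (pickP (pred_of_simpl (@predT J))) => [j _|J0]; first exact: inhabits j.
move: m1; rewrite /net_integral big_pred0// => /eqP.
by rewrite eq_sym oner_eq0.
Qed.

Lemma density_lower_bound m : net_C2 G m -> (forall x, carrier G x -> 0 < m x) ->
  exists2 c, 0 < c & forall j (y : R), y \in `[0, len G j] -> c <= edge G m j y.
Proof.
move=> [_ mC2] m0.
apply: (@unif_pos R J (fun j c => forall y : R, y \in `[0, len G j] ->
  c <= edge G m j y)) => [j c c' h cc' y yl|j]; first exact: le_trans cc' (h y yl).
have [D1 _ _] := mC2 j.
have [y yl ymin] := EVT_min (ltW (len_gt0 G j)) (derivable_seg_continuous D1).
by exists (edge G m j y) => //; apply: m0; right; exists j; exists y.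
Qed.

Lemma holder_constant u (alpha : R) : net_C2holder G alpha u ->
  exists2 C, 0 <= C & forall j (y z : R), y \in `[0, len G j] -> z \in `[0, len G j] ->
    `|dseg (len G j) (dseg (len G j) (edge G u j)) y -
      dseg (len G j) (dseg (len G j) (edge G u j)) z| <= C * `|y - z| `^ alpha.
Proof.
move=> [_ uC2].
apply: (@unif_const R J (fun j C => forall y z : R, y \in `[0, len G j] ->
  z \in `[0, len G j] -> `|dseg (len G j) (dseg (len G j) (edge G u j)) y -
      dseg (len G j) (dseg (len G j) (edge G u j)) z| <= C * `|y - z| `^ alpha)).
  move=> j c c' h cc' y z yl zl; apply: le_trans (h y z yl zl) _.
  by rewrite ler_wpM2r// powR_ge0.
by move=> j; have [_ [C CP]] := uC2 j; exists C.
Qed.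

End Constants.
(** * Passage to the limit *)

Section MeshFilter.
Context {R : realType} {n : nat} {I J : finType} (G : network R n I J).

Lemma mesh_impl (P Q : step G -> Prop) : (forall h, P h -> Q h) ->
  (\forall h \near mesh_to0 G, P h) -> \forall h \near mesh_to0 G, Q h.
Proof. by move=> PQ nP; near=> h; apply: PQ; near: h. Unshelve. all: by end_near. Qed.

Lemma mesh_and (P Q : step G -> Prop) :
  (\forall h \near mesh_to0 G, P h) -> (\forall h \near mesh_to0 G, Q h) ->
  \forall h \near mesh_to0 G, P h /\ Q h.
Proof. by move=> nP nQ; near=> h; split; near: h. Unshelve. all: by end_near. Qed.

Lemma mesh_near (d : R) : 0 < d -> \forall h \near mesh_to0 G, mesh h < d.
Proof. by move=> d0; exists d. Qed.

Lemma mesh_lin_near (c e : R) : 0 < e -> \forall h \near mesh_to0 G, c * mesh h <= e.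
Proof.
move=> e0; have d0 : 0 < e / (`|c| + 1) by rewrite divr_gt0// ltr_wpDl.
near=> h; have hd : mesh h < e / (`|c| + 1) by near: h; exact: mesh_near.
have c1 : 0 < `|c| + 1 by rewrite ltr_wpDl.
apply: (@le_trans _ _ ((`|c| + 1) * mesh h)).
  by rewrite ler_wpM2r ?mesh_ge0// (le_trans (ler_norm _))// lerDl.
by rewrite mulrC -ler_pdivlMr// ltW.
Unshelve. all: by end_near.
Qed.

Lemma mesh_pow_near (a c e : R) : 0 < a -> 0 < e ->
  \forall h \near mesh_to0 G, forall j, c * stp h j `^ a <= e.
Proof.
move=> a0 e0; have c1 : 0 < `|c| + 1 by rewrite ltr_wpDl.
have d0 : 0 < e / (`|c| + 1) by rewrite divr_gt0.
near=> h => j.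
have hd : mesh h < (e / (`|c| + 1)) `^ a^-1.
  by near: h; apply: mesh_near; exact: powR_gt0.
have h0 : 0 <= h j by exact: ltW (stp_gt0 h j).
apply: (@le_trans _ _ ((`|c| + 1) * h j `^ a)).
  by rewrite ler_wpM2r ?powR_ge0// (le_trans (ler_norm _))// lerDl.
rewrite mulrC -ler_pdivlMr//.
have <- : ((e / (`|c| + 1)) `^ a^-1) `^ a = e / (`|c| + 1).
  by rewrite -powRrM mulVf ?lt0r_neq0// powRr1// ltW.
apply: ge0_ler_powR; rewrite ?nnegrE ?(ltW a0) ?powR_ge0//.
exact: le_trans (step_le_mesh h j) (ltW hd).
Unshelve. all: by end_near.
Qed.

Lemma sum_step_le (h : step G) : \sum_j h j <= #|J|%:R * mesh h.
Proof.
apply: (@le_trans _ _ (\sum_(j : J) mesh h)).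
  by apply: ler_sum => j _; exact: step_le_mesh.
by rewrite sumr_const mulr_natl.
Qed.

Lemma sum_step_near (c e : R) : 0 <= c -> 0 < e ->
  \forall h \near mesh_to0 G, c * \sum_j stp h j <= e.
Proof.
move=> c0 e0; near=> h.
apply: (@le_trans _ _ (c * #|J|%:R * mesh h)).
  by rewrite -mulrA ler_wpM2l// sum_step_le.
by near: h; exact: mesh_lin_near.
Unshelve. all: by end_near.
Qed.

End MeshFilter.

Section Convergence.
Context {R : realType} {n : nat} {I J : finType} (G : network R n I J).
Variables (nu : J -> R) (alpha beta : R) (f : 'rV[R]_n -> R).
Variable V : ('rV[R]_n -> R) -> 'rV[R]_n -> R.
Variable Vh : forall h : step G, gridfun h -> gridfun h.
Variables (u m : 'rV[R]_n -> R) (lambda : R).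
Variables (U M : forall h : step G, gridfun h) (Lambda : step G -> R).
Arguments U : clear implicits.
Arguments M : clear implicits.

Local Notation L := (total_len (G := G)).
Local Notation one h := (grid_const 1 : gridfun h).
Local Notation w h := (grid_proj h u : gridfun h).
Local Notation du j := (dseg (len G j) (edge G u j)).

Hypothesis nu0 : forall j, 0 < nu j.
Hypothesis alpha0 : 0 < alpha.
Hypothesis alpha1 : alpha <= 1.
Hypothesis beta2 : 2 <= beta.
Hypothesis J0 : inhabited J.

Variables Cu Ch Cm m0 C : R.
Hypothesis Cu0 : 0 <= Cu.
Hypothesis Ch0 : 0 <= Ch.
Hypothesis Cm0 : 0 <= Cm.
Hypothesis m00 : 0 < m0.
Hypothesis C0 : 0 <= C.
Hypothesis uD : forall j, derivable_seg (len G j) (edge G u j).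
Hypothesis uD2 : forall j, derivable_seg (len G j) (du j).
Hypothesis uC : lip_slopes G (edge G u) Cu.
Hypothesis uH : forall j (y z : R), y \in `[0, len G j] -> z \in `[0, len G j] ->
     `|dseg (len G j) (du j) y - dseg (len G j) (du j) z| <= Ch * `|y - z| `^ alpha.
Hypothesis mD : forall j, derivable_seg (len G j) (edge G m j).
Hypothesis mD2 : forall j, derivable_seg (len G j) (dseg (len G j) (edge G m j)).
Hypothesis mC : lip_slopes G (edge G m) Cm.
Hypothesis mge : forall j (y : R), y \in `[0, len G j] -> m0 <= edge G m j y.
Hypothesis mcont : net_continuous G m.
Hypothesis HJB : hjb_equation G nu beta f V u m lambda.
Hypothesis FP : fp_equation G nu beta f u m.
Hypothesis mass1 : net_integral G m = 1.
Hypothesis mean0 : net_integral G u = 0.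
Hypothesis TC : transition_conditions G nu beta f u m.
Hypothesis VhC : forall (h : step G) (W : gridfun h) j k, grid_density W -> `|gat (Vh W) j k| <= C.
Hypothesis VhV2 : coupling_V2 Vh.
Hypothesis VhV4 : coupling_V4 V Vh alpha.
Hypothesis scheme : \forall h \near mesh_to0 G,
  scheme_solution beta f nu (@Vh h) (U h) (M h) (Lambda h).

Lemma L_gt0 : 0 < L.
Proof.
case: J0 => j; rewrite /total_len (bigD1 j)//= ltr_pwDl ?len_gt0//.
by apply: sumr_ge0 => i _; exact: ltW (len_gt0 _ _).
Qed.

Lemma m_holder : net_holder G alpha m.
Proof.
split=> // j; exists (Cm * Num.max 1 (len G j)) => y z yl zl.
apply: le_trans (edge_lip mD mC yl zl) _; rewrite -mulrA ler_wpM2l//.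
set t := `|y - z|; have tl : t <= len G j.
  move: yl zl; rewrite !in_itv/= => /andP[y0 yl] /andP[z0 zl].
  by rewrite ler_norml; apply/andP; split; lra.
have t0 : 0 <= t by exact: normr_ge0.
have ta : 0 <= t `^ alpha by exact: powR_ge0.
have [t1|t1] := lerP t 1; last first.
  apply: (@le_trans _ _ (len G j * t `^ alpha)); last first.
    by rewrite ler_wpM2r// le_max lexx orbT.
  apply: le_trans tl _; rewrite ler_peMr ?(ltW (len_gt0 G j))//.
  by rewrite -(powRr0 t); apply: ler_powR => //; exact: ltW.
apply: (@le_trans _ _ (t `^ alpha)); last first.
  by rewrite ler_peMl// le_max lexx.
move: t0; rewrite le0r => /orP[/eqP->|t0]; first exact: powR_ge0.
by rewrite -[leLHS]powRr1 ?(ltW t0)//; apply: ger_powR; rewrite ?t0.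
Qed.

(** The assumptions on the coupling concern densities of mass exactly one,
    whence the normalization. *)
Definition mass (h : step G) : R := ginner (grid_proj h m) (one h).
Definition sampled (h : step G) : gridfun h := fun j k => grid_proj h m j k / mass h.
Arguments sampled : clear implicits.
Local Notation mu h := (sampled h).

Lemma mass_near e : 0 < e -> \forall h \near mesh_to0 G, `|mass h - 1| <= e.
Proof.
move=> e0; near=> h; rewrite -mass1.
apply: le_trans (ginner_proj_integral h Cm0 mD mC) _; rewrite mulrAC.
by near: h; exact: mesh_lin_near.
Unshelve. all: by end_near.
Qed.

Lemma mass_half : \forall h \near mesh_to0 G, 1 / 2 <= mass h <= 2.
Proof.
near=> h; have : `|mass h - 1| <= 1 / 2 by near: h; apply: mass_near; lra.
by rewrite ler_norml => /andP[h1 h2]; apply/andP; split; lra.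
Unshelve. all: by end_near.
Qed.

Lemma mass_inv h : 1 / 2 <= mass h <= 2 -> 1 / 2 <= (mass h)^-1 <= 2.
Proof.
move=> /andP[h1 h2]; have p : 0 < mass h by lra.
have y0 : 0 < (mass h)^-1 by rewrite invr_gt0.
have : mass h * (mass h)^-1 = 1 by rewrite divff// gt_eqF.
by move: (mass h)^-1 y0 => y y0 e; apply/andP; split; nra.
Qed.

Lemma gat_sampled h j k : (k <= nst h j)%N ->
  gat (mu h) j k = edge G m j (ycoord h j k) / mass h.
Proof. by move=> kN; rewrite -gat_proj. Qed.

Lemma sampled_bounds h j k : 1 / 2 <= mass h <= 2 -> (k <= nst h j)%N ->
  m0 / 2 <= gat (mu h) j k <= 2 * Cm.
Proof.
move=> /mass_inv/andP[i1 i2] kN; rewrite gat_sampled//.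
have yl := ycoord_itv kN; have h1 := mge yl.
have [/(_ _ yl) h2 _ _] := mC j.
have {}h2 := le_trans (ler_norm _) h2.
have a := m00; have b := Cm0.
by apply/andP; split; nra.
Qed.

Lemma sampled_gt0 h j k : 1 / 2 <= mass h <= 2 -> (k <= nst h j)%N ->
  0 < gat (mu h) j k.
Proof.
move=> hm kN; have /andP[+ _] := sampled_bounds hm kN.
by apply: lt_le_trans; rewrite divr_gt0.
Qed.

Lemma sampled_continuous h : gcontinuous (mu h).
Proof.
have [v0 v1] := vertex_values_proj h m.
apply: (@vertex_valuesP _ _ _ _ _ _ _ (fun i => m (vtx G i) / mass h)).
by split=> j; [rewrite -v0|rewrite -v1].
Qed.

Lemma sampled_mass h : 1 / 2 <= mass h <= 2 -> ginner (mu h) (one h) = 1.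
Proof.
move=> /andP[h1 h2]; have p : mass h != 0 by rewrite gt_eqF//; lra.
transitivity ((mass h)^-1 * mass h); last by rewrite mulVf.
rewrite {2}/mass !ginner_trapezoid cellsZ.
by apply: eq_cells => j k kN; rewrite !gat_const /sampled /gat; field.
Qed.

Lemma sampled_density h : 1 / 2 <= mass h <= 2 -> grid_density (mu h).
Proof.
move=> hm; split; [exact: sampled_continuous| |exact: sampled_mass].
move=> j k; have kN : (k <= nst h j)%N by rewrite -ltnS.
by have := sampled_gt0 hm kN; rewrite /gat inord_val => /ltW.
Qed.

Lemma Dp_sampled h j k : Dp (mu h) j k = Dp (grid_proj h m) j k / mass h.
Proof. by rewrite /Dp /sampled /gat; ring. Qed.

Lemma flux_sampled h g1 g2 j k :
  flux nu g1 g2 (mu h) j k = flux nu g1 g2 (grid_proj h m) j k / mass h.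
Proof.
rewrite /flux Dp_sampled /sampled /gat.
by case: ifP => _; case: ifP => _; ring.
Qed.

Lemma sampled_near e : 0 < e -> \forall h \near mesh_to0 G,
  forall j k, (k <= nst h j)%N -> `|gat (mu h) j k - edge G m j (ycoord h j k)| <= e.
Proof.
move=> e0; have d0 : 0 < e / (2 * Cm + 1) by rewrite divr_gt0// ltr_wpDl// mulr_ge0.
near=> h => j k kN.
have hm : 1 / 2 <= mass h <= 2 by near: h; exact: mass_half.
have hd : `|mass h - 1| <= e / (2 * Cm + 1) by near: h; exact: mass_near.
have /andP[i1 i2] := mass_inv hm.
have p : mass h != 0 by rewrite gt_eqF//; case/andP: hm => ? ?; lra.
rewrite gat_sampled//; set x := edge G m j _.
have -> : x / mass h - x = - (x * (mass h - 1)) / mass h by field.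
have [/(_ _ (ycoord_itv kN)) xC _ _] := mC j.
rewrite normrM normrN normrM.
have -> : `|(mass h)^-1| = (mass h)^-1 by rewrite ger0_norm//; lra.
have h1 : `|x| * `|mass h - 1| <= Cm * (e / (2 * Cm + 1)) by apply: ler_pM.
apply: (@le_trans _ _ (Cm * (e / (2 * Cm + 1)) * 2)).
  by apply: ler_pM => //; lra.
have c1 : 0 < 2 * Cm + 1 by rewrite ltr_wpDl// mulr_ge0.
rewrite mulrAC mulrA ler_pdivrMr//.
have := e0; have := Cm0; nra.
Unshelve. all: by end_near.
Qed.

(** Used for the sampled density, and for [M] once it is known to converge. *)
Lemma coupling_near (W : forall h : step G, gridfun h) :
  (\forall h \near mesh_to0 G, grid_density (W h)) ->
  (forall e, 0 < e -> \forall h \near mesh_to0 G, forall j k, (k <= nst h j)%N ->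
     `|gat (W h) j k - edge G m j (ycoord h j k)| <= e) ->
  forall e, 0 < e -> \forall h \near mesh_to0 G, forall j k, (k <= nst h j)%N ->
    `|gat (Vh (W h)) j k - V m (node h j k)| <= e.
Proof.
move=> Wd Wm e e0; have [omega [_ omono /cvgrPdist_le/(_ e e0) ocv oV]] := VhV4.
have [d d0 dP] : exists2 d : R, 0 < d & omega d <= e.
  move: ocv; rewrite near_withinE => -[r /= r0 hr]; exists (r / 2).
    by rewrite divr_gt0.
  have : `|0 - omega (r / 2)| <= e.
    apply: hr => /=; last by rewrite divr_gt0.
    by rewrite sub0r normrN gtr0_norm ?divr_gt0//; lra.
  by rewrite sub0r normrN; exact: le_trans (ler_norm _).
have d20 : 0 < d / 2 by rewrite divr_gt0.
near=> h => j k kN.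
have Wdh : grid_density (W h) by near: h.
have Wmh j' k' : (k' <= nst h j')%N ->
    `|gat (W h) j' k' - edge G m j' (ycoord h j' k')| <= d / 2.
  by move: j' k'; near: h; exact: Wm.
have mh : Cm * mesh h <= d / 2 by near: h; exact: mesh_lin_near.
have le := oV m h (W h) m_holder mass1 Wdh.
have /andP[nn0 nnd] := @net_norm_interp _ _ _ _ _ h (edge G m) Cm (d / 2) (W h) J0 Cm0
  (fun j => @edge_lip _ _ _ _ _ m Cm mD mC j) Wmh.
have nnd' : net_norm G (fun j y => edge G m j y - interp (W h) j y) <= d.
  by apply: le_trans nnd _; lra.
have od : omega (net_norm G (fun j y => edge G m j y - interp (W h) j y)) <= omega d.
  by apply: omono => //; rewrite in_itv/= andbT// ltW.
have := gat_norm_le (grid_sub (grid_proj h (V m)) (Vh (W h))) j k.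
have -> : gat (grid_sub (grid_proj h (V m)) (Vh (W h))) j k =
    V m (node h j k) - gat (Vh (W h)) j k.
  by rewrite /gat /grid_sub /grid_proj inordK.
rewrite distrC => hle; apply: le_trans hle _.
exact: le_trans le (le_trans od dP).
Unshelve. all: by end_near.
Qed.

(** * Residuals of the sampled solution and uniform bounds *)

Definition exact_c j : R := exact_flux G nu beta u m j 0.
Definition sampled_c (h : step G) j : R := exact_c j / mass h.

Lemma sampled_kirchhoff h : kirchhoff G (sampled_c h).
Proof.
move=> i; rewrite -!mulr_suml -mulrBl (exact_flux_kirchhoff beta2 uD uD2 mD mD2 FP) ?mul0r//.
by move=> i'; have [_ + _] := TC i'.
Qed.

Lemma sampled_coupling e : 0 < e -> \forall h \near mesh_to0 G,
  forall j k, (k <= nst h j)%N -> `|gat (Vh (mu h)) j k - V m (node h j k)| <= e.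
Proof.
apply: (@coupling_near (fun h => mu h)); last exact: sampled_near.
near=> h; apply: sampled_density; near: h; exact: mass_half.
Unshelve. all: by end_near.
Qed.

Definition hjb_residual (h : step G) j k : R :=
  - nu j * D2 (w h) j k + g_at beta f (w h) j k + lambda - gat (Vh (mu h)) j k.

Lemma sum_ge (F : J -> R) j : (forall i, 0 <= F i) -> F j <= \sum_i F i.
Proof. by move=> F0; rewrite (bigD1 j)//= lerDl sumr_ge0. Qed.

Lemma exact_tau_near e : 0 < e -> \forall h \near mesh_to0 G,
  forall j k, (1 <= k < nst h j)%N ->
  `|- nu j * D2 (w h) j k + g_at beta f (w h) j k + lambda - V m (node h j k)| <= e.
Proof.
move=> e0; have e2 : 0 < e / 2 by rewrite divr_gt0.
near=> h => j k kN.
apply: le_trans (tau_consistency beta2 nu0 uD uD2 Cu0 uC HJB Ch0 (ltW alpha0) (@uH j) kN) _.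
have H1 : forall j, (\sum_j nu j) * Ch * stp h j `^ alpha <= e / 2.
  by near: h; exact: mesh_pow_near.
have h1 := H1 j.
have h2 : tau_rate beta Cu * mesh h <= e / 2 by near: h; exact: mesh_lin_near.
have h3 : tau_rate beta Cu * h j <= tau_rate beta Cu * mesh h.
  rewrite ler_wpM2l ?step_le_mesh// /tau_rate !mulr_ge0 ?powR_ge0 ?sqrtr_ge0//.
  exact: le_trans beta2.
have h4 : nu j * (Ch * h j `^ alpha) <= (\sum_j nu j) * Ch * stp h j `^ alpha.
  rewrite -mulrA ler_wpM2r ?mulr_ge0 ?powR_ge0//.
  by apply: sum_ge => i; exact: ltW.
by lra.
Unshelve. all: by end_near.
Qed.

Lemma hjb_residual_near e : 0 < e -> \forall h \near mesh_to0 G,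
  forall j k, (1 <= k < nst h j)%N -> `|hjb_residual h j k| <= e.
Proof.
move=> e0; have e2 : 0 < e / 2 by rewrite divr_gt0.
near=> h => j k kN.
have H1 : forall j k, (1 <= k < nst h j)%N ->
    `|- nu j * D2 (w h) j k + g_at beta f (w h) j k + lambda - V m (node h j k)| <= e / 2.
  by near: h; exact: exact_tau_near.
have h1 := H1 j k kN.
have kN' : (k <= nst h j)%N by case/andP: kN => _ /ltnW.
have H2 : forall j k, (k <= nst h j)%N ->
    `|gat (Vh (mu h)) j k - V m (node h j k)| <= e / 2.
  by near: h; exact: sampled_coupling.
have h2 := H2 j k kN'.
rewrite /hjb_residual; move: h1 h2; set a := _ + lambda; set b := V m _; set c := gat _ _ _.
move=> h1 h2; have -> : a - c = (a - b) - (c - b) by ring.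
by rewrite (le_trans (ler_normB _ _))//; lra.
Unshelve. all: by end_near.
Qed.

(** In the Hamilton-Jacobi equation for [w] all terms but [f] are bounded. *)
Lemma running_cost_near : exists2 Cf, 0 <= Cf & \forall h \near mesh_to0 G,
  forall j k, (1 <= k < nst h j)%N -> `|f (node h j k)| <= Cf.
Proof.
have lin (a b c d x l ll s t cc : R) : `|- c + (d + x) + l - b| <= 1 ->
    `|a - b| <= 1 -> `|a| <= cc -> `|c| <= s -> `|d| <= t -> `|l| <= ll ->
    `|x| <= 1 + (1 + cc) + ll + s + t.
  rewrite !ler_norml => /andP[? ?] /andP[? ?] /andP[? ?] /andP[? ?] /andP[? ?].
  by move=> /andP[? ?]; apply/andP; split; lra.
pose Np := (Cu ^+ 2 + Cu ^+ 2) `^ (beta / 2).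
exists (1 + (1 + C) + `|lambda| + (\sum_j nu j) * (2 * Cu) + Np).
  have s0 : 0 <= \sum_j nu j by apply: sumr_ge0 => j _; exact: ltW.
  have := C0; have := Cu0; have := normr_ge0 lambda; have : 0 <= Np by exact: powR_ge0.
  by move: (\sum_j _) s0 => s s0 *; rewrite !addr_ge0// mulr_ge0// mulr_ge0.
near=> h => j k kN.
have H1 : forall j k, (1 <= k < nst h j)%N ->
    `|- nu j * D2 (w h) j k + g_at beta f (w h) j k + lambda - V m (node h j k)| <= 1.
  by near: h; exact: exact_tau_near.
have h1 := H1 j k kN.
have /andP[k1 kN'] := kN.
have H2 : forall j k, (k <= nst h j)%N ->
    `|gat (Vh (mu h)) j k - V m (node h j k)| <= 1.
  by near: h; exact: sampled_coupling.
have h2 := H2 j k (ltnW kN').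
have hm : 1 / 2 <= mass h <= 2 by near: h; exact: mass_half.
have h3 := @VhC h (mu h) j k (sampled_density hm).
have k1S : k.-1.+1 = k by rewrite prednK.
have kN1 : (k.-1 < nst h j)%N by rewrite (leq_ltn_trans (leq_pred _)).
have h0 := stp_gt0 h j.
have h4 : `|nu j * D2 (w h) j k| <= (\sum_j nu j) * (2 * Cu).
  rewrite normrM (gtr0_norm (nu0 j)); apply: ler_pM => //; first exact: ltW.
    by apply: sum_ge => i; exact: ltW.
  have -> : D2 (w h) j k = (Dp (w h) j k - Dp (w h) j k.-1) / h j.
    by rewrite /D2 /Dp k1S; field; exact: stp_neq0.
  rewrite normrM normfV (gtr0_norm h0) ler_pdivrMr//.
  have -> : Dp (w h) j k - Dp (w h) j k.-1 = (Dp (w h) j k - du j (ycoord h j k)) -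
      (Dp (w h) j k.-1 - du j (ycoord h j k)) by ring.
  apply: le_trans (ler_normB _ _) _.
  have -> : 2 * Cu * h j = Cu * h j + Cu * h j by ring.
  apply: lerD; first exact: Dp_proj_left.
  by rewrite -{2}k1S; exact: Dp_proj_right.
have h5 : `|slopes (nham beta) (w h) j k| <= Np.
  rewrite ger0_norm ?npow_ge0//; apply: npow_le => //.
  by apply: sqn_box; exact: Dp_proj_le.
rewrite g_atE mulNr in h1; exact: lin h1 h2 h3 h4 h5 (lexx _).
Unshelve. all: by end_near.
Qed.

Lemma slope_near : exists2 K, Cu <= K & \forall h \near mesh_to0 G,
  forall j k, (k < nst h j)%N -> `|Dp (U h) j k| <= K.
Proof.
have [Cf Cf0 fn] := running_cost_near.
exists (Cu + \sum_j `|slope_bound (G := G) nu (C + Cf) j|).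
  by rewrite lerDl sumr_ge0.
near=> h => j k kN.
have fC : forall j k, (1 <= k < nst h j)%N -> `|f (node h j k)| <= Cf by near: h.
have [HU HM VU Md mean] : scheme_solution beta f nu (@Vh h) (U h) (M h) (Lambda h).
  by near: h.
have HS : discrete_hjb nu beta f (U h) (Vh (M h)) (Lambda h).
  by split=> // i; case: (VU i).
have Uc : gcontinuous (U h) by move=> i; case: (VU i).
have TM i : T_op beta f nu (M h) (U h) i = 0 by case: (VU i).
have [cM FM] := scheme_flux HM TM.
have VC j' k' : (k' <= nst h j')%N -> `|gat (Vh (M h)) j' k'| <= C.
  by move=> _; exact: VhC.
have lamge := ergodic_ge beta2 Uc Md HS FM VC Cf0 fC.
apply: le_trans (slope_le beta2 nu0 C0 Cf0 lamge L_gt0 HS VC fC kN) _.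
apply: le_trans (ler_norm _) _; rewrite -[leLHS]add0r lerD//.
exact: (@sum_ge (fun j => `|slope_bound (G := G) nu (C + Cf) j|)).
Unshelve. all: by end_near.
Qed.

Section BoundedSlopes.
Variable K : R.
Hypothesis CuK : Cu <= K.
Hypothesis UK : \forall h \near mesh_to0 G,
  forall j k, (k < nst h j)%N -> `|Dp (U h) j k| <= K.

Lemma K_ge0 : 0 <= K. Proof. exact: le_trans Cu0 CuK. Qed.

Lemma wK (h : step G) j k : (k < nst h j)%N -> `|Dp (w h) j k| <= K.
Proof. by move=> kN; apply: le_trans CuK; exact: Dp_proj_le. Qed.

Definition grad_bound : R := beta * (K * hbox beta K).

Lemma grad_bound_ge0 : 0 <= grad_bound.
Proof.
by rewrite !mulr_ge0 ?powR_ge0 ?K_ge0//; apply: le_trans beta2.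
Qed.

Lemma g_at_le (h : step G) (W : gridfun h) j k :
  (forall j k, (k < nst h j)%N -> `|Dp W j k| <= K) -> (1 <= k < nst h j)%N ->
  `|g1_at beta f W j k| <= grad_bound /\ `|g2_at beta f W j k| <= grad_bound.
Proof.
move=> WK /andP[_ kN].
have kN1 : (k.-1 < nst h j)%N by rewrite (leq_ltn_trans (leq_pred _)).
rewrite g1_atE// g2_atE//; split.
  by apply: nham1_le; rewrite ?WK.
by apply: nham2_le; rewrite ?WK.
Qed.

Definition residual_bound : R := \sum_j (nu j * (2 * Cm)
  + (2 * Cm * grad_bound + 2 * Cm * grad_bound) + 2 * `|exact_c j|).

Lemma flux_residual_le (h : step G) (W : gridfun h) j k : 1 / 2 <= mass h <= 2 ->
  (forall j k, (k < nst h j)%N -> `|Dp W j k| <= K) -> (k < nst h j)%N ->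
  `|flux nu (g1_at beta f W) (g2_at beta f W) (mu h) j k - sampled_c h j|
  <= residual_bound.
Proof.
move=> hm WK kN; have /andP[i1 i2] := mass_inv hm.
have Cm2 : 0 <= 2 * Cm by rewrite mulr_ge0.
have iN : `|(mass h)^-1| <= 2 by rewrite ger0_norm//; lra.
have Gb0 := grad_bound_ge0.
apply: le_trans (sum_ge _ _); last first.
  by move=> i; rewrite !addr_ge0// mulr_ge0// ltW.
apply: le_trans (ler_normB _ _) _; apply: lerD.
  apply: (flux_le nu0 Gb0 Cm2 kN) => [|i iN'|i iN'].
  - rewrite Dp_sampled normrM [leRHS]mulrC ler_pM//.
    exact: Dp_proj_le.
  - have /andP[s1 s2] := sampled_bounds hm iN'.
    by rewrite ger0_norm// (le_trans _ s1)// divr_ge0// ltW.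
  - exact: g_at_le.
by rewrite normrM mulrC ler_wpM2r.
Qed.

Lemma residual_bound_ge0 : 0 <= residual_bound.
Proof.
have Cm2 : 0 <= 2 * Cm by rewrite mulr_ge0.
have g0 := mulr_ge0 Cm2 grad_bound_ge0.
by apply: sumr_ge0 => j _; rewrite !addr_ge0// mulr_ge0// ltW.
Qed.

Definition fp_residual (h : step G) j k : R :=
  flux nu (g1_at beta f (w h)) (g2_at beta f (w h)) (mu h) j k - sampled_c h j.

Lemma fp_residual_near e : 0 < e -> \forall h \near mesh_to0 G,
  forall j k, (0 < k)%N -> (k.+1 < nst h j)%N -> `|fp_residual h j k| <= e.
Proof.
move=> e0; near=> h => j k k0 kN.
have hm : 1 / 2 <= mass h <= 2 by near: h; exact: mass_half.
have /andP[i1 i2] := mass_inv hm.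
have fr0 i : 0 <= flux_rate nu beta Cu Cm i.
  have b0 : 0 <= beta by apply: le_trans beta2.
  have b1 : 0 <= beta - 1 by have := beta2; lra.
  by rewrite !addr_ge0 ?mulr_ge0 ?powR_ge0// ltW.
have h1 : (\sum_i flux_rate nu beta Cu Cm i) * 2 * mesh h <= e.
  by near: h; exact: mesh_lin_near.
rewrite /fp_residual flux_sampled /sampled_c -mulrBl normrM.
have h2 := flux_consistency beta2 nu0 uD uD2 Cu0 uC mD mD2 Cm0 mC FP k0 kN.
have -> : `|(mass h)^-1| = (mass h)^-1 by rewrite ger0_norm//; lra.
apply: le_trans h1; rewrite mulrAC; apply: ler_pM => //; first lra.
apply: le_trans h2 _; apply: ler_pM => //; first exact: ltW (stp_gt0 h j).
  exact: sum_ge.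
exact: step_le_mesh.
Unshelve. all: by end_near.
Qed.

(** Small in the interior cells and bounded in the end cells, of which there is
    a fixed number. *)
Lemma fp_residual_L1 c e : 0 <= c -> 0 < e -> \forall h \near mesh_to0 G,
  c * cells h (fun j k => h j * `|fp_residual h j k|) <= e.
Proof.
move=> c0 e0; have L0 := L_gt0; have E0 := residual_bound_ge0.
have d0 : 0 < e / 2 / (c * L + 1) by rewrite !divr_gt0// ltr_wpDl// mulr_ge0// ltW.
near=> h.
have hm : 1 / 2 <= mass h <= 2 by near: h; exact: mass_half.
have h1 : forall j k, (0 < k)%N -> (k.+1 < nst h j)%N ->
    `|fp_residual h j k| <= e / 2 / (c * L + 1) by near: h; exact: fp_residual_near.
have h2 : c * (2 * residual_bound) * \sum_j stp h j <= e / 2.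
  by near: h; apply: sum_step_near; rewrite ?mulr_ge0// divr_gt0.
have := @cells_ends _ _ _ _ _ h (fun j k => h j * `|fp_residual h j k|) _ _ (ltW d0) E0.
move=> /(_ _ _) H; apply: le_trans (ler_wpM2l c0 (H _ _)) _.
- by move=> j k k0 kN; rewrite ler_wpM2l ?stp_ge0// h1.
- move=> j k kN; rewrite ler_wpM2l ?stp_ge0//.
  by apply: flux_residual_le => // i l; exact: wK.
have eE : e = e / 2 + e / 2 by field.
rewrite mulrDr [leRHS]eE; apply: lerD; last by rewrite mulrA.
have cL : 0 < c * L + 1 by rewrite ltr_wpDl// mulr_ge0// ltW.
have -> : c * (e / 2 / (c * L + 1) * L) = e / 2 * (c * L / (c * L + 1)).
  by field; rewrite gt_eqF.
have e20 : 0 <= e / 2 by rewrite divr_ge0// ltW.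
by rewrite ler_piMr// ler_pdivrMr// mul1r lerDl.
Unshelve. all: by end_near.
Qed.

Lemma fp_residual_L2 c e : 0 <= c -> 0 < e -> \forall h \near mesh_to0 G,
  c * cells h (fun j k => h j * fp_residual h j k ^+ 2) <= e.
Proof.
move=> c0 e0; have E0 := residual_bound_ge0.
near=> h.
have hm : 1 / 2 <= mass h <= 2 by near: h; exact: mass_half.
have h1 : c * residual_bound * cells h (fun j k => h j * `|fp_residual h j k|) <= e.
  by near: h; apply: fp_residual_L1; rewrite ?mulr_ge0.
apply: le_trans h1; rewrite -mulrA ler_wpM2l// cellsZ.
apply: le_cells => j k kN; rewrite [leRHS]mulrCA ler_wpM2l ?stp_ge0//.
rewrite -real_normK ?num_real// expr2 ler_wpM2r//.
by apply: flux_residual_le => // i l; exact: wK.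
Unshelve. all: by end_near.
Qed.

Lemma small_factor (c e : R) : 0 <= c -> 0 < e -> exists2 d, 0 < d & c * d <= e.
Proof.
move=> c0 e0; have c1 : 0 < c + 1 by rewrite ltr_wpDl.
exists (e / (c + 1)); first by rewrite divr_gt0.
by rewrite mulrA ler_pdivrMr// mulrC ler_pM2l// lerDl.
Qed.

Lemma scheme_facts : \forall h \near mesh_to0 G,
  [/\ discrete_hjb nu beta f (U h) (Vh (M h)) (Lambda h), gcontinuous (U h),
      grid_density (M h) & ginner (U h) (one h) = 0] /\
  exists cM, conserved nu (g1_at beta f (U h)) (g2_at beta f (U h)) (M h) cM.
Proof.
near=> h; have [HU HM VU Md mean] :
  scheme_solution beta f nu (@Vh h) (U h) (M h) (Lambda h) by near: h.
split; first by split=> // [|i]; [split=> // i; case: (VU i)|case: (VU i)].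
by apply: scheme_flux => // i; case: (VU i).
Unshelve. all: by end_near.
Qed.

Lemma diffusion_ge : exists2 a, 0 < a & forall j, a <= nu j * (m0 / 2).
Proof.
apply: unif_pos => [j c c' h1 h2|j]; first exact: le_trans h1.
by exists (nu j * (m0 / 2)); rewrite // mulr_gt0 ?divr_gt0.
Qed.

Lemma mid_sampled h j k a : 1 / 2 <= mass h <= 2 -> a <= nu j * (m0 / 2) ->
  (k < nst h j)%N -> a <= nu j * mid (mu h) j k.
Proof.
move=> hm aj kN; apply: le_trans aj _; rewrite ler_wpM2l ?(ltW (nu0 j))//.
have /andP[s1 _] := sampled_bounds hm (ltnW kN).
have /andP[s2 _] := sampled_bounds hm kN.
by rewrite /mid; move: s1 s2; lra.
Qed.

Lemma g1_at_le0 (h : step G) (W : gridfun h) j k : g1_at beta f W j k <= 0.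
Proof. by rewrite g1_atE//; exact: nham1_le0. Qed.

Lemma g2_at_ge0 (h : step G) (W : gridfun h) j k : 0 <= g2_at beta f W j k.
Proof. by rewrite g2_atE//; exact: nham2_ge0. Qed.

Lemma ratio_near : exists2 B, 0 <= B & \forall h \near mesh_to0 G,
  forall j k, (k <= nst h j)%N -> 0 <= gat (grid_div (M h) (mu h)) j k <= B.
Proof.
have [a a0 aP] := diffusion_ge.
have b0 : 0 < m0 / 2 by rewrite divr_gt0.
exists (Num.max 0 (ratio_bound (G := G) a (m0 / 2) residual_bound)).
  by rewrite le_max lexx.
have near_all := mesh_and scheme_facts (mesh_and mass_half UK).
apply: mesh_impl near_all => h [[[HS Uc Md mean] [cM FM]] [hm UKh]] j k kN.
apply/andP; split.
  by rewrite /grid_div /gat divr_ge0 ?grid_density_gat//; exact: ltW (sampled_gt0 hm kN).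
rewrite le_max; apply/orP; right.
have mub i l : (l <= nst h i)%N -> m0 / 2 <= gat (mu h) i l.
  by move=> lN; case/andP: (sampled_bounds hm lN).
have mid_ge i l : (l < nst h i)%N -> a <= nu i * mid (mu h) i l.
  by move=> lN; exact: mid_sampled.
have res_le i l : (l < nst h i)%N -> `|flux nu (g1_at beta f (U h))
    (g2_at beta f (U h)) (mu h) i l - sampled_c h i| <= residual_bound.
  by move=> lN; exact: flux_residual_le.
exact: (ratio_le a0 b0 mid_ge (g1_at_le0 (U h)) (g2_at_ge0 (U h)) mub Md
  (sampled_continuous h) (sampled_mass hm) FM (sampled_kirchhoff h) res_le).
Qed.

(** * Convergence of the slopes, the densities and the constants *)

Section BoundedRatio.
Variable B : R.
Hypothesis B0 : 0 <= B.
Hypothesis MB : \forall h \near mesh_to0 G,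
  forall j k, (k <= nst h j)%N -> 0 <= gat (grid_div (M h) (mu h)) j k <= B.

Lemma ratioK h j k : 1 / 2 <= mass h <= 2 -> (k <= nst h j)%N ->
  gat (M h) j k = gat (grid_div (M h) (mu h)) j k * gat (mu h) j k.
Proof.
move=> hm kN; rewrite {1}/gat /grid_div [gat (fun _ _ => _) _ _]/gat.
by rewrite divfK// gt_eqF//; exact: sampled_gt0.
Qed.

Definition density_gap : R := B * (2 * Cm) + 2 * Cm.

Lemma density_gap_ge0 : 0 <= density_gap.
Proof. by rewrite addr_ge0// !mulr_ge0. Qed.

Lemma density_gap_le h j k : 1 / 2 <= mass h <= 2 ->
  (forall j k, (k <= nst h j)%N -> 0 <= gat (grid_div (M h) (mu h)) j k <= B) ->
  (k <= nst h j)%N -> `|gat (grid_sub (M h) (mu h)) j k| <= density_gap.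
Proof.
move=> hm rB kN; rewrite -[gat (grid_sub _ _) j k]/(gat (M h) j k - gat (mu h) j k).
have /andP[_ s2] := sampled_bounds hm kN; have s0 := ltW (sampled_gt0 hm kN).
have /andP[r0 r1] := rB j k kN.
apply: le_trans (ler_normB _ _) _; rewrite (ratioK hm kN) /density_gap.
apply: lerD; last by rewrite ger0_norm.
by rewrite normrM !ger0_norm//; apply: ler_pM.
Qed.

(** Were the pairing negative, monotonicity would make the densities coincide,
    and the pairing would vanish. *)
Lemma coupling_pairing_ge0 (h : step G) (W W' : gridfun h) :
  grid_density W -> grid_density W' ->
  0 <= ginner (grid_sub (Vh W) (Vh W')) (grid_sub W W').
Proof.
move=> Wd Wd'; have [//|lt0] := lerP 0 (ginner (grid_sub (Vh W) (Vh W')) (grid_sub W W')).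
have e := VhV2 Wd Wd' (ltW lt0); move: lt0; rewrite e ginnerBl subrr ltxx.
by [].
Qed.

(** In [gap_identity], the residuals are paired with bounded quantities: the
    densities and the slopes. *)
Lemma gap_near e : 0 < e -> \forall h \near mesh_to0 G,
  nodes h (fun j k => h j * gat (mu h) j k *
    gap beta (Dp (w h) j k) (Dp (w h) j k.-1) (Dp (U h) j k) (Dp (U h) j k.-1)) <= e.
Proof.
have lin (a b c x y z t : R) : a + b + c = x - y - z -> 0 <= a -> 0 <= c ->
    x <= t / 3 -> - y <= t / 3 -> - z <= t / 3 -> b <= t by lra.
move=> e0; have e3 : 0 < e / 3 by rewrite divr_gt0.
have Q0 := density_gap_ge0; have L0 := ltW L_gt0.
have [d d0 dP] := small_factor (mulr_ge0 Q0 L0) e3.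
have K2 : 0 <= 2 * K by rewrite mulr_ge0// K_ge0.
pose Sg := \sum_j 2 * (nu j * Cu + (C + `|lambda|)).
have mq0 := mesh_lin_near G (#|I|%:R * density_gap * Sg) e3.
have near_all := mesh_and (mesh_and scheme_facts (mesh_and mass_half (mesh_and UK MB)))
  (mesh_and (hjb_residual_near d0) (mesh_and (fp_residual_L1 K2 e3) mq0)).
apply: mesh_impl near_all => h [[[[HS Uc Md mean] [cM FM]] [hm [UKh rB]]] [tau_le [e_le mq]]].
have mud := sampled_density hm; have [muc _ mu1] := mud; have [Mc M0 M1] := Md.
have [v0 [v00 v01]] := gcontinuousP (gcontinuousB Mc muc).
(* The grid functions have no value at a vertex without edges, where [v0] is
   arbitrary. *)
pose v i := if `|v0 i| <= density_gap then v0 i else 0.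
have vP : vertex_values (grid_sub (M h) (mu h)) v.
  split=> j; rewrite ?v00 ?v01 /v; case: ifP => //.
    by rewrite -v00 density_gap_le.
  by rewrite -v01 density_gap_le.
have vQ i : `|v i| <= density_gap.
  by rewrite /v; case: ifP => // _; rewrite normr0.
have Hw j k : (1 <= k < nst h j)%N -> - nu j * D2 (w h) j k + g_at beta f (w h) j k
    + lambda = gat (Vh (mu h)) j k + hjb_residual h j k.
  by move=> _; rewrite /hjb_residual [RHS]addrC subrK.
have Fw j k : (k < nst h j)%N -> flux nu (g1_at beta f (w h)) (g2_at beta f (w h))
    (mu h) j k = sampled_c h j + fp_residual h j k.
  by move=> _; rewrite /fp_residual [RHS]addrC subrK.
have mass_eq : ginner (M h) (one h) = ginner (mu h) (one h) by rewrite M1 mu1.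
have id := gap_identity beta2 Uc (gcontinuous_proj h u) mass_eq vP HS FM Hw
  (sampled_kirchhoff h) Fw.
have pair0 := coupling_pairing_ge0 Md mud.
have gM0 : 0 <= nodes h (fun j k => h j * gat (M h) j k *
   gap beta (Dp (U h) j k) (Dp (U h) j k.-1) (Dp (w h) j k) (Dp (w h) j k.-1)).
  apply: nodes_ge0 => j k _; apply: mulr_ge0; last exact: gap_ge0.
  by rewrite mulr_ge0 ?stp_ge0 ?grid_density_gat.
have p1 : nodes h (fun j k => h j * hjb_residual h j k * gat (grid_sub (M h) (mu h)) j k)
    <= e / 3.
  apply: le_trans dP; rewrite [leRHS]mulrAC.
  apply: nodes_const_le; first by rewrite mulr_ge0// ltW.
  move=> j k kN; rewrite -mulrA ler_wpM2l ?stp_ge0// mulrC.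
  apply: le_trans (ler_norm _) _; rewrite normrM; apply: ler_pM => //.
    by apply: density_gap_le => //; case/andP: kN => _ /ltnW.
  by move: j k kN; exact: tau_le.
have p2 : - (\sum_i v i * S_op nu (w h) (grid_sub (Vh (mu h)) (grid_const lambda)) i)
    <= e / 3.
  apply: le_trans mq; apply: le_trans (ler_norm _) _; rewrite normrN.
  apply: le_trans (ler_norm_sum _ _ _) _.
  have -> : #|I|%:R * density_gap * Sg * mesh h = \sum_(i : I) density_gap * (mesh h * Sg).
    by rewrite sumr_const -mulr_natl; ring.
  apply: ler_sum => i _; rewrite normrM; apply: ler_pM => //.
  apply: (sigma_consistency nu0 uD Cu0 uC).
  - by rewrite addr_ge0.
  - by have [+ _ _] := TC i.
  - move=> j k kN; rewrite -[gat (grid_sub _ _) j k]/(gat (Vh (mu h)) j k - lambda).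
    by apply: le_trans (ler_normB _ _) _; rewrite lerD2r VhC.
have p3 : - cells h (fun j k => fp_residual h j k * incr (grid_sub (U h) (w h)) j k)
    <= e / 3.
  apply: le_trans e_le.
  apply: le_trans (ler_norm _) _; rewrite normrN.
  apply: le_trans (norm_cells _ _) _; rewrite cellsZ; apply: le_cells => j k kN.
  rewrite normrM incrE normrM (ger0_norm (stp_ge0 h j)) DpB.
  have -> : 2 * K * (h j * `|fp_residual h j k|) =
    `|fp_residual h j k| * (h j * (2 * K)) by ring.
  rewrite ler_wpM2l// ler_wpM2l ?stp_ge0// (le_trans (ler_normB _ _))//.
  by rewrite mulr_natl mulr2n lerD ?UKh ?wK.
exact: lin id gM0 pair0 p1 p2 p3.
Qed.

Lemma dslope2_near c e : 0 <= c -> 0 < e -> \forall h \near mesh_to0 G,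
  c * nodes h (fun j k => h j * dslope2 (U h) (w h) j k) <= e.
Proof.
move=> c0 e0; have e2 : 0 < e / 2 by rewrite divr_gt0.
have L0 := ltW L_gt0; have b0 : 0 < m0 / 2 by rewrite divr_gt0.
have cL : 0 <= c * (4 * L) by rewrite mulr_ge0// mulr_ge0.
have [d d0 dP] := small_factor cL e2.
have p0 : 0 < m0 / 2 * d `^ (beta / 2 - 1) by rewrite mulr_gt0// powR_gt0.
have cp : 0 <= c * (2 / (m0 / 2 * d `^ (beta / 2 - 1))).
  by rewrite mulr_ge0// divr_ge0// ltW.
have [d' d'0 d'P] := small_factor cp e2.
have near_all := mesh_and (mass_half) (gap_near d'0).
apply: mesh_impl near_all => h [hm gle].
have mub j k : (k <= nst h j)%N -> m0 / 2 <= gat (mu h) j k.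
  by move=> kN; case/andP: (sampled_bounds hm kN).
apply: le_trans (ler_wpM2l c0 (nodes_dslope2_le (U h) (w h) beta2 b0 d0 mub)) _.
have eE : e = e / 2 + e / 2 by field.
rewrite mulrDr [leRHS]eE; apply: lerD.
  by have -> : c * (4 * d * L) = c * (4 * L) * d by ring.
rewrite mulrA; apply: le_trans d'P; rewrite ler_wpM2l//.
Qed.

Lemma dslope_near c e : 0 <= c -> 0 < e -> \forall h \near mesh_to0 G,
  c * nodes h (fun j k => h j * (`|dneg (U h) (w h) j k| + `|dpos (U h) (w h) j k|)) <= e.
Proof.
move=> c0 e0; have e2 : 0 < e / 2 by rewrite divr_gt0.
have L0 := ltW L_gt0.
have cL : 0 <= c * (2 * L) by rewrite mulr_ge0// mulr_ge0.
have [d d0 dP] := small_factor cL e2.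
have cd : 0 <= c * d^-1 by rewrite mulr_ge0// invr_ge0 ltW.
apply: mesh_impl (dslope2_near cd e2) => h le2.
apply: le_trans (ler_wpM2l c0 (nodes_dslope_le (U h) (w h) d0)) _.
have eE : e = e / 2 + e / 2 by field.
rewrite mulrDr [leRHS]eE; apply: lerD; last by rewrite mulrA.
by have -> : c * (2 * d * L) = c * (2 * L) * d by ring.
Qed.

Lemma variation_near c e : 0 <= c -> 0 < e -> \forall h \near mesh_to0 G,
  c * variation (grid_sub (U h) (w h)) <= e.
Proof.
move=> c0 e0; have e2 : 0 < e / 2 by rewrite divr_gt0.
have cK : 0 <= c * (4 * K) by rewrite mulr_ge0// mulr_ge0// K_ge0.
have near_all := mesh_and (mesh_and UK (dslope_near c0 e2)) (sum_step_near G cK e2).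
apply: mesh_impl near_all => h [[UKh le1] le2].
have wKh j k : (k < nst h j)%N -> `|Dp (w h) j k| <= K by exact: wK.
apply: le_trans (ler_wpM2l c0 (variation_sub_le UKh wKh)) _.
have eE : e = e / 2 + e / 2 by field.
by rewrite mulrDr [leRHS]eE; apply: lerD => //; rewrite mulrA.
Qed.

(** The difference of the grid functions is continuous across the vertices and
    its total variation is controlled by the slopes, while both functions have
    a mean close to zero. *)
Lemma value_near e : 0 < e -> \forall h \near mesh_to0 G,
  forall j k, (k <= nst h j)%N -> `|gat (U h) j k - edge G u j (ycoord h j k)| <= e.
Proof.
move=> e0; have e2 : 0 < e / 2 by rewrite divr_gt0.
have dg : 0 <= (#|I|.+2)%:R :> R by [].
have near_all := mesh_and scheme_facts (mesh_and (variation_near dg e2)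
  (mesh_lin_near G Cu e2)).
apply: mesh_impl near_all => h [[[_ Uc _ mean] _] [vle mle]] j k kN.
have pc := gcontinuousB Uc (gcontinuous_proj h u).
have one0 j' k' : (k' <= nst h j')%N -> 0 <= gat (one h) j' k' by rewrite gat_const.
have W0 : 0 < ginner (one h) (one h) by rewrite ginner1 L_gt0.
have := mean_osc 0 pc one0 W0 kN.
rewrite ginner1 mul0r !subr0 -gat_proj//.
rewrite -[gat (grid_sub _ _) j k]/(gat (U h) j k - gat (w h) j k) => le.
apply: le_trans le _.
have eE : e = e / 2 + e / 2 by field.
rewrite [leRHS]eE; apply: lerD => //.
rewrite ginnerBl mean sub0r normrN ler_pdivrMr ?L_gt0//.
have := ginner_proj_integral h Cu0 uD uC; rewrite mean0 subr0 => le'.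
by apply: le_trans le' _; rewrite ler_wpM2r// ltW// L_gt0.
Qed.

(** The fluxes of [mu] for the drifts of [U] and of [w] are as close as the
    slopes, and the latter flux is constant on edges up to [fp_residual]. *)
Lemma ratio_to1_near e : 0 < e -> \forall h \near mesh_to0 G,
  forall j k, (k <= nst h j)%N -> `|gat (grid_div (M h) (mu h)) j k - 1| <= e.
Proof.
have lin (c x y z p q r s t v T : R) : 0 <= p -> v <= r * T + s * x -> p * s = c ->
    x <= 2 * y + q * z -> c * 2 * y <= t / 3 -> c * (q) * z <= t / 3 ->
    p * T * r <= t / 3 -> 0 <= c -> p * v <= t.
  move=> p0 vle ps xle h1 h2 h3 cc.
  have : p * v <= p * (r * T + s * x) by rewrite ler_wpM2l.
  have : c * x <= c * (2 * y + q * z) by rewrite ler_wpM2l.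
  have -> : p * (r * T + s * x) = p * T * r + c * x by rewrite -ps; ring.
  have -> : c * (2 * y + q * z) = c * 2 * y + c * q * z by ring.
  by lra.
move=> e0; have e3 : 0 < e / 3 by rewrite divr_gt0.
have L0 := ltW L_gt0; have [a a0 aP] := diffusion_ge.
pose D : R := (#|I|.+2)%:R; have D0 : 0 <= D by [].
have [d d0 dP] := small_factor (mulr_ge0 D0 L0) e3.
have c0 : 0 <= D * (B ^+ 2 / (a ^+ 2 * d)).
  by rewrite mulr_ge0// divr_ge0 ?sqr_ge0// mulr_ge0 ?sqr_ge0// ltW.
set c := D * _ in c0.
have Hl0 := hlip_ge0 K beta2.
have c2 : 0 <= c * 2 by rewrite mulr_ge0.
have c16 : 0 <= c * (16 * (2 * Cm * hlip beta K) ^+ 2).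
  by rewrite mulr_ge0// mulr_ge0// sqr_ge0.
have near_all := mesh_and (mesh_and scheme_facts (mesh_and mass_half (mesh_and UK MB)))
  (mesh_and (fp_residual_L2 c2 e3) (dslope2_near c16 e3)).
apply: mesh_impl near_all => h [[[[HS Uc Md mean] [cM FM]] [hm [UKh rB]]] [le1 le2]].
move=> j k kN; have [Mc M0 M1] := Md.
have mu0 j' k' : (k' <= nst h j')%N -> 0 < gat (mu h) j' k' by exact: sampled_gt0.
have mub j' k' : (k' <= nst h j')%N -> 0 <= gat (mu h) j' k' <= 2 * Cm.
  move=> kN'; have /andP[_ s2] := sampled_bounds hm kN'.
  by rewrite s2 andbT ltW// mu0.
have muc := sampled_continuous h.
apply: le_trans (ratio_osc Mc muc mu0 M1 (sampled_mass hm) kN) _; rewrite -/D.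
have midge j' k' : (k' < nst h j')%N -> a <= nu j' * mid (mu h) j' k'.
  by move=> kN'; exact: mid_sampled.
have := variation_ratio_le a0 d0 midge (g1_at_le0 (U h)) (g2_at_ge0 (U h)) mu0 Mc muc
  FM (sampled_kirchhoff h) rB.
have slope_lip j' k' : (1 <= k' < nst h j')%N ->
   `|g1_at beta f (U h) j' k' - g1_at beta f (w h) j' k'| <=
     hlip beta K * (`|dneg (U h) (w h) j' k'| + `|dpos (U h) (w h) j' k'|) /\
   `|g2_at beta f (U h) j' k' - g2_at beta f (w h) j' k'| <=
     hlip beta K * (`|dneg (U h) (w h) j' k'| + `|dpos (U h) (w h) j' k'|).
  move=> /andP[_ kN']; have kN1 : (k'.-1 < nst h j')%N by rewrite (leq_ltn_trans (leq_pred _)).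
  rewrite (g1_atE f (U h))// (g1_atE f (w h))// (g2_atE f (U h))// (g2_atE f (w h))//.
  split; [apply: nham1_lip => //|apply: nham2_lip => //];
    by [exact: UKh|exact: wK].
have := @flux_sub_le _ _ _ _ _ h (U h) (w h) nu (g1_at beta f (U h)) (g2_at beta f (U h))
  (g1_at beta f (w h)) (g2_at beta f (w h)) (mu h) (sampled_c h) (hlip beta K) (2 * Cm)
  Hl0 (fun j' k' kN' => (slope_lip j' k' kN').1) (fun j' k' kN' => (slope_lip j' k' kN').2)
  mub.
rewrite -/(fp_residual h).
move=> XY vX.
exact: lin D0 vX erefl XY le1 le2 dP c0.
Qed.

Lemma density_near e : 0 < e -> \forall h \near mesh_to0 G,
  forall j k, (k <= nst h j)%N -> `|gat (M h) j k - edge G m j (ycoord h j k)| <= e.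
Proof.
move=> e0; have e2 : 0 < e / 2 by rewrite divr_gt0.
have c0 : 0 <= 2 * Cm by rewrite mulr_ge0.
have [d d0 dP] := small_factor c0 e2.
have near_all := mesh_and mass_half (mesh_and (ratio_to1_near d0) (sampled_near e2)).
apply: mesh_impl near_all => h [hm [r1 s1]] j k kN.
have -> : gat (M h) j k - edge G m j (ycoord h j k) =
   gat (mu h) j k * (gat (grid_div (M h) (mu h)) j k - 1) +
   (gat (mu h) j k - edge G m j (ycoord h j k)).
  by rewrite (ratioK hm kN); ring.
have eE : e = e / 2 + e / 2 by field.
rewrite [leRHS]eE; apply: le_trans (ler_normD _ _) _; apply: lerD; last exact: s1.
apply: le_trans dP; rewrite normrM; apply: ler_pM => //; last exact: r1.
have /andP[_ s2] := sampled_bounds hm kN.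
by rewrite ger0_norm// ltW// sampled_gt0.
Qed.

(** Of the four terms of [ergodic_sub_le], the first needs the convergence of the
    densities, the second that of the slopes; the others are residuals. *)
Lemma ergodic_near e : 0 < e -> \forall h \near mesh_to0 G, `|Lambda h - lambda| <= e.
Proof.
have tri (a b c d : R) : `|a - b - c + d| <= `|a| + `|b| + `|c| + `|d|.
  by rewrite (le_trans (ler_normD _ _))// lerD2r (le_trans (ler_normB _ _))//
    lerD2r ler_normB.
move=> e0; have L0 := L_gt0; have eL : 0 < e * L / 4 by rewrite divr_gt0// mulr_gt0.
have [d d0 dP] := small_factor (ltW L0) eL.
have d2 : 0 < d / 2 by rewrite divr_gt0.
pose Lp := beta * hbox beta K * Num.sqrt (K ^+ 2 + K ^+ 2).
have Lp0 : 0 <= Lp.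
  by rewrite !mulr_ge0 ?powR_ge0 ?sqrtr_ge0//; apply: le_trans beta2.
pose Sg := \sum_j 2 * (nu j * Cu + (C + `|lambda|)).
have Mdn : \forall h \near mesh_to0 G, grid_density (M h).
  by apply: mesh_impl scheme_facts => h [[]].
have near_all := mesh_and (mesh_and scheme_facts (mesh_and mass_half UK))
  (mesh_and (mesh_and (dslope_near Lp0 eL) (hjb_residual_near d0))
    (mesh_and (mesh_and (@coupling_near M Mdn density_near _ d2) (sampled_coupling d2))
       (mesh_lin_near G (#|I|%:R * Sg) eL))).
apply: mesh_impl near_all => h
  [[[[HS Uc Md mean] [cM FM]] [hm UKh]] [[le1 le2] [[le3 le4] le5]]].
have Hw j k : (1 <= k < nst h j)%N -> - nu j * D2 (w h) j k + g_at beta f (w h) j k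
    + lambda = gat (Vh (mu h)) j k + hjb_residual h j k.
  by move=> _; rewrite /hjb_residual [RHS]addrC subrK.
have id := ergodic_sub_le beta2 HS Hw.
rewrite -(ler_pM2r L0) -[X in _ * X <= _](gtr0_norm L0) -normrM id.
have eE : e * L = e * L / 4 + e * L / 4 + e * L / 4 + e * L / 4 by field.
apply: le_trans (tri _ _ _ _) _; rewrite [leRHS]eE.
apply: lerD; first (apply: lerD; first apply: lerD).
- apply: le_trans dP; rewrite mulrC.
  have one0 j' k' : (k' <= nst h j')%N -> 0 <= gat (one h) j' k' by rewrite gat_const.
  rewrite -(ginner1 h); apply: ginner_norm_le => // j k kN.
  rewrite -[gat (grid_sub _ _) j k]/(gat (Vh (M h)) j k - gat (Vh (mu h)) j k).
  have h1 := le3 j k kN; have h2 := le4 j k kN.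
  have -> : gat (Vh (M h)) j k - gat (Vh (mu h)) j k =
    (gat (Vh (M h)) j k - V m (node h j k)) - (gat (Vh (mu h)) j k - V m (node h j k)) by ring.
  rewrite (le_trans (ler_normB _ _))//; have -> : d = d / 2 + d / 2 by field.
  exact: lerD.
- apply: le_trans le1; apply: le_trans (norm_nodes _ _) _.
  rewrite nodesZ; apply: le_nodes => j k /andP[k1 kN].
  have kN1 : (k.-1 < nst h j)%N by rewrite (leq_ltn_trans (leq_pred _)).
  rewrite normrM (ger0_norm (stp_ge0 h j)) [leRHS]mulrCA ler_wpM2l ?stp_ge0//.
  by apply: nham_lip => //; [exact: UKh|exact: UKh|exact: wK|exact: wK].
- apply: le_trans dP; apply: le_trans (norm_nodes _ _) _; rewrite mulrC.
  apply: nodes_const_le; first exact: ltW.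
  move=> j k kN; rewrite normrM (ger0_norm (stp_ge0 h j)) ler_wpM2l ?stp_ge0//.
  exact: le2.
- apply: le_trans le5; apply: le_trans (ler_norm_sum _ _ _) _.
  have -> : #|I|%:R * Sg * mesh h = \sum_(i : I) (mesh h * Sg).
    by rewrite sumr_const -mulr_natl; ring.
  apply: ler_sum => i _; apply: (sigma_consistency nu0 uD Cu0 uC).
  + by rewrite addr_ge0.
  + by have [+ _ _] := TC i.
  + move=> j k kN; rewrite -[gat (grid_sub _ _) j k]/(gat (Vh (mu h)) j k - lambda).
    apply: le_trans (ler_normB _ _) _; rewrite lerD2r VhC//.
    exact: sampled_density.
Qed.

End BoundedRatio.
End BoundedSlopes.

Lemma convergence :
  grid_norm (grid_sub (U h) (grid_proj h u)) + grid_norm (grid_sub (M h) (grid_proj h m))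
    + `|Lambda h - lambda| @[h --> mesh_to0 G] --> (0 : R).
Proof.
have [K CuK UK] := slope_near; have [B B0 MB] := ratio_near CuK UK.
apply/cvgrPdist_le => e e0; have e3 : 0 < e / 3 by rewrite divr_gt0.
have near_all := mesh_and (value_near CuK UK B0 MB e3)
  (mesh_and (density_near CuK UK B0 MB e3) (ergodic_near CuK UK B0 MB e3)).
apply: mesh_impl near_all => h [h1 [h2 h3]].
have n1 : grid_norm (grid_sub (U h) (grid_proj h u)) <= e / 3.
  apply: grid_norm_le; first exact: ltW.
  by move=> j k kN; have := h1 j k kN; rewrite -gat_proj.
have n2 : grid_norm (grid_sub (M h) (grid_proj h m)) <= e / 3.
  apply: grid_norm_le; first exact: ltW.
  by move=> j k kN; have := h2 j k kN; rewrite -gat_proj.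
rewrite sub0r normrN ger0_norm; last by rewrite !addr_ge0 ?grid_norm_ge0.
have -> : e = e / 3 + e / 3 + e / 3 by field.
by rewrite !lerD.
Qed.

End Convergence.

Theorem theorem3p3 (R : realType) (n : nat) (I J : finType)
    (G : network R n I J) (nu : J -> R) (alpha beta : R)
    (f : 'rV[R]_n -> R) (V : ('rV[R]_n -> R) -> 'rV[R]_n -> R)
    (Vh : forall h : step G, gridfun h -> gridfun h)
    (u m : 'rV[R]_n -> R) (lambda : R)
    (U M : forall h : step G, gridfun h) (Lambda : step G -> R) :
  (forall j, 0 < nu j) ->
  0 < alpha <= 1 ->
  2 <= beta ->
  net_continuous G f ->
  coupling_V1 Vh -> coupling_V2 Vh -> coupling_V3 Vh ->
  coupling_V4 V Vh alpha ->
  mfg_solution G nu alpha beta f V u m lambda ->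
  (\forall h \near mesh_to0 G,
     scheme_solution beta f nu (@Vh h) (U h) (M h) (Lambda h)) ->
  grid_norm (grid_sub (U h) (grid_proj h u)) + grid_norm (grid_sub (M h) (grid_proj h m))
    + `|Lambda h - lambda| @[h --> mesh_to0 G] --> (0 : R).
Proof.
move=> nu0 /andP[alpha0 alpha1] beta2 _ _ V2 [C VC] V4.
move=> [uC2 [mC2 mpos] [HJB FP] [mass1 mean0] TC] scheme.
have [Cu Cu0 uC] := @C2_lip_slopes _ _ _ _ G (edge G u) (fun j => (uC2.2 j).1).
have [Cm Cm0 mC] := @C2_lip_slopes _ _ _ _ G (edge G m) mC2.2.
have [Ch Ch0 uH] := holder_constant uC2.
have [m0 m00 mge] := density_lower_bound mC2 mpos.
have VhC (h : step G) (W : gridfun h) j k : grid_density W -> `|gat (Vh h W) j k| <= `|C|.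
  move=> Wd; have [Wle _] := VC h W Wd.
  apply: le_trans (gat_norm_le _ _ _) _.
  exact: le_trans Wle (ler_norm _).
have uD j : derivable_seg (len G j) (edge G u j) by have [[]] := uC2.2 j.
have uD2 j : derivable_seg (len G j) (dseg (len G j) (edge G u j)).
  by have [[]] := uC2.2 j.
have mD j : derivable_seg (len G j) (edge G m j) by have [] := mC2.2 j.
have mD2 j : derivable_seg (len G j) (dseg (len G j) (edge G m j)).
  by have [] := mC2.2 j.
have J0 := inhabited_edges mass1.
exact (@convergence _ _ _ _ _ _ _ _ _ _ _ _ _ _ _ _ _ nu0 alpha0 alpha1 beta2 J0 _ _ _ _ _
  Cu0 Ch0 Cm0 m00 (normr_ge0 C) uD uD2 uC uH mD mD2 mC mge mC2.1 HJB FP mass1 mean0 TC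
  VhC V2 V4 scheme).
Qed.
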